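(* Let $d\ge1$, $\sigma\in\mathbb{R}$. Let $f:\mathbb{R}\to\mathbb{R}$ satisfy Assumption (F), let $\dot W$ satisfy Assumption (N), and let the initial data $x\mapsto u(0,x)$ satisfy Assumption (I) (written out in the context). Assume in addition that there exists $\varepsilon\in(0,1)$ such that the local Lipschitz constants $L(R)$ of $f$ from Assumption (F)(1) satisfy $$\lim_{R\to+\infty}\frac{L(R)}{(\log R)^{1+\varepsilon}}=0 .$$ Let $\nu\in(0,2/(1+\varepsilon))$ and $T>0$. Then there exists at most one weak solution $u(t,x)$, $t\in[0,T]$, with the given initial data, to $\frac{\partial u}{\partial t}=\frac12\Delta u+f(u)+\sigma\dot W$ on $\mathbb{R}^d$ that satisfies the growth condition $$\mathbb{P}\left(\sup_{t\in[0,T]}\sup_{x\in\mathbb{R}^d}|u(t,x)|e^{-|x|^\nu}<+\infty\right)=1 .$$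
   Context: Assumption (F): (1) $f:\mathbb{R}\to\mathbb{R}$ is locally Lipschitz: there is an increasing function $L:[0,+\infty)\to[0,+\infty)$ such that $|f(u_1)-f(u_2)|\le L(R)|u_1-u_2|$ whenever $|u_1|\le R$, $|u_2|\le R$. (2) There is a function $h:[0,+\infty)\to(0,+\infty)$ that is strictly positive, twice differentiable, increasing and strictly convex, satisfies $\int_0^\infty\frac{1}{h(x)}dx=+\infty$, satisfies $h(x)\le C(1+|x|^p)$ for some $C>0$, $p>1$, and satisfies $|f(x)|\le h(|x|)$ for all $x\in\mathbb{R}$. (3) With $H(x)=\int_0^x\frac{1}{h(y)}dy$, for every $t>0$ there exist $\nu_t\in(0,2)$ and $C_t>0$ such that $H^{-1}(H(x)+t)\le C_t\exp(\exp(|x|^{\nu_t}))$ for all $x>0$. (4) For $\alpha>1$, the function $h_\alpha(x):=\frac{h(x^\alpha)}{x^{\alpha-1}}$ is convex for $x\ge1$. Assumption (N): $\dot W$ is a centered Gaussian noise on $[0,\infty)\times\mathbb{R}^d$, white in time and spatially homogeneous, with covariance formally $\mathbb{E}\,\dot W(t,x)\dot W(s,y)=\delta(t-s)\Lambda(x-y)$, where $\delta$ is the Dirac measure and $\Lambda$ is a positive and positive definite generalized function whose Fourier transform $\mu=\mathcal{F}(\Lambda)$ (a nonnegative measure) satisfies $\int_{\mathbb{R}^d}\frac{\mu(d\xi)}{1+|\xi|^{2(1-\eta)}}<+\infty$ for some $\eta\in(0,1)$. Stochastic integrals against $W$ are in the sense of Walsh. Assumption (I): $x\mapsto u(0,x)$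 is continuous and $\sup_{x\in\mathbb{R}^d}\frac{|u(0,x)|}{\sqrt{\log(e+|x|^2)}}<+\infty$. Weak solution: a random field $u(t,x)$ is a weak solution (for $t\in[0,T]$) if for any twice-differentiable test function $\phi:\mathbb{R}^d\to\mathbb{R}$ with compact support, with probability one, for all $t\in[0,T]$, $$\int_{\mathbb{R}^d}u(t,x)\phi(x)dx-\int_{\mathbb{R}^d}u(0,x)\phi(x)dx=\int_0^t\int_{\mathbb{R}^d}u(s,x)\tfrac12\Delta\phi(x)dxds+\int_0^t\int_{\mathbb{R}^d}f(u(s,x))\phi(x)dxds+\int_0^t\int_{\mathbb{R}^d}\sigma\phi(x)W(dxds).$$ ''At most one'' means: if $u_1,u_2$ are two such solutions (same noise, same initial data), then with probability one, for every $t\in[0,T]$, $u_1(t,x)=u_2(t,x)$ for almost every $x\in\mathbb{R}^d$. *)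

(* Defs.v *)
From HB Require Import structures.
From mathcomp Require Import all_boot all_order all_algebra.
From mathcomp Require Import all_classical all_reals all_analysis.

Set Implicit Arguments.
Unset Strict Implicit.
Unset Printing Implicit Defensive.

Import Order.TTheory GRing.Theory Num.Theory.
Import numFieldNormedType.Exports.

Local Open Scope classical_set_scope.
Local Open Scope ring_scope.

(* The library's `|x| on 'rV[R]_d is the sup norm, hence the explicit
   Euclidean structure. *)
Definition dotrv (R : realType) (d : nat) (x y : 'rV[R]_d) : R :=
  \sum_(i < d) x ord0 i * y ord0 i.

Definition enorm (R : realType) (d : nat) (x : 'rV[R]_d) : R :=
  Num.sqrt (dotrv x x).

(* R^d gets the sigma-algebra generated by the coordinates, which is the Borel
   one; same construction as the library's instance on n.-tuple T. *)
Definition rv_display : measure_display.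
Proof. exact: default_measure_display. Qed.

Section measurable_rv.
Variables (R : realType) (d : nat).

Let coors : 'I_d -> 'rV[R]_d -> measurableTypeR R := fun i x => x ord0 i.

Let rv_set0 : g_sigma_preimage coors set0.
Proof. exact: sigma_algebra0. Qed.

Let rv_setC A : g_sigma_preimage coors A -> g_sigma_preimage coors (~` A).
Proof. exact: sigma_algebraC. Qed.

Let rv_bigcup (F : _^nat) : (forall i, g_sigma_preimage coors (F i)) ->
  g_sigma_preimage coors (\bigcup_i (F i)).
Proof. exact: sigma_algebra_bigcup. Qed.

HB.instance Definition _ := @isMeasurable.Build rv_display
  'rV[R]_d (g_sigma_preimage coors) rv_set0 rv_setC rv_bigcup.

Lemma measurable_coord (i : 'I_d) :
  measurable_fun [set: 'rV[R]_d] (fun x : 'rV[R]_d => x ord0 i).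
Proof.
move=> _ Y mY; rewrite setTI; apply: sub_sigma_algebra => /=.
rewrite -bigcup_seq/=; exists i => /=; first by rewrite mem_index_enum.
by exists Y => //; rewrite setTI.
Qed.

Lemma measurable_fun_rvP d1 (T1 : measurableType d1) (f : T1 -> 'rV[R]_d) :
  (forall i, measurable_fun [set: T1] (fun z => f z ord0 i)) ->
  measurable_fun [set: T1] f.
Proof.
move=> mf _ A mA; rewrite setTI; move: A mA.
suff : g_sigma_preimage (fun i => coors i \o f) `<=` measurable.
  rewrite g_sigma_preimage_comp => prefS A mA; apply: prefS.
  by exists A => //; rewrite setTI.
apply: smallest_sub; first exact: sigma_algebra_measurable.
rewrite -bigcup_seq; apply: bigcup_sub => i _ A [B mB <-].
exact: mf.
Qed.

End measurable_rv.

Definition cons_rv (R : realType) (d : nat) (p : R * 'rV[R]_d) : 'rV[R]_d.+1 :=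
  \row_j (if unlift ord0 j is Some k then p.2 ord0 k else p.1).

Definition uncons_rv (R : realType) (d : nat) (x : 'rV[R]_d.+1) :
  R * 'rV[R]_d := (x ord0 ord0, \row_j x ord0 (lift ord0 j)).

Lemma cons_rvK (R : realType) (d : nat) :
  cancel (@cons_rv R d) (@uncons_rv R d).
Proof.
move=> [a y]; rewrite /uncons_rv /cons_rv mxE unlift_none; congr pair.
by apply/rowP => j; rewrite !mxE liftK.
Qed.

Lemma measurable_cons_rv (R : realType) (d : nat) :
  measurable_fun [set: R * 'rV[R]_d] (@cons_rv R d).
Proof.
apply: measurable_fun_rvP => i.
under eq_fun do rewrite /cons_rv mxE.
case: unliftP => [k _|_]; last exact: measurable_fst.
exact: (measurableT_comp (measurable_coord k) measurable_snd).
Qed.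

Lemma measurable_uncons_rv (R : realType) (d : nat) :
  measurable_fun [set: 'rV[R]_d.+1] (@uncons_rv R d).
Proof.
apply: (@measurable_fun_pair _ _ _ _ (measurableTypeR R)).
  exact: measurable_coord.
apply: measurable_fun_rvP => i.
under eq_fun do rewrite mxE.
exact: measurable_coord.
Qed.

(* Image of the product of one-dimensional Lebesgue measure with m under
   R x R^d = R^(d+1). *)
Definition lebesgue_cons (R : realType) (d : nat)
    (m : set 'rV[R]_d -> \bar R) : set 'rV[R]_d.+1 -> \bar R :=
  pushforward (@lebesgue_measure R \x m)%E (@cons_rv R d).

Section lebesgue_cons.
Local Open Scope ereal_scope.
Variables (R : realType) (d : nat).
Variable m : {sigma_finite_measure set 'rV[R]_d -> \bar R}.

Let mcons (A : set 'rV[R]_d.+1) :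
  measurable A -> measurable (@cons_rv R d @^-1` A).
Proof.
by move=> mA; rewrite -[X in measurable X]setTI; exact: measurable_cons_rv.
Qed.

Let cons0 : lebesgue_cons m set0 = 0.
Proof. by rewrite /lebesgue_cons /pushforward preimage_set0 measure0. Qed.

Let cons_ge0 A : 0 <= lebesgue_cons m A.
Proof. exact: (measure_ge0 (@lebesgue_measure R \x m)). Qed.

Let cons_sigma_additive : semi_sigma_additive (lebesgue_cons m).
Proof.
move=> F mF tF mUF; rewrite /lebesgue_cons /pushforward preimage_bigcup.
apply: measure_semi_sigma_additive.
- by move=> n; exact: mcons.
- apply/trivIsetP => i j _ _ ij; rewrite -preimage_setI.
  by move/trivIsetP : tF => /(_ _ _ _ _ ij) ->//; rewrite preimage_set0.
- by rewrite -preimage_bigcup; exact: mcons.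
Qed.

HB.instance Definition _ := isMeasure.Build _ _ _ (lebesgue_cons m)
  cons0 cons_ge0 cons_sigma_additive.

Let cons_sigma_finite : sigma_finite setT (lebesgue_cons m).
Proof.
have /sigma_finiteP[F [TF ndF Foo]] := sigma_finiteT (@lebesgue_measure R).
have /sigma_finiteP[G [TG ndG Goo]] := sigma_finiteT m.
exists (fun n => @uncons_rv R d @^-1` (F n `*` G n)).
  rewrite -preimage_bigcup -[LHS](preimage_setT (@uncons_rv R d)).
  congr (_ @^-1` _); rewrite -setXTT TF TG predeqE => -[x y]; split.
    move=> [/= [n _ Fnx] [k _ Gky]]; exists (maxn n k) => //; split.
    - by move: x Fnx; exact/subsetPset/ndF/leq_maxl.
    - by move: y Gky; exact/subsetPset/ndG/leq_maxr.
  by move=> [n _ []/= ? ?]; split; exists n.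
move=> n; have [mF Fn] := Foo n; have [mG Gn] := Goo n; split.
  rewrite -[X in measurable X]setTI; apply: measurable_uncons_rv => //.
  exact: measurableX.
rewrite /lebesgue_cons /pushforward -comp_preimage.
rewrite (_ : _ \o _ = id) ?preimage_id; last exact/funext/cons_rvK.
by rewrite [ltLHS]product_measure1E// lte_mul_pinfty// ge0_fin_numE.
Qed.

HB.instance Definition _ := Measure_isSigmaFinite.Build _ _ _ (lebesgue_cons m)
  cons_sigma_finite.

End lebesgue_cons.

Fixpoint lebesgue_rv (R : realType) (d : nat) :
    {sigma_finite_measure set 'rV[R]_d -> \bar R} :=
  match d with
  | 0%N => dirac (0 : 'rV[R]_0)
  | d'.+1 => lebesgue_cons (lebesgue_rv R d')
  end.

(* D_{v_1} ... D_{v_k} f for vs = [:: v_1; ...; v_k]. *)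
Definition iter_derive (R : realType) (V : normedModType R) (vs : seq V)
    (f : V -> R) : V -> R :=
  foldr (fun v (g : V -> R) => 'D_v g) f vs.

Definition class_C (R : realType) (V : normedModType R) (k : nat)
    (f : V -> R) : Prop :=
  forall vs : seq V,
    ((size vs < k)%N -> forall x, differentiable (iter_derive vs f) x) /\
    ((size vs <= k)%N -> continuous (iter_derive vs f)).

Definition smooth (R : realType) (V : normedModType R) (f : V -> R) : Prop :=
  forall k, class_C k f.

Definition compact_support (R : realType) (V : normedModType R)
    (f : V -> R) : Prop :=
  compact (closure [set x | f x != 0]).

Definition basis_rv (R : realType) (d : nat) (i : 'I_d) : 'rV[R]_d :=
  delta_mx ord0 i.

Definition laplacian (R : realType) (d : nat) (phi : 'rV[R]_d -> R)
    (x : 'rV[R]_d) : R :=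
  \sum_(i < d) iter_derive [:: basis_rv R i; basis_rv R i] phi x.

(* M bounds the N-th Schwartz seminorm
   max_{|s| <= N} sup_x (1 + |x|)^N |d_s phi x|. *)
Definition schwartz_bound (R : realType) (d : nat) (N : nat) (M : R)
    (phi : 'rV[R]_d -> R) : Prop :=
  forall s : seq 'I_d, (size s <= N)%N -> forall x : 'rV[R]_d,
    (1 + enorm x) ^+ N * `|iter_derive (map (@basis_rv R d) s) phi x| <= M.

Definition schwartz (R : realType) (d : nat) (phi : 'rV[R]_d -> R) : Prop :=
  smooth phi /\ forall N, exists M : R, schwartz_bound N M phi.

(* Real tempered distributions; only the values on Schwartz functions matter. *)
Definition tempered_distribution (R : realType) (d : nat)
    (Lam : ('rV[R]_d -> R) -> R) : Prop :=
  (forall (a : R) (phi psi : 'rV[R]_d -> R), schwartz phi -> schwartz psi ->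
     Lam (fun x => a * phi x + psi x) = a * Lam phi + Lam psi) /\
  exists (N : nat) (C : R), forall (phi : 'rV[R]_d -> R) (M : R),
    schwartz phi -> schwartz_bound N M phi -> `|Lam phi| <= C * M.

Definition positive_distribution (R : realType) (d : nat)
    (Lam : ('rV[R]_d -> R) -> R) : Prop :=
  forall phi : 'rV[R]_d -> R, schwartz phi -> (forall x, 0 <= phi x) ->
    0 <= Lam phi.

(* z |-> \int phi(x) psi(x - z) dx, so that Lam (correlation phi psi) is
   \int\int phi(x) psi(y) Lam(x - y) dx dy. *)
Definition correlation (R : realType) (d : nat) (phi psi : 'rV[R]_d -> R)
    (z : 'rV[R]_d) : R :=
  \int[lebesgue_rv R d]_x (phi x * psi (x - z)).

(* Real test functions suffice: a complex one phi + i psi contributes the terms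
   for phi and for psi plus cross terms that cancel, Lam being even as soon as
   its Fourier transform is real (see fourier_transform_of). *)
Definition positive_definite_distribution (R : realType) (d : nat)
    (Lam : ('rV[R]_d -> R) -> R) : Prop :=
  forall phi : 'rV[R]_d -> R, schwartz phi -> 0 <= Lam (correlation phi phi).

(* Real and imaginary parts of (F phi)(xi) = \int exp(- i x.xi) phi(x) dx. *)
Definition fourier_re (R : realType) (d : nat) (phi : 'rV[R]_d -> R)
    (xi : 'rV[R]_d) : R :=
  \int[lebesgue_rv R d]_x (phi x * cos (dotrv x xi)).

Definition fourier_im (R : realType) (d : nat) (phi : 'rV[R]_d -> R)
    (xi : 'rV[R]_d) : R :=
  - \int[lebesgue_rv R d]_x (phi x * sin (dotrv x xi)).

(* mu = F Lam as tempered distributions: <F Lam, phi> = <Lam, F phi>. *)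
Definition fourier_transform_of (R : realType) (d : nat)
    (Lam : ('rV[R]_d -> R) -> R) (mu : {measure set 'rV[R]_d -> \bar R}) :
    Prop :=
  forall phi : 'rV[R]_d -> R, schwartz phi ->
    [/\ mu.-integrable setT (EFin \o phi),
        Lam (fourier_re phi) = \int[mu]_xi phi xi &
        Lam (fourier_im phi) = 0].

Definition spatial_covariance (R : realType) (d : nat)
    (Lam : ('rV[R]_d -> R) -> R) (mu : {measure set 'rV[R]_d -> \bar R}) :
    Prop :=
  [/\ tempered_distribution Lam, positive_distribution Lam,
      positive_definite_distribution Lam, fourier_transform_of Lam mu &
      exists eta : R, 0 < eta < 1 /\
        (\int[mu]_xi ((1 + enorm xi `^ (2 * (1 - eta)))^-1)%:E < +oo)%E].

(* The library's normal_prob 0 0 is not the Dirac mass at 0. *)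
Definition centered_normal (R : realType) (s : R)
    (A : set (measurableTypeR R)) : \bar R :=
  if s == 0 then dirac (0 : R) A else normal_prob 0 s A.

Definition centered_gaussian (d' : measure_display) (Omega : measurableType d')
    (R : realType) (P : probability Omega R) (I : Type) (D : set I)
    (X : I -> {RV P >-> R}) : Prop :=
  forall (n : nat) (c : 'I_n -> R) (i : 'I_n -> I), (forall k, D (i k)) ->
    exists s : R, forall A : set (measurableTypeR R), measurable A ->
      P [set w | A (\sum_(k < n) c k * X (i k) w)] = centered_normal s A.

(* Test functions on the whole of R x R^d: the covariance of the noise only
   sees their restriction to [0, +oo) x R^d. *)
Definition test_function (R : realType) (d : nat)
    (psi : R * 'rV[R]_d -> R) : Prop :=
  smooth psi /\ compact_support psi.

(* The generalized random field psi |-> \int\int psi(t, x) W(dx dt):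
   E[W psi1 W psi2] = \int_0^oo \int\int psi1(s, x) psi2(s, y) Lam(x - y). *)
Definition gaussian_noise (d' : measure_display) (Omega : measurableType d')
    (R : realType) (P : probability Omega R) (d : nat)
    (Lam : ('rV[R]_d -> R) -> R)
    (W : (R * 'rV[R]_d -> R) -> {RV P >-> R}) : Prop :=
  centered_gaussian [set psi | test_function psi] W /\
  forall psi1 psi2 : R * 'rV[R]_d -> R,
    test_function psi1 -> test_function psi2 ->
    ('E_P[fun w => (W psi1 w * W psi2 w)%R] =
     (\int[lebesgue_measure]_(s in `[0%R, +oo[)
        Lam (correlation (fun x => psi1 (s, x)) (fun y => psi2 (s, y))))%:E)%E.

(* Squared norm in the Hilbert space of deterministic Walsh integrands,
   \int_0^oo \int |F g(s, .)(xi)|^2 mu(dxi) ds. *)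
Definition integrand_sqnorm (R : realType) (d : nat)
    (mu : {measure set 'rV[R]_d -> \bar R}) (g : R * 'rV[R]_d -> R) : \bar R :=
  (\int[lebesgue_measure]_(s in `[0%R, +oo[) \int[mu]_xi
     (fourier_re (fun x => g (s, x)) xi ^+ 2 +
      fourier_im (fun x => g (s, x)) xi ^+ 2)%:E)%E.

(* I is an almost surely continuous version of the process
   t |-> \int_0^t \int phi(x) W(dx ds): for each t, the limit in L^2(P) of
   W psi_n for test functions psi_n tending to 1_[0,t](s) phi(x). *)
Definition is_walsh_integral (d' : measure_display)
    (Omega : measurableType d') (R : realType) (P : probability Omega R)
    (d : nat) (mu : {measure set 'rV[R]_d -> \bar R})
    (W : (R * 'rV[R]_d -> R) -> {RV P >-> R}) (phi : 'rV[R]_d -> R)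
    (I : R -> Omega -> R) : Prop :=
  [/\ forall t, 0 <= t -> measurable_fun setT (I t),
      {ae P, forall w, {within `[0, +oo[, continuous (fun t => I t w)}} &
      forall t, 0 <= t -> exists psi : nat -> R * 'rV[R]_d -> R,
        [/\ forall n, test_function (psi n),
            integrand_sqnorm mu
              (fun z => psi n z - \1_(`[0, t]) z.1 * phi z.2)
              @[n --> \oo] --> 0%E &
            'E_P[fun w => ((W (psi n) w - I t w) ^+ 2)%R]%E
              @[n --> \oo] --> 0%E]].

(* Such versions exist and are indistinguishable for phi of class C^2 with
   compact support; one of them is chosen. *)
Definition walsh_integral (d' : measure_display)
    (Omega : measurableType d') (R : realType) (P : probability Omega R)
    (d : nat) (mu : {measure set 'rV[R]_d -> \bar R})
    (W : (R * 'rV[R]_d -> R) -> {RV P >-> R}) (phi : 'rV[R]_d -> R) :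
    R -> Omega -> R :=
  xget (fun _ _ => 0) [set I | is_walsh_integral mu W phi I].

Definition local_lipschitz (R : realType) (f L : R -> R) : Prop :=
  [/\ forall r, 0 <= r -> 0 <= L r,
      forall r1 r2, 0 <= r1 -> r1 <= r2 -> L r1 <= L r2 &
      forall r u1 u2, `|u1| <= r -> `|u2| <= r ->
        `|f u1 - f u2| <= L r * `|u1 - u2|].

(* Derivative relative to [0, +oo), hence one-sided at 0. *)
Definition derivative_on_nneg (R : realType) (g g' : R -> R) : Prop :=
  forall x, 0 <= x ->
    (fun y => (g y - g x) / (y - x))
      @ within [set y | 0 <= y] (x^') --> g' x.

Definition Hfun (R : realType) (h : R -> R) (x : R) : R :=
  \int[lebesgue_measure]_(y in `[0, x]) (h y)^-1.

Definition Hinv (R : realType) (h : R -> R) (y : R) : R :=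
  xget 0 [set z | 0 <= z /\ Hfun h z = y].

Definition growth_bound (R : realType) (f h : R -> R) : Prop :=
  [/\ forall x, 0 <= x -> 0 < h x,
      exists h1 h2 : R -> R, derivative_on_nneg h h1 /\ derivative_on_nneg h1 h2,
      forall x y, 0 <= x -> x <= y -> h x <= h y &
      forall x y t, 0 <= x -> x < y -> 0 < t < 1 ->
        h (t * x + (1 - t) * y) < t * h x + (1 - t) * h y] /\
  [/\ (\int[lebesgue_measure]_(x in `[0%R, +oo[) ((h x)^-1)%:E = +oo)%E,
      exists C p : R, [/\ 0 < C, 1 < p &
        forall x, 0 <= x -> h x <= C * (1 + x `^ p)] &
      forall x, `|f x| <= h `|x|].

Definition assumption_F (R : realType) (f L : R -> R) : Prop :=
  local_lipschitz f L /\
  exists h : R -> R,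
    [/\ growth_bound f h,
        forall t, 0 < t -> exists nu C : R,
          [/\ 0 < nu < 2, 0 < C &
            forall x, 0 < x ->
              Hinv h (Hfun h x + t) <= C * expR (expR (`|x| `^ nu))] &
        forall alpha, 1 < alpha ->
          forall x y t, 1 <= x -> 1 <= y -> 0 <= t <= 1 ->
          let h_ z := h (z `^ alpha) / z `^ (alpha - 1) in
          h_ (t * x + (1 - t) * y) <= t * h_ x + (1 - t) * h_ y].

Definition assumption_I (R : realType) (d : nat) (u0 : 'rV[R]_d -> R) : Prop :=
  continuous u0 /\
  (ereal_sup (range (fun x : 'rV[R]_d =>
     (`|u0 x| / Num.sqrt (ln (expR 1 + enorm x ^+ 2)))%:E)) < +oo)%E.

Definition random_field (d' : measure_display) (Omega : measurableType d')
    (R : realType) (P : probability Omega R) (d : nat) (T : R)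
    (u : R -> 'rV[R]_d -> Omega -> R) : Prop :=
  (forall t x, 0 <= t <= T -> measurable_fun setT (u t x)) /\
  {ae P, forall w, measurable_fun (`[0, T] `*` [set: 'rV[R]_d])
           (fun z : R * 'rV[R]_d => u z.1 z.2 w)}.

(* The integrability clauses say that the integrals of the equation are
   ordinary Lebesgue integrals, not the library's default values; they are
   automatic for locally bounded sample paths. *)
Definition weak_solution (d' : measure_display) (Omega : measurableType d')
    (R : realType) (P : probability Omega R) (d : nat)
    (mu : {measure set 'rV[R]_d -> \bar R})
    (W : (R * 'rV[R]_d -> R) -> {RV P >-> R})
    (f : R -> R) (sigma T : R) (u : R -> 'rV[R]_d -> Omega -> R) : Prop :=
  random_field P T u /\
  forall phi : 'rV[R]_d -> R, class_C 2 phi -> compact_support phi ->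
    {ae P, forall w,
      [/\ forall t, 0 <= t <= T ->
            (lebesgue_rv R d).-integrable setT
              (fun x => (u t x w * phi x)%:E),
          (lebesgue_measure \x lebesgue_rv R d)%E.-integrable
            (`[0, T] `*` setT)
            (fun z => (u z.1 z.2 w * (2^-1 * laplacian phi z.2))%:E),
          (lebesgue_measure \x lebesgue_rv R d)%E.-integrable
            (`[0, T] `*` setT)
            (fun z => (f (u z.1 z.2 w) * phi z.2)%:E) &
          forall t, 0 <= t <= T ->
            \int[lebesgue_rv R d]_x (u t x w * phi x)
            - \int[lebesgue_rv R d]_x (u 0 x w * phi x)
            = \int[lebesgue_measure]_(s in `[0, t])
                \int[lebesgue_rv R d]_x
                  (u s x w * (2^-1 * laplacian phi x))
              + \int[lebesgue_measure]_(s in `[0, t])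
                  \int[lebesgue_rv R d]_x (f (u s x w) * phi x)
              + walsh_integral mu W (fun x => sigma * phi x) t w]}.

Definition has_initial_data (d' : measure_display)
    (Omega : measurableType d') (R : realType) (P : probability Omega R)
    (d : nat) (u0 : 'rV[R]_d -> R) (u : R -> 'rV[R]_d -> Omega -> R) : Prop :=
  {ae P, forall w, forall x, u 0 x w = u0 x}.

Definition growth_condition (d' : measure_display)
    (Omega : measurableType d') (R : realType) (P : probability Omega R)
    (d : nat) (T nu : R) (u : R -> 'rV[R]_d -> Omega -> R) : Prop :=
  {ae P, forall w,
    (ereal_sup [set (`|u z.1 z.2 w| * expR (- (enorm z.2 `^ nu)))%:E
       | z in `[0%R, T] `*` [set: 'rV[R]_d]] < +oo)%E}.

(* Main.v *)
Require Import Defs.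
From HB Require Import structures.
From mathcomp Require Import all_boot all_order all_algebra.
From mathcomp Require Import all_classical all_reals all_analysis.
From mathcomp Require Import measurable_realfun.
From mathcomp Require Import ring lra.

Import Order.TTheory GRing.Theory Num.Theory.
Import numFieldNormedType.Exports.

Local Open Scope classical_set_scope.
Local Open Scope ring_scope.

(** The noise is additive, so in the difference v = u1 - u2 of two solutions it
    cancels, and so do the initial data.  For almost every sample, v is a weak
    solution of dv/dt = (1/2) Laplacian(v) + g with g = f(u1) - f(u2), starting
    from zero, and the problem has become deterministic.  The two growth
    hypotheses combine as follows: where |u1| and |u2| are at most
    A exp(|x|^nu), the Lipschitz constant of f is at most of the order of
    (log A + |x|^nu)^(1 + eps), and nu (1 + eps) < 2.  Hence
      |g| <= c (1 + |x|^2) |v|   and   |v| <= K exp(|x|^2 / 2)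
    ([log_growth_quadratic], [expR_powR_le]), and what has to be proved is
    uniqueness for a heat inequality with a quadratically growing potential
    ([evolution_unique]).

    The weight psi(t, x) = exp(a(t) (1 + |x|^2)) with a(t) = 1 + kappa (t - t0)
    does this.  As long as a <= 2, the Laplacian of psi is at most a constant
    times (1 + |x|^2) psi, while d psi/dt = kappa (1 + |x|^2) psi.  So if
    |v| <= N psi, then |g| <= c N (1 + |x|^2) psi, and for kappa large enough
    (N / 2) psi is a supersolution of the equation of v.  The maximum principle
    improves |v| <= N psi to |v| <= (N / 2) psi ([comparison_half]); iterating
    gives v = 0 on [t0, t0 + 1 / kappa] ([comparison_zero]), and finitely many
    such steps cover [0, T].  The potential may grow no faster than
    (d psi/dt) / psi, that is, quadratically: this is where nu (1 + eps) < 2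
    enters.

    As v solves its equation only weakly, the maximum principle is applied to
    the averages of v against the bumps y |-> max(r^2 - |y - x|^2, 0)^m.  The
    Laplacian of such a bump is a combination of the bumps of orders m - 1 and
    m - 2, so that the averages of orders 3, 4 and 5 are Lipschitz in time and
    the second differences in x of the average of order 5 are controlled by
    those of orders 3 and 4 ([avg_second]).  At a maximum of the average minus
    the barrier this is enough to reach a contradiction, with no derivative
    of the averages ([lapavg_at_max], [avg_le_barrier]).  Letting r tend to
    zero turns the inequality between averages into one between functions,
    almost everywhere ([ae_le_of_avg]).

    The exceptional null set of samples in the definition of a weak solution
    depends on the test function.  Bumps with rational centres and radii
    1 / (n + 2) are countably many, and the averages depend on the centre in a
    Lipschitz way, which recovers all real centres
    ([subevolution_of_rational]). *)

(** * Lebesgue measure on R^d *)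

Section lebesgue_rv.
Context {R : realType}.

Lemma lebesgue_measure_shift (c : R) (A : set R) : measurable A ->
  pushforward (@lebesgue_measure R) ((fun t => t + c) : measurableTypeR R -> measurableTypeR R) A
  = lebesgue_measure A.
Proof.
move=> mA; have mf : measurable_fun setT ((fun t => t + c) : measurableTypeR R -> measurableTypeR R).
  exact: measurable_funD.
pose m := isMeasurableFun.Build _ _ (measurableTypeR R) (measurableTypeR R) _ mf.
pose f : {mfun measurableTypeR R >-> measurableTypeR R} := HB.pack ((fun t => t + c) : measurableTypeR R -> measurableTypeR R) m.
apply/esym.
apply: (@lebesgue_measure_unique R
  (pushforward (@lebesgue_measure R) f)) => //= _ [[a b]] _ <-.
rewrite /pushforward /=.
rewrite (_ : _ @^-1` _ = `](a - c), (b - c)]%classic); last first.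
  by apply/seteqP; split => x /=; rewrite !in_itv/= ltrBlDr lerBrDr.
rewrite !lebesgue_measure_itv/= !lte_fin ltrD2r.
by case: ifP => // _; rewrite -!EFinB; congr EFin; ring.
Qed.

Lemma measurable_shift_rv {d} (c : 'rV[R]_d) :
  measurable_fun setT (fun x : 'rV[R]_d => x + c).
Proof.
apply: measurable_fun_rvP => i; under eq_fun do rewrite mxE.
by apply: measurable_funD => //; exact: measurable_coord.
Qed.

Lemma ge0_integral_lebesgue_shift (c : R) (F : R -> \bar R) :
  measurable_fun setT F -> (forall x, 0 <= F x)%E ->
  (\int[lebesgue_measure]_x F (x + c)%R = \int[lebesgue_measure]_x F x)%E.
Proof.
move=> mF F0.
have mf : measurable_fun setT ((fun t => t + c) : measurableTypeR R -> measurableTypeR R).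
  exact: measurable_funD.
transitivity (\int[pushforward (@lebesgue_measure R) ((fun t => t + c)%R : measurableTypeR R -> measurableTypeR R)]_x F x)%E.
  by rewrite ge0_integral_pushforward.
by apply: eq_measure_integral => A mA _; exact: lebesgue_measure_shift.
Qed.

Lemma ge0_integral_cons_rv {d} (F : 'rV[R]_d.+1 -> \bar R) :
  measurable_fun setT F -> (forall x, 0 <= F x)%E ->
  (\int[lebesgue_rv R d.+1]_x F x =
   \int[lebesgue_measure]_s \int[lebesgue_rv R d]_y F (cons_rv (s, y)))%E.
Proof.
move=> mF F0.
rewrite [LHS](ge0_integral_pushforward _ (@lebesgue_measure R \x lebesgue_rv R d)%E)//; last first.
  exact: measurable_cons_rv.
rewrite preimage_setT fubini_tonelli1//; first exact: measurableT_comp mF (@measurable_cons_rv R d).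
by move=> x; exact: F0.
Qed.

(** Induction on the dimension: Tonelli reduces a shift of R^(d+1) to one of the
    line and one of R^d. *)
Lemma ge0_integral_shift_rv {d} (c : 'rV[R]_d) (F : 'rV[R]_d -> \bar R) :
  measurable_fun setT F -> (forall x, 0 <= F x)%E ->
  (\int[lebesgue_rv R d]_x F (x + c)%R = \int[lebesgue_rv R d]_x F x)%E.
Proof.
elim: d c F => [|d IH] c F mF F0.
  by apply: eq_integral => x _; congr F; apply/rowP => -[].
have [c0 cE] : exists p, c = cons_rv p.
  exists (uncons_rv c); apply/rowP => i; rewrite /cons_rv /uncons_rv mxE /=.
  by case: unliftP => [j ->|->]; rewrite ?mxE.
have addE s y : cons_rv (s, y) + c = cons_rv (s + c0.1, y + c0.2).
  rewrite cE; apply/rowP => i; rewrite /cons_rv !mxE /=.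
  by case: unliftP => [j _|_] //=; rewrite mxE.
rewrite !ge0_integral_cons_rv//; last exact: measurableT_comp mF (measurable_shift_rv _).
under eq_integral do under eq_integral do rewrite addE.
have mG s : measurable_fun setT (fun y => F (cons_rv (s, y))).
  apply: measurableT_comp mF _; apply: measurableT_comp (@measurable_cons_rv R d) _.
  exact: measurable_pair1.
under eq_integral do rewrite (IH c0.2 (fun y => F (cons_rv (_, y))))//.
rewrite (ge0_integral_lebesgue_shift c0.1 (fun s => \int[lebesgue_rv R d]_y F (cons_rv (s, y)))%E)//.
- apply: (@measurable_fun_fubini_tonelli_F _ _ _ _ _ (lebesgue_rv R d) (F \o @cons_rv R d)) => //.
  exact: measurableT_comp mF (@measurable_cons_rv R d).
  by move=> x; exact: F0.
- by move=> s; apply: integral_ge0 => y _; exact: F0.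
Qed.

(** Boundedness is measured with these cubes: unlike Euclidean balls they are
    products, so that their volume follows from the recursive definition of
    the measure. *)
Definition cube {d} (r : R) : set 'rV[R]_d :=
  [set y | forall i, `|y ord0 i| <= r].

Lemma measurable_cube {d} r : measurable (@cube d r).
Proof.
rewrite (_ : cube r = \bigcap_(i in [set: 'I_d]) ((fun y : 'rV[R]_d => y ord0 i) @^-1` `[-r, r]%classic)).
  apply: fin_bigcap_measurable => // i _; rewrite -[X in measurable X]setTI.
  exact: measurable_coord.
apply/seteqP; split => y /=.
  move=> cy i _ /=. rewrite in_itv/= -ler_norml. exact: cy.
move=> h i. have := h i I. by rewrite /= in_itv/= -ler_norml.
Qed.

Lemma compact_cube {d} (r : R) : compact (@cube d r).
Proof.
rewrite (_ : cube r = [set x : 'rV[R]_d | forall i, `[- r, r]%classic (x ord0 i)]).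
  by apply: (@rV_compact _ _ (fun=> `[(- r), r]%classic)) => _; exact: segment_compact.
by apply/seteqP; split => x cx i; have := cx i; rewrite /= in_itv/= -ler_norml.
Qed.

Lemma lebesgue_rv_cubeE {d} r : 0 < r ->
  lebesgue_rv R d (@cube d r) = ((2 * r) ^+ d)%:E.
Proof.
move=> r0; elim: d => [|d IH].
  by rewrite /= diracE mem_set ?expr0// => -[].
rewrite /= /lebesgue_cons /pushforward.
rewrite (_ : _ @^-1` _ = `[-r, r]%classic `*` cube r); last first.
  apply/seteqP; split => -[s y] /=.
    move=> cy; split.
      rewrite in_itv/= -ler_norml; have := cy ord0; by rewrite /cons_rv mxE unlift_none.
    by move=> i; have := cy (lift ord0 i); rewrite /cons_rv mxE liftK.
  move=> [+ cy] i; rewrite in_itv/= -ler_norml /cons_rv mxE /= => sr.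
  by case: unliftP => [j _|_] //=; exact: cy.
rewrite [LHS]product_measure1E//; last exact: measurable_cube.
have h : lebesgue_measure (`[(- r)%R, r]%classic : set R) = (2 * r)%:E.
  by rewrite lebesgue_measure_itv/= lte_fin gt0_cp// -EFinB; congr EFin; ring.
rewrite exprS EFinM -IH; congr (_ * _)%E; exact: h.
Qed.

Lemma lebesgue_rv_cube {d} r : (lebesgue_rv R d (@cube d r) < +oo)%E.
Proof.
apply: (@le_lt_trans _ _ (lebesgue_rv R d (@cube d (`|r| + 1)))).
  apply: le_measure; rewrite ?inE; try exact: measurable_cube.
  by move=> y cy i; rewrite (le_trans (cy i))// (le_trans (ler_norm r))// lerDl.
by rewrite lebesgue_rv_cubeE ?ltry// ltr_wpDl.
Qed.

End lebesgue_rv.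

(** * Powers of the positive part *)

Section bumps.
Context {R : realType} {d : nat}.
Implicit Types (x y : 'rV[R]_d) (w : 'rV[R]_d -> R) (m : nat).

Definition sqn x : R := dotrv x x.

Lemma sqnE x : sqn x = \sum_(i < d) x ord0 i ^+ 2.
Proof. by apply: eq_bigr => i _; rewrite expr2. Qed.

Lemma sqn_ge0 x : 0 <= sqn x.
Proof. by rewrite sqnE sumr_ge0// => i _; exact: sqr_ge0. Qed.

Lemma sqr_coord_le x i : x ord0 i ^+ 2 <= sqn x.
Proof.
by rewrite sqnE (bigD1 i)//= lerDl sumr_ge0// => j _; exact: sqr_ge0.
Qed.

Lemma sqnN x : sqn (- x) = sqn x.
Proof. by rewrite !sqnE; apply: eq_bigr => i _; rewrite mxE sqrrN. Qed.

Definition ppow m (s : R) : R := Num.max s 0 ^+ m.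

Lemma ppow_ge0 m s : 0 <= ppow m s.
Proof. by rewrite exprn_ge0// le_max lexx orbT. Qed.

Lemma ppow_le1 m s : s <= 1 -> ppow m s <= 1.
Proof. by move=> s1; rewrite exprn_ile1 ?le_max ?lexx ?orbT// ge_max s1 ler01. Qed.

Lemma ppow_neg m s : (0 < m)%N -> s <= 0 -> ppow m s = 0.
Proof. by case: m => // m _ s0; rewrite /ppow max_r// exprS mul0r. Qed.

Lemma ppow_pos m s : 0 <= s -> ppow m s = s ^+ m.
Proof. by move=> s0; rewrite /ppow max_l. Qed.

Lemma ppowS m s : s * ppow m.+1 s = ppow m.+2 s.
Proof.
have [s0|/ltW s0] := lerP 0 s; first by rewrite !ppow_pos// [RHS]exprS.
by rewrite !ppow_neg ?mulr0.
Qed.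

Lemma ppow_lip m s s' : s <= 1 -> s' <= 1 ->
  `|ppow m s - ppow m s'| <= m%:R * `|s - s'|.
Proof.
move=> s1 s'1; have h : `|Num.max s 0 - Num.max s' 0| <= `|s - s'|.
  have [?|?] := leP 0 s; have [?|?] := leP 0 s'.
  - by [].
  - by rewrite subr0 !ger0_norm; lra.
  - by rewrite sub0r normrN distrC !ger0_norm; lra.
  - by rewrite subrr normr0.
elim: m => [|m IH]; first by rewrite /ppow !expr0 subrr normr0 mul0r.
have -> : ppow m.+1 s - ppow m.+1 s' =
    Num.max s 0 * (ppow m s - ppow m s') + (Num.max s 0 - Num.max s' 0) * ppow m s'.
  by rewrite /ppow !exprS; ring.
rewrite (le_trans (ler_normD _ _))// -natr1 [leRHS]mulrDl mul1r lerD//.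
  rewrite normrM (le_trans _ IH)// ler_piMl// ger0_norm ?le_max ?lexx ?orbT//.
  by rewrite ge_max s1 ler01.
rewrite normrM (le_trans _ h)// ler_piMr// ger0_norm ?ppow_ge0//.
exact: ppow_le1.
Qed.

(** When s and s + u are both nonnegative this is the binomial formula; otherwise
    |s| <= |u|, or s is negative and the expansion at s vanishes, and every term
    is at most of the order of |u|^5. *)
Lemma ppow5_taylor s u : s <= 1 ->
  `|ppow 5 (s + u) - ppow 5 s - 5 * ppow 4 s * u - 10 * ppow 3 s * u ^+ 2|
    <= 16 * (`|u| ^+ 3 + `|u| ^+ 5).
Proof.
move=> s1; have u3 := exprn_ge0 3 (normr_ge0 u); have u5 := exprn_ge0 5 (normr_ge0 u).
have u4 := exprn_ge0 4 (normr_ge0 u).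
have [s0|s0] := leP 0 s.
  have [su|su] := leP 0 (s + u).
    rewrite !ppow_pos//.
    have -> : (s + u) ^+ 5 - s ^+ 5 - 5 * s ^+ 4 * u - 10 * s ^+ 3 * u ^+ 2 =
      (10 * s ^+ 2) * u ^+ 3 + (5 * s) * u ^+ 4 + u ^+ 5 by ring.
    rewrite (le_trans (ler_normD _ _))// (le_trans (lerD (ler_normD _ _) (lexx _)))//.
    rewrite !(normrX, normrM) !normr_nat !(ger0_norm s0)//.
    have s2 : s ^+ 2 <= 1 by rewrite exprn_ile1.
    have h4 : `|u| ^+ 4 <= `|u| ^+ 3 + `|u| ^+ 5.
      have -> : `|u| ^+ 3 + `|u| ^+ 5 = `|u| ^+ 4 + `|u| ^+ 3 * ((1 - `|u|) ^+ 2 + `|u|).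
        by ring.
      by rewrite lerDl mulr_ge0// addr_ge0// sqr_ge0.
    have : 10 * s ^+ 2 * `|u| ^+ 3 <= 10 * `|u| ^+ 3 by rewrite ler_wpM2r//; lra.
    have : 5 * s * `|u| ^+ 4 <= 5 * `|u| ^+ 4 by rewrite ler_wpM2r//; lra.
    lra.
  rewrite (ppow_neg _ (s + u)) ?(ltW su)// !ppow_pos// sub0r.
  have us : s <= `|u| by rewrite ltr0_norm; lra.
  have b3 : s ^+ 3 * `|u| ^+ 2 <= `|u| ^+ 5.
    by rewrite (exprD _ 3 2) ler_wpM2r ?exprn_ge0// lerXn2r// nnegrE.
  have b4 : s ^+ 4 * `|u| ^+ 1 <= `|u| ^+ 5.
    by rewrite (exprD _ 4 1) ler_wpM2r ?exprn_ge0// lerXn2r// nnegrE.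
  have b5 : s ^+ 5 <= `|u| ^+ 5 by rewrite lerXn2r// nnegrE.
  rewrite (le_trans (ler_normB _ _))// (le_trans (lerD (ler_normB _ _) (lexx _)))//.
  rewrite normrN !(normrX, normrM) !normr_nat !(ger0_norm s0)//.
  have -> : 5 * s ^+ 4 * `|u| = 5 * (s ^+ 4 * `|u| ^+ 1) by rewrite expr1; ring.
  have -> : 10 * s ^+ 3 * `|u| ^+ 2 = 10 * (s ^+ 3 * `|u| ^+ 2) by ring.
  lra.
rewrite (ppow_neg 5 s) ?(ppow_neg 4 s) ?(ppow_neg 3 s) ?(ltW s0)//.
rewrite !mulr0 !mul0r !subr0 (ger0_norm (ppow_ge0 _ _)).
have [su|su] := leP 0 (s + u).
  rewrite ppow_pos//.
  have : (s + u) ^+ 5 <= `|u| ^+ 5.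
    by rewrite lerXn2r ?nnegrE// (le_trans _ (ler_norm u))//; lra.
  lra.
by rewrite ppow_neg ?(ltW su)//; lra.
Qed.

(** Moving the centre of a bump by h and by - h in a direction where y - x has
    coordinate xi changes its argument by 2 h xi - h^2 and - 2 h xi - h^2; the
    first-order terms of the two expansions cancel up to h^2. *)
Lemma ppow5_second (s xi h A : R) : s <= 1 -> 0 <= h -> h <= 1 -> 2 * `|xi| + 1 <= A ->
  `|ppow 5 (s + (2 * h * xi - h ^+ 2)) + ppow 5 (s + (- 2 * h * xi - h ^+ 2))
     - 2 * ppow 5 s - h ^+ 2 * (80 * xi ^+ 2 * ppow 3 s - 10 * ppow 4 s)|
  <= (64 * A ^+ 5 + 20) * h ^+ 3.
Proof.
move=> s1 h0 h1 xiA.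
set u : R := 2 * h * xi - h ^+ 2; set u' : R := - 2 * h * xi - h ^+ 2.
have A1 : 1 <= A by have := normr_ge0 xi; lra.
have hh : h ^+ 2 <= h by rewrite expr2 ler_piMr.
have uA : `|u| <= A * h.
  rewrite /u (le_trans (ler_normB _ _))// !(normrX, normrM) !(ger0_norm h0) normr_nat.
  have : (2 * `|xi| + 1) * h <= A * h by rewrite ler_wpM2r.
  lra.
have u'A : `|u'| <= A * h.
  rewrite /u' (le_trans (ler_normB _ _))// !(normrX, normrM) !(ger0_norm h0) normrN normr_nat.
  have : (2 * `|xi| + 1) * h <= A * h by rewrite ler_wpM2r.
  lra.
have bd (v : R) : `|v| <= A * h -> 16 * (`|v| ^+ 3 + `|v| ^+ 5) <= 32 * (A ^+ 5 * h ^+ 3).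
  move=> vA.
  have v3 : `|v| ^+ 3 <= A ^+ 5 * h ^+ 3.
    rewrite (@le_trans _ _ ((A * h) ^+ 3))// ?lerXn2r ?nnegrE//; first by rewrite mulr_ge0//; lra.
    by rewrite exprMn ler_wpM2r ?exprn_ge0// ler_weXn2l.
  have v5 : `|v| ^+ 5 <= A ^+ 5 * h ^+ 3.
    rewrite (@le_trans _ _ ((A * h) ^+ 5))// ?lerXn2r ?nnegrE//; first by rewrite mulr_ge0//; lra.
    by rewrite exprMn ler_wpM2l ?exprn_ge0//; [lra|rewrite ler_wiXn2l].
  lra.
have t1 := ppow5_taylor s u s1; have t2 := ppow5_taylor s u' s1.
have b1 := bd _ uA; have b2 := bd _ u'A.
have p31 := ppow_le1 3 s s1; have p30 := ppow_ge0 3 s.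
have h3 : h ^+ 4 <= h ^+ 3 by rewrite ler_wiXn2l.
have h40 : 0 <= h ^+ 4 by rewrite exprn_ge0.
have h4 : h ^+ 4 * ppow 3 s <= h ^+ 3.
  by rewrite (le_trans _ h3)// ler_piMr.
have h4' : 0 <= h ^+ 4 * ppow 3 s by rewrite mulr_ge0.
have -> : ppow 5 (s + u) + ppow 5 (s + u')
     - 2 * ppow 5 s - h ^+ 2 * (80 * xi ^+ 2 * ppow 3 s - 10 * ppow 4 s) =
  (ppow 5 (s + u) - ppow 5 s - 5 * ppow 4 s * u - 10 * ppow 3 s * u ^+ 2) +
  (ppow 5 (s + u') - ppow 5 s - 5 * ppow 4 s * u' - 10 * ppow 3 s * u' ^+ 2) +
  20 * (h ^+ 4 * ppow 3 s).
  by rewrite /u /u'; ring.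
rewrite (le_trans (ler_normD _ _))// (le_trans (lerD (ler_normD _ _) (lexx _)))//.
have -> : `|20 * (h ^+ 4 * ppow 3 s)| = 20 * (h ^+ 4 * ppow 3 s) by rewrite ger0_norm; lra.
lra.
Qed.

End bumps.

(** * Averages against bumps and their second differences *)

Section averages.
Context {R : realType} {d : nat}.
Implicit Types (x y : 'rV[R]_d) (w k : 'rV[R]_d -> R) (m : nat).

(** A bump of order m is of class C^(m-1) as a function of y, and is defined from
    |y - x|^2 alone, which makes it polynomial in the coordinates wherever it
    does not vanish. *)
Definition bump m (dl : R) x y : R := ppow m (dl ^+ 2 - sqn (y - x)).

Definition avg m (dl : R) w x : R := \int[lebesgue_rv R d]_y (w y * bump m dl x y).

Definition vol (r : R) : R := fine (lebesgue_rv R d (cube r)).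

Lemma measurable_sqn {d1} {T : measurableType d1} (g : T -> 'rV[R]_d) :
  measurable_fun setT g -> measurable_fun setT (fun z => sqn (g z)).
Proof.
move=> mg; under eq_fun do rewrite sqnE.
apply: measurable_sum => i; apply: measurable_funX.
exact: measurableT_comp (@measurable_coord _ _ i) mg.
Qed.

Lemma measurable_ppow m : measurable_fun setT (@ppow R m).
Proof. by apply: measurable_funX; apply: measurable_maxr. Qed.

Lemma measurable_subrv {d1} {T : measurableType d1} (g h : T -> 'rV[R]_d) :
  measurable_fun setT g -> measurable_fun setT h ->
  measurable_fun setT (fun z => g z - h z).
Proof.
move=> mg mh; apply: measurable_fun_rvP => i; under eq_fun do rewrite !mxE.
by apply: measurable_funB; [exact: measurableT_comp (@measurable_coord _ _ i) mg
  |exact: measurableT_comp (@measurable_coord _ _ i) mh].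
Qed.

Lemma measurable_bump2 m dl {d1} {T : measurableType d1} (g h : T -> 'rV[R]_d) :
  measurable_fun setT g -> measurable_fun setT h ->
  measurable_fun setT (fun z => bump m dl (g z) (h z)).
Proof.
move=> mg mh; apply: measurableT_comp (measurable_ppow m) _.
apply: measurable_funB => //; apply: measurable_sqn; exact: measurable_subrv.
Qed.

Lemma measurable_bump m dl x : measurable_fun setT (bump m dl x).
Proof. exact: measurable_bump2. Qed.

Lemma bump_ge0 m dl x y : 0 <= bump m dl x y.
Proof. exact: ppow_ge0. Qed.

Lemma bump_arg_le1 (dl : R) x : 0 <= dl -> dl <= 1 -> dl ^+ 2 - sqn x <= 1.
Proof.
move=> d0 d1; have := sqn_ge0 x; have : dl ^+ 2 <= 1 by rewrite exprn_ile1.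
lra.
Qed.

Lemma bump_le1 m dl x y : 0 <= dl -> dl <= 1 -> bump m dl x y <= 1.
Proof. by move=> d0 d1; apply: ppow_le1; exact: bump_arg_le1. Qed.

Lemma normr_bump m dl x y : 0 <= dl -> dl <= 1 -> `|bump m dl x y| <= 1.
Proof. by move=> d0 d1; rewrite ger0_norm ?bump_ge0 ?bump_le1. Qed.

Lemma cubeS (r s : R) x : r <= s -> cube r x -> cube s x.
Proof. by move=> rs cx i; exact: le_trans (cx i) rs. Qed.

Lemma bump_supp (r : R) m dl x y : (0 < m)%N -> 0 <= dl -> dl <= 1 -> cube r x ->
  ~ cube (r + 1) y -> bump m dl x y = 0.
Proof.
move=> m0 d0 d1 cx /existsNP[i /negP]; rewrite -ltNge => yi.
apply: ppow_neg => //.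
have h : 1 < `|(y - x) ord0 i|.
  rewrite !mxE; have := cx i; have := lerB_dist (y ord0 i) (x ord0 i); lra.
have := sqr_coord_le (y - x) i.
have : 1 < (y - x) ord0 i ^+ 2 by rewrite -real_normK ?num_real// exprn_egt1.
have : dl ^+ 2 <= 1 by rewrite exprn_ile1.
lra.
Qed.

Lemma sqn_lip (r e : R) x x' y : cube r x -> cube r x' -> cube (r + 1) y ->
  (forall i, `|x ord0 i - x' ord0 i| <= e) ->
  `|sqn (y - x) - sqn (y - x')| <= d%:R * (e * (4 * r + 2)).
Proof.
move=> cx cx' cy xx'; rewrite !sqnE -sumrB.
rewrite (le_trans (ler_norm_sum _ _ _))//.
rewrite (@le_trans _ _ (\sum_(i < d) (e * (4 * r + 2))))//; last first.
  by rewrite sumr_const card_ord -[leLHS]mulr_natl.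
apply: ler_sum => i _; rewrite !mxE.
have -> : (y ord0 i - x ord0 i) ^+ 2 - (y ord0 i - x' ord0 i) ^+ 2 =
  (x ord0 i - x' ord0 i) * (x ord0 i + x' ord0 i - 2 * y ord0 i) by ring.
rewrite normrM ler_pM//.
rewrite (le_trans (ler_normB _ _))// (le_trans (lerD (ler_normD _ _) (lexx _)))//.
rewrite normrM normr_nat; have := cx i; have := cx' i; have := cy i; lra.
Qed.

Lemma bump_lip (r e : R) m dl x x' y : (0 < m)%N -> 0 <= dl -> dl <= 1 ->
  cube r x -> cube r x' -> cube (r + 1) y ->
  (forall i, `|x ord0 i - x' ord0 i| <= e) ->
  `|bump m dl x y - bump m dl x' y| <= m%:R * (d%:R * (e * (4 * r + 2))).
Proof.
move=> m0 d0 d1 cx cx' cy xx'.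
rewrite (le_trans (ppow_lip _ _ _ _ _)) ?bump_arg_le1//.
have -> : dl ^+ 2 - sqn (y - x) - (dl ^+ 2 - sqn (y - x')) = - (sqn (y - x) - sqn (y - x')) by ring.
by rewrite normrN ler_wpM2l// (sqn_lip _ _ _ _ _ cx cx' cy xx').
Qed.

(** Integrals against kernels supported in a cube: the integrand is bounded, and
    the cube has finite volume. *)
Lemma integrable_kernel {w k} {r M e : R} :
  measurable_fun setT w -> measurable_fun setT k ->
  (forall y, ~ cube r y -> k y = 0) ->
  (forall y, cube r y -> `|w y| <= M) -> (forall y, cube r y -> `|k y| <= e) ->
  (lebesgue_rv R d).-integrable setT (EFin \o (fun y => w y * k y)) /\
  `|\int[lebesgue_rv R d]_y (w y * k y)| <= M * e * vol r.
Proof.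
move=> mw mk k0 wM ke.
have bd y : cube r y -> `|w y * k y| <= M * e.
  by move=> cy; rewrite normrM ler_pM// ?wM// ke.
have int1 : (lebesgue_rv R d).-integrable (cube r) (EFin \o (fun y => w y * k y)).
  apply: measurable_bounded_integrable.
  - exact: measurable_cube.
  - exact: lebesgue_rv_cube.
  - by apply: measurable_funTS; exact: measurable_funM.
  - exists (M * e); split; first exact: num_real.
    move=> z Mz y cy /=. exact: le_trans (bd _ cy) (ltW Mz).
have int2 : (lebesgue_rv R d).-integrable setT (EFin \o (fun y => w y * k y)).
  move: int1; rewrite integrable_mkcond; last exact: measurable_cube.
  apply: eq_integrable => // y _ /=; rewrite /patch; case: ifPn => //.
  by rewrite notin_setE => /k0 ->; rewrite mulr0.
have -> : \int[lebesgue_rv R d]_y (w y * k y) = \int[lebesgue_rv R d]_(y in cube r) (w y * k y).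
  rewrite [RHS]Rintegral_mkcond; apply: eq_Rintegral => y _; rewrite /patch; case: ifPn => //.
  by rewrite notin_setE => /k0 ->; rewrite mulr0.
split => //.
rewrite (le_trans (le_normr_Rintegral _ int1))//; first exact: measurable_cube.
rewrite (@le_trans _ _ (\int[lebesgue_rv R d]_(y in cube r) (M * e)))//; last first.
  by rewrite Rintegral_cst//; exact: measurable_cube.
apply: le_Rintegral => //.
- exact: measurable_cube.
- exact: integrable_norm.
- apply: measurable_bounded_integrable.
  - exact: measurable_cube.
  - exact: lebesgue_rv_cube.
  - by [].
  - exists (M * e); split; first exact: num_real.
    move=> z Mz y cy /=.
    apply: le_trans (ltW Mz). rewrite ger0_norm//. exact: le_trans (bd _ cy).
Qed.

Lemma integrable_avg {w} {r M : R} {m dl x} : (0 < m)%N -> 0 <= dl -> dl <= 1 ->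
  measurable_fun setT w -> cube r x -> (forall y, cube (r + 1) y -> `|w y| <= M) ->
  (lebesgue_rv R d).-integrable setT (EFin \o (fun y => w y * bump m dl x y)).
Proof.
move=> m0 d0 d1 mw cx wM.
apply: (integrable_kernel (e := 1) mw (measurable_bump m dl x) _ wM _).1.
- by move=> y; exact: bump_supp.
- by move=> y _; exact: normr_bump.
Qed.

Lemma avg_bound {w} {r M : R} {m dl x} : (0 < m)%N -> 0 <= dl -> dl <= 1 ->
  measurable_fun setT w -> cube r x -> (forall y, cube (r + 1) y -> `|w y| <= M) ->
  `|avg m dl w x| <= M * vol (r + 1).
Proof.
move=> m0 d0 d1 mw cx wM; rewrite -[X in _ <= X * _]mulr1.
apply: (integrable_kernel (e := 1) mw (measurable_bump m dl x) _ wM _).2.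
- by move=> y; exact: bump_supp.
- by move=> y _; exact: normr_bump.
Qed.

Lemma avg_lip {w} {r e M : R} {m dl x x'} : (0 < m)%N -> 0 <= dl -> dl <= 1 ->
  measurable_fun setT w -> cube r x -> cube r x' ->
  (forall y, cube (r + 1) y -> `|w y| <= M) ->
  (forall i, `|x ord0 i - x' ord0 i| <= e) ->
  `|avg m dl w x - avg m dl w x'| <=
     M * (m%:R * (d%:R * (e * (4 * r + 2)))) * vol (r + 1).
Proof.
move=> m0 d0 d1 mw cx cx' wM xx'.
rewrite -RintegralB//; [|exact: (integrable_avg m0 d0 d1 mw cx wM)|exact: (integrable_avg m0 d0 d1 mw cx' wM)].
under eq_Rintegral do rewrite -mulrBr.
apply: (integrable_kernel mw _ _ wM _).2.
- by apply: measurable_funB; exact: measurable_bump.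
- by move=> y cy; rewrite !(bump_supp r)// subrr.
- by move=> y cy; exact: (bump_lip r).
Qed.

(** The Laplacian of the bump of order m is a combination of the bumps of orders
    m - 1 and m - 2, thanks to |z|^2 = r^2 - (r^2 - |z|^2); this is the
    corresponding combination of averages of w. *)
Definition lapavg m (dl : R) w x : R :=
  4 * m%:R * m.-1%:R * (dl ^+ 2 * avg m.-2 dl w x - avg m.-1 dl w x)
  - 2 * m%:R * d%:R * avg m.-1 dl w x.

Lemma lapavg5E dl w x : lapavg 5 dl w x =
  80 * dl ^+ 2 * avg 3 dl w x - (80 + 10 * d%:R) * avg 4 dl w x.
Proof. by rewrite /lapavg /=; ring. Qed.

Lemma sqn_shift (h : R) x i : sqn (x + h *: delta_mx ord0 i) = sqn x + 2 * h * x ord0 i + h ^+ 2.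
Proof.
rewrite !sqnE (bigD1 i)//= [in RHS](bigD1 i)//= !mxE !eqxx/= mulr1.
under eq_bigr => j ji do rewrite !mxE (negbTE ji) andbF mulr0 addr0.
ring.
Qed.

Let mu := lebesgue_rv R d.

Lemma integrableRD (f g : 'rV[R]_d -> R) : mu.-integrable setT (EFin \o f) ->
  mu.-integrable setT (EFin \o g) ->
  mu.-integrable setT (EFin \o (fun y => f y + g y)).
Proof. by move=> fi gi; exact: (integrableD measurableT fi gi). Qed.

Lemma integrableRB (f g : 'rV[R]_d -> R) : mu.-integrable setT (EFin \o f) ->
  mu.-integrable setT (EFin \o g) ->
  mu.-integrable setT (EFin \o (fun y => f y - g y)).
Proof. by move=> fi gi; exact: (integrableB measurableT fi gi). Qed.

Lemma integrableRZ a (f : 'rV[R]_d -> R) : mu.-integrable setT (EFin \o f) ->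
  mu.-integrable setT (EFin \o (fun y => a * f y)).
Proof. by move=> fi; exact: (integrableZl measurableT a fi). Qed.

Lemma Rintegral_sum {I : Type} (s : seq I) (F : I -> 'rV[R]_d -> R) :
  (forall i, (lebesgue_rv R d).-integrable setT (EFin \o F i)) ->
  (lebesgue_rv R d).-integrable setT (EFin \o (fun y => \sum_(i <- s) F i y)) /\
  \int[lebesgue_rv R d]_y (\sum_(i <- s) F i y) =
  \sum_(i <- s) \int[lebesgue_rv R d]_y F i y.
Proof.
move=> iF; elim: s => [|i s [IH1 IH2]].
  split; first by apply: eq_integrable (integrable0 _ _) => // y _ /=; rewrite big_nil.
  rewrite big_nil /Rintegral; under eq_integral do rewrite big_nil.
  by rewrite integral0.
split.
  apply: (eq_integrable _ (EFin \o (fun y => F i y + \sum_(j <- s) F j y))) => //.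
    by move=> y _ /=; rewrite big_cons.
  exact: integrableRD.
rewrite big_cons -IH2 -RintegralD//.
by apply: eq_Rintegral => y _; rewrite big_cons.
Qed.

(** The second differences are taken on the kernel, where [ppow5_second] applies
    uniformly in y, and integrated afterwards; w itself is not differentiated. *)
Lemma avg_second {w} {r M : R} {dl x} : 0 <= dl -> dl <= 1 ->
  measurable_fun setT w -> cube r x -> (forall y, cube (r + 2) y -> `|w y| <= M) ->
  exists C, forall h, 0 <= h -> h <= 1 ->
  `|\sum_(i < d) (avg 5 dl w (x + h *: delta_mx ord0 i) +
       avg 5 dl w (x - h *: delta_mx ord0 i) - 2 * avg 5 dl w x)
    - h ^+ 2 * lapavg 5 dl w x| <= C * h ^+ 3.
Proof.
move=> d0 d1 mw cx wM; set A := 2 * (2 * r + 2) + 1.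
exists (M * (d%:R * (64 * A ^+ 5 + 20)) * vol (r + 2)) => h h0 h1.
have cxh (s : R) i : `|s| <= 1 -> cube (r + 1) (x + s *: delta_mx ord0 i).
  move=> s1 j; rewrite !mxE (le_trans (ler_normD _ _))// lerD//.
  rewrite normrM; case: (_ && _); rewrite /= ?normr1 ?normr0 ?mulr1 ?mulr0//.
have ia m y : (0 < m)%N -> cube (r + 1) y ->
    (lebesgue_rv R d).-integrable setT (EFin \o (fun z => w z * bump m dl y z)).
  move=> m0 cy; apply: (@integrable_avg w (r + 1) M) => // z cz; apply: wM.
  by move: cz; rewrite -addrA.
pose ker y : R := \sum_(i < d) (bump 5 dl (x + h *: delta_mx ord0 i) y +
       bump 5 dl (x - h *: delta_mx ord0 i) y - 2 * bump 5 dl x y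
   - h ^+ 2 * (80 * (y - x) ord0 i ^+ 2 * bump 3 dl x y - 10 * bump 4 dl x y)).
have cx1 : cube (r + 1) x by apply: cubeS cx; lra.
have hn : `|h| <= 1 by rewrite ger0_norm.
have hn' : `|- h| <= 1 by rewrite normrN.
have sq3 y : sqn (y - x) * bump 3 dl x y = dl ^+ 2 * bump 3 dl x y - bump 4 dl x y.
  by rewrite /bump -(ppowS 2); ring.
have kerE y : w y * ker y = \sum_(i < d) (w y * bump 5 dl (x + h *: delta_mx ord0 i) y +
       w y * bump 5 dl (x - h *: delta_mx ord0 i) y - 2 * (w y * bump 5 dl x y))
   - h ^+ 2 * (80 * dl ^+ 2 * (w y * bump 3 dl x y) - (80 + 10 * d%:R) * (w y * bump 4 dl x y)).
  rewrite /ker sumrB mulrBr; congr (_ - _).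
    by rewrite mulr_sumr; apply: eq_bigr => i _; ring.
  rewrite -mulr_sumr sumrB sumr_const card_ord -[10 * _ *+ d]mulr_natl.
  have -> : \sum_(i < d) 80 * (y - x) ord0 i ^+ 2 * bump 3 dl x y =
      80 * (dl ^+ 2 * bump 3 dl x y - bump 4 dl x y).
    by rewrite -sq3 sqnE mulr_suml mulr_sumr; apply: eq_bigr => i _; ring.
  ring.
have -> : \sum_(i < d) (avg 5 dl w (x + h *: delta_mx ord0 i) +
       avg 5 dl w (x - h *: delta_mx ord0 i) - 2 * avg 5 dl w x)
    - h ^+ 2 * lapavg 5 dl w x = \int[lebesgue_rv R d]_y (w y * ker y).
  have c2 i : cube (r + 1) (x + h *: delta_mx ord0 i) by exact: cxh.
  have c3 i : cube (r + 1) (x - h *: delta_mx ord0 i) by rewrite -scaleNr; exact: cxh.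
  have [[i3 i4] i5] := (ia 3%N x isT cx1, ia 4%N x isT cx1, ia 5%N x isT cx1).
  have iterm i : (lebesgue_rv R d).-integrable setT (EFin \o (fun y =>
      w y * bump 5 dl (x + h *: delta_mx ord0 i) y +
      w y * bump 5 dl (x - h *: delta_mx ord0 i) y - 2 * (w y * bump 5 dl x y))).
    apply: integrableRB; last exact: integrableRZ.
    by apply: integrableRD; exact: ia.
  under [RHS]eq_Rintegral do rewrite kerE.
  have [isum sumE] := Rintegral_sum (index_enum 'I_d) _ iterm.
  have iL : (lebesgue_rv R d).-integrable setT (EFin \o (fun y =>
     80 * dl ^+ 2 * (w y * bump 3 dl x y) - (80 + 10 * d%:R) * (w y * bump 4 dl x y))).
    by apply: integrableRB; exact: integrableRZ.
  rewrite RintegralB//; last exact: integrableRZ.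
  rewrite sumE RintegralZl// RintegralB//; [|exact: integrableRZ|exact: integrableRZ].
  rewrite !RintegralZl// lapavg5E; congr (_ - _).
  apply: eq_bigr => i _; rewrite RintegralB//; last exact: integrableRZ.
    by rewrite RintegralD ?RintegralZl//; exact: ia.
  by apply: integrableRD; exact: ia.
have -> : M * (d%:R * (64 * A ^+ 5 + 20)) * vol (r + 2) * h ^+ 3 =
  M * (d%:R * (64 * A ^+ 5 + 20) * h ^+ 3) * vol (r + 2) by ring.
apply: (integrable_kernel mw _ _ wM _).2.
- apply: measurable_sum => i; apply: measurable_funB; first apply: measurable_funB.
  - by apply: measurable_funD; exact: measurable_bump.
  - by apply: measurable_funM => //; exact: measurable_bump.
  - apply: measurable_funM => //; apply: measurable_funB.
    + apply: measurable_funM; last exact: measurable_bump.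
      apply: measurable_funM => //; apply: measurable_funX.
      apply: measurableT_comp (@measurable_coord _ _ i) _; exact: measurable_subrv.
    + by apply: measurable_funM => //; exact: measurable_bump.
- move=> y cy; rewrite /ker big1// => i _.
  have cy' : ~ cube (r + 1 + 1) y by move=> h'; apply: cy; move: h'; rewrite -addrA.
  rewrite !(bump_supp (r + 1))//; [ring|rewrite -scaleNr; exact: cxh|exact: cxh].
- move=> y cy; rewrite /ker (le_trans (ler_norm_sum _ _ _))//.
  rewrite (@le_trans _ _ (\sum_(i < d) ((64 * A ^+ 5 + 20) * h ^+ 3)))//; last first.
    by rewrite sumr_const card_ord -[leLHS]mulr_natl mulrA.
  apply: ler_sum => i _; rewrite /bump.
  have -> : dl ^+ 2 - sqn (y - (x + h *: delta_mx ord0 i)) =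
     dl ^+ 2 - sqn (y - x) + (2 * h * (y - x) ord0 i - h ^+ 2).
    rewrite opprD addrA -scaleNr sqn_shift; ring.
  have -> : dl ^+ 2 - sqn (y - (x - h *: delta_mx ord0 i)) =
     dl ^+ 2 - sqn (y - x) + (- 2 * h * (y - x) ord0 i - h ^+ 2).
    rewrite opprB addrCA addrC sqn_shift; ring.
  apply: ppow5_second => //; first exact: bump_arg_le1.
  rewrite /A lerD2r ler_wpM2l// !mxE (le_trans (ler_normB _ _))//.
  have := cx i; have := cy i; lra.
Qed.

End averages.

(** * Approximation of measurable sets by continuous functions *)

Section continuous_functions.
Context {R : realType} {T : topologicalType}.
Implicit Types f g : T -> R.

Lemma continuous_addf {f g} : continuous f -> continuous g ->
  continuous (fun y => f y + g y).
Proof. by move=> cf cg y; exact: (continuousD (cf y) (cg y)). Qed.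

Lemma continuous_subf {f g} : continuous f -> continuous g ->
  continuous (fun y => f y - g y).
Proof. by move=> cf cg y; exact: (continuousB (cf y) (cg y)). Qed.

Lemma continuous_mulf {f g} : continuous f -> continuous g ->
  continuous (fun y => f y * g y).
Proof. by move=> cf cg y; exact: (continuousM (cf y) (cg y)). Qed.

Lemma continuous_minf {f g} : continuous f -> continuous g ->
  continuous (fun y => Num.min (f y) (g y)).
Proof. by move=> cf cg y; exact: (continuous_min (cf y) (cg y)). Qed.

Lemma continuous_maxf {f g} : continuous f -> continuous g ->
  continuous (fun y => Num.max (f y) (g y)).
Proof. by move=> cf cg y; exact: (continuous_max (cf y) (cg y)). Qed.

Lemma continuous_cstf (a : R) : continuous (fun _ : T => a).
Proof. by move=> y; exact: cst_continuous. Qed.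

End continuous_functions.

Section continuous_approximation.
Context {R : realType} {d : nat}.
Let mu := lebesgue_rv R d.
Variable H : 'rV[R]_d -> R.
Hypothesis mH : measurable_fun setT H.
Hypothesis H0 : forall y, 0 <= H y.
Hypothesis iH : mu.-integrable setT (EFin \o H).

Lemma integrable_weight (k : 'rV[R]_d -> R) (C : R) :
  measurable_fun setT k -> (forall y, `|k y| <= C) ->
  mu.-integrable setT (EFin \o (fun y => k y * H y)).
Proof.
move=> mk kC.
apply: (le_integrable measurableT _ _ (integrableRZ C _ iH)).
  by apply/measurable_EFinP; exact: measurable_funM.
move=> y _ /=; rewrite lee_fin normrM (ger0_norm (H0 y)) (le_trans _ (ler_norm _))//.
by rewrite ler_wpM2r.
Qed.

Lemma normr_sub01_le1 (a b : R) : 0 <= a <= 1 -> 0 <= b <= 1 -> `|a - b| <= 1.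
Proof. by move=> /andP[a0 a1] /andP[b0 b1]; rewrite ler_norml; apply/andP; split; lra. Qed.

Lemma indic01 (A : set 'rV[R]_d) y : 0 <= (\1_A y : R) <= 1.
Proof. by rewrite indicE; case: (_ \in _); rewrite ?lexx ?ler01. Qed.

(** Indicators approximated in L^1(H dx) by continuous functions with values in
    [0, 1].  Such sets form a sigma-algebra, which is how all Borel sets are
    reached. *)
Definition approximable (A : set 'rV[R]_d) : Prop :=
  measurable A /\ forall e : R, 0 < e -> exists rho : 'rV[R]_d -> R,
    [/\ measurable_fun setT rho, continuous rho, forall y, 0 <= rho y <= 1 &
      \int[mu]_y (`|rho y - \1_A y| * H y) <= e].

Lemma integrable_err (rho : 'rV[R]_d -> R) (A : set 'rV[R]_d) :
  measurable_fun setT rho -> measurable A -> (forall y, 0 <= rho y <= 1) ->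
  mu.-integrable setT (EFin \o (fun y => `|rho y - \1_A y| * H y)).
Proof.
move=> mr mA r01; apply: (@integrable_weight _ 1).
  by apply: measurableT_comp => //; exact: measurable_funB.
by move=> y; rewrite normr_id normr_sub01_le1// indic01.
Qed.

Lemma approximableC A : approximable A -> approximable (~` A).
Proof.
move=> [mA hA]; split; first exact: measurableC.
move=> e e0; have [rho [mr cr r01 re]] := hA e e0.
exists (fun y => 1 - rho y); split.
- exact: measurable_funB.
- by apply: continuous_subf => //; exact: continuous_cstf.
- by move=> y; have /andP[? ?] := r01 y; apply/andP; split; lra.
- rewrite (le_trans _ re)// le_eqVlt; apply/orP; left; apply/eqP.
  apply: eq_Rintegral => y _; congr (_ * _).
  rewrite !indicE in_setC; case: (y \in A) => /=; last by rewrite -[RHS]normrN; congr (`|_|); ring.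
  by rewrite -[RHS]normrN; congr (`|_|); ring.
Qed.

(** Products of approximants approximate the indicator of the intersection, as
    all the functions involved take values in [0, 1]. *)
Lemma approximableI A B : approximable A -> approximable B -> approximable (A `&` B).
Proof.
move=> [mA hA] [mB hB]; split; first exact: measurableI.
move=> e e0; have [|p [mp cp p01 pe]] := hA (e / 2); first by rewrite divr_gt0.
have [|q [mq cq q01 qe]] := hB (e / 2); first by rewrite divr_gt0.
exists (fun y => p y * q y); split.
- exact: measurable_funM.
- exact: continuous_mulf.
- move=> y; have /andP[? ?] := p01 y; have /andP[? ?] := q01 y.
  by rewrite mulr_ge0//= mulr_ile1.
- rewrite (@le_trans _ _ (e / 2 + e / 2))//; last by rewrite -splitr.
  apply: le_trans (lerD pe qe); rewrite -RintegralD//; try exact: integrable_err.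
  apply: le_Rintegral => //.
  + apply: integrable_err; [exact: measurable_funM|exact: measurableI|].
    move=> y; have /andP[? ?] := p01 y; have /andP[? ?] := q01 y.
    by rewrite mulr_ge0//= mulr_ile1.
  + by apply: integrableRD; exact: integrable_err.
  + move=> y _; rewrite -mulrDl ler_wpM2r//.
    have -> : \1_(A `&` B) y = \1_A y * \1_B y :> R by rewrite indicI.
    have -> : p y * q y - \1_A y * \1_B y = (p y - \1_A y) * q y + \1_A y * (q y - \1_B y).
      by ring.
    rewrite (le_trans (ler_normD _ _))// !normrM lerD//.
      by rewrite ler_piMr//; have /andP[? ?] := q01 y; rewrite ger0_norm.
    by rewrite ler_piMl//; have /andP[? ?] := indic01 A y; rewrite ger0_norm.
Qed.

Lemma approximable0 : approximable set0.
Proof.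
split => // e e0; exists (fun=> 0); split => //.
- exact: continuous_cstf.
- by move=> y; rewrite lexx ler01.
- rewrite (_ : \int[mu]_y _ = 0) ?ltW//.
  under eq_Rintegral do rewrite indic0 subrr normr0 mul0r.
  by rewrite /Rintegral integral0.
Qed.

Lemma approximableU A B : approximable A -> approximable B -> approximable (A `|` B).
Proof.
move=> gA gB; rewrite -[_ `|` _]setCK setCU.
by apply: approximableC; apply: approximableI; exact: approximableC.
Qed.

(** Dominated convergence: H is integrable and the factors k n are uniformly
    bounded. *)
Lemma cvg_Rint_weight (k : nat -> 'rV[R]_d -> R) (C : R) :
  (forall n, measurable_fun setT (k n)) -> (forall n y, `|k n y| <= C) ->
  (forall y, k n y @[n --> \oo] --> 0) ->
  \int[mu]_y (k n y * H y) @[n --> \oo] --> 0.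
Proof.
move=> mk kC k0.
have [|||||_ _ h] := @dominated_convergence _ _ _ mu setT measurableT
  (fun n y => (k n y * H y)%:E) (cst 0%E) (fun y => (C * H y)%:E).
- by move=> n; apply/measurable_EFinP; exact: measurable_funM.
- exact: measurable_cst.
- apply: aeW => y _; apply/fine_cvgP; split; first exact: nearW.
  have := cvgM (k0 y) (@cvg_cst _ (H y) _ \oo _); rewrite mul0r; exact.
- exact: integrableRZ.
- apply: aeW => y n _; rewrite lee_fin normrM (ger0_norm (H0 y)).
  by rewrite ler_wpM2r.
have : fine \o [sequence (\int[mu]_y (k n y * H y)%:E)%E]_n @ \oo --> fine (\int[mu]_y (cst 0%E y)).
  by apply: fine_cvg; move: h; rewrite integral0.
by rewrite integral0.
Qed.

(** The finite unions of the F n approximate their union in L^1(H dx), and are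
    themselves approximable. *)
Lemma approximable_bigcup (F : nat -> set 'rV[R]_d) :
  (forall n, approximable (F n)) -> approximable (\bigcup_n F n).
Proof.
move=> gF; split; first by apply: bigcup_measurable => n _; exact: (gF n).1.
have gB n : approximable (\big[setU/set0]_(i < n) F i).
  elim: n => [|n IH]; first by rewrite big_ord0; exact: approximable0.
  by rewrite big_ord_recr/=; exact: approximableU.
set B := fun n => \big[setU/set0]_(i < n) F i.
have BF n y : B n y -> (\bigcup_n F n) y.
  rewrite /B -bigcup_mkord => -[i _ Fi]; by exists i.
move=> e e0.
have mF : measurable (\bigcup_n F n) by apply: bigcup_measurable => n _; exact: (gF n).1.
have cv : \int[mu]_y (`|\1_(B n) y - \1_(\bigcup_n F n) y| * H y) @[n --> \oo] --> (0 : R).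
  apply: (@cvg_Rint_weight _ 1).
  - move=> n; apply: measurableT_comp => //; apply: measurable_funB => //.
    by apply: measurable_indic; exact: (gB n).1.
  - by move=> n y; rewrite normr_id normr_sub01_le1// indic01.
  - move=> y; have [[i _ Fi]|nF] := pselect ((\bigcup_n F n) y).
      apply: cvg_near_cst; exists i.+1 => // n /= ni.
      have By : B n y by rewrite /B -bigcup_mkord; exists i.
      rewrite !indicE !mem_set//; last exact: BF By.
      by rewrite subrr normr0.
    apply: cvg_near_cst; apply: nearW => n; rewrite !indicE !memNset ?subrr ?normr0//.
    by move=> /BF.
have /cvgrPdist_le/(_ (e / 2)) := cv; rewrite divr_gt0// => /(_ isT)[n _ /(_ n (leqnn n))].
rewrite /= sub0r normrN => hn.
have [|rho [mr cr r01 re]] := (gB n).2 (e / 2); first by rewrite divr_gt0.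
exists rho; split => //.
have i1 := @integrable_err rho _ mr (gB n).1 r01.
have i2 : mu.-integrable setT (EFin \o (fun y => `|\1_(B n) y - \1_(\bigcup_n F n) y| * H y)).
  by apply: integrable_err => //; [apply: measurable_indic; exact: (gB n).1|exact: indic01].
rewrite (@le_trans _ _ (e / 2 + e / 2))//; last by rewrite -splitr.
apply: le_trans (lerD re (le_trans (ler_norm _) hn)); rewrite -RintegralD//.
apply: le_Rintegral => //.
- exact: integrable_err.
- exact: integrableRD.
- move=> y _; rewrite -mulrDl ler_wpM2r//.
  by rewrite (le_trans _ (ler_normD _ _))// addrA subrK.
Qed.

(** The indicator of the half-space is the limit of the functions
    min(1, n (y_i - a)^+). *)
Lemma approximable_ray i (a : R) : approximable [set y | a < y ord0 i].
Proof.
have mA : measurable [set y : 'rV[R]_d | a < y ord0 i].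
  rewrite (_ : [set _ | _] = setT `&` (fun y : 'rV[R]_d => y ord0 i) @^-1` `]a, +oo[%classic).
    by apply: measurable_coord.
  by rewrite setTI; apply/seteqP; split => y /=; rewrite in_itv/= andbT.
split => // e e0.
pose k n (y : 'rV[R]_d) : R := Num.min 1 (n%:R * Num.max (y ord0 i - a) 0).
have mk n : measurable_fun setT (k n).
  apply: measurable_minr => //; apply: measurable_funM => //; apply: measurable_maxr => //.
  by apply: measurable_funB => //; exact: measurable_coord.
have k01 n y : 0 <= k n y <= 1.
  by rewrite /k le_min ler01 ge_min lexx/= mulr_ge0// le_max lexx orbT.
have ck n : continuous (k n).
  apply: continuous_minf; first exact: continuous_cstf.
  apply: continuous_mulf; first exact: continuous_cstf.
  apply: continuous_maxf; last exact: continuous_cstf.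
  by apply: continuous_subf; [exact: coord_continuous|exact: continuous_cstf].
have cv : \int[mu]_y (`|k n y - \1_[set y : 'rV[R]_d | a < y ord0 i] y| * H y) @[n --> \oo] --> (0 : R).
  apply: (@cvg_Rint_weight _ 1).
  - by move=> n; apply: measurableT_comp => //; apply: measurable_funB.
  - by move=> n y; rewrite normr_id normr_sub01_le1// indic01.
  - move=> y; have [ay|ya] := ltP a (y ord0 i).
      apply: cvg_near_cst; near=> n.
      rewrite indicE mem_set//= /k max_l ?subr_ge0 ?(ltW ay)// min_l ?subrr ?normr0//.
      rewrite -ler_pdivrMr ?subr_gt0// ltW//.
      by near: n; exact: nbhs_infty_gtr.
    apply: cvg_near_cst; apply: nearW => n.
    rewrite indicE memNset/=; last by apply/negP; rewrite -leNgt.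
    by rewrite /k max_r ?subr_le0// mulr0 min_r ?subrr ?normr0 ?ler01.
have /cvgrPdist_le/(_ e e0)[n _ /(_ n (leqnn n))] := cv.
rewrite /= sub0r normrN => hn.
by exists (k n); split => //; exact: le_trans (ler_norm _) hn.
Unshelve. all: by end_near. Qed.

Lemma measurable_approximable A : measurable A -> approximable A.
Proof.
have coor i (B : set R) : measurable B -> approximable ((fun y : 'rV[R]_d => y ord0 i) @^-1` B).
  rewrite (_ : @measurable _ R = (RGenOInfty.G (R:=R)).-sigma.-measurable); last exact: RGenOInfty.measurableE.
  move: B; apply: smallest_sub.
    split.
    - by rewrite preimage_set0; exact: approximable0.
    - by move=> B gB; rewrite setTD preimage_setC; exact: approximableC.
    - by move=> F gF; rewrite preimage_bigcup; exact: approximable_bigcup.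
  move=> B [a ->]; have := approximable_ray i a; congr approximable.
  by apply/seteqP; split => y /=; rewrite in_itv/= andbT.
move: A; apply: smallest_sub.
  split.
  - exact: approximable0.
  - by move=> B gB; rewrite setTD; exact: approximableC.
  - by move=> F gF; exact: approximable_bigcup.
rewrite -bigcup_seq; apply: bigcup_sub => i _ A [B mB <-].
by rewrite setTI; exact: coor.
Qed.

End continuous_approximation.

(** * From averages to almost every point *)

Section weak_inequalities.
Context {R : realType} {d : nat}.
Implicit Types (x y : 'rV[R]_d) (w h chi : 'rV[R]_d -> R).
Let mu := lebesgue_rv R d.

Definition locally_bounded w : Prop :=
  forall r : R, exists M : R, forall y, cube r y -> `|w y| <= M.

Definition test01 chi : Prop :=
  [/\ measurable_fun setT chi, continuous chi, forall y, 0 <= chi y <= 1 &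
    exists r : R, forall y, ~ cube r y -> chi y = 0].

Lemma continuous_sqn : continuous (@sqn R d).
Proof.
suff h (s : seq 'I_d) : continuous (fun x : 'rV[R]_d => \sum_(i <- s) x ord0 i * x ord0 i).
  exact: h.
elim: s => [|i s IH].
  by under eq_fun do rewrite big_nil; exact: continuous_cstf.
under eq_fun do rewrite big_cons; apply: continuous_addf => //.
by apply: continuous_mulf; exact: coord_continuous.
Qed.

Lemma cube_sqn x : cube (sqn x + 1) x.
Proof.
move=> i; have := sqr_coord_le x i; rewrite -real_normK ?num_real//.
have := normr_ge0 (x ord0 i); nra.
Qed.


Lemma integrable_test w chi : measurable_fun setT w -> locally_bounded w ->
  measurable_fun setT chi -> (forall y, `|chi y| <= 1) ->
  (exists r : R, forall y, ~ cube r y -> chi y = 0) ->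
  mu.-integrable setT (EFin \o (fun y => w y * chi y)).
Proof.
move=> mw lw mc c1 [r cr]; have [M wM] := lw r.
by apply: (integrable_kernel (e := 1) mw mc cr wM _).1 => y _.
Qed.

Definition cutoff (n : nat) y : R := Num.min 1 (Num.max (n%:R - sqn y) 0).

Lemma cutoff_test n : test01 (cutoff n).
Proof.
split.
- apply: measurable_minr => //; apply: measurable_maxr => //.
  apply: measurable_funB => //; exact: measurable_sqn.
- apply: continuous_minf; first exact: continuous_cstf.
  apply: continuous_maxf; last exact: continuous_cstf.
  by apply: continuous_subf; [exact: continuous_cstf|exact: continuous_sqn].
- by move=> y; rewrite /cutoff le_min ler01 ge_min lexx/= le_max lexx orbT.
- exists (n%:R + 1) => y /existsNP[i /negP]; rewrite -ltNge => yi.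
  have n0 : (0 : R) <= n%:R by [].
  have : n%:R < sqn y.
    rewrite (lt_le_trans _ (sqr_coord_le y i))// -real_normK ?num_real//.
    by nra.
  by move=> ny; rewrite /cutoff max_r ?min_r//; lra.
Qed.

(** The indicator of {h < 0} is a limit of test functions in the L^1 space with
    weight |h|, localized by a cutoff; hence the integral of h over that set is
    nonnegative, and the set is negligible. *)
Lemma ae_ge0_of_test h : measurable_fun setT h -> locally_bounded h ->
  (forall chi, test01 chi -> 0 <= \int[mu]_y (h y * chi y)) ->
  {ae mu, forall y, 0 <= h y}.
Proof.
move=> mh lh hpos.
pose A := [set y | h y < 0].
have mA : measurable A.
  rewrite (_ : A = setT `&` h @^-1` `]-oo, 0%R[%classic); first exact: mh.
  by rewrite setTI; apply/seteqP; split => y /=; rewrite in_itv.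
suff step n : {ae mu, forall y, sqn y < n%:R -> 0 <= h y}.
  have /ae_foralln := step; apply: filterS => y hy.
  apply: (hy (Num.truncn (sqn y)).+1); exact: truncnS_gt.
have [mk ck k01 [r kr]] := cutoff_test n.
have kn y : `|cutoff n y| <= 1 by have /andP[? ?] := k01 y; rewrite ger0_norm.
pose H y := `|h y| * cutoff n y.
have mH : measurable_fun setT H.
  by apply: measurable_funM => //; exact: measurableT_comp.
have H0 y : 0 <= H y by rewrite mulr_ge0//; have /andP[] := k01 y.
have lah : locally_bounded (fun y => `|h y|).
  by move=> s; have [M hM] := lh s; exists M => y cy; rewrite normr_id hM.
have iH : mu.-integrable setT (EFin \o H).
  by apply: integrable_test => //; [exact: measurableT_comp|exists r].
have i1A : mu.-integrable setT (EFin \o (fun y => \1_A y * H y)).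
  apply: (@integrable_weight R d H mH H0 iH _ 1) => //.
  by move=> y; have /andP[? ?] := indic01 A y; rewrite ger0_norm.
have le0 : \int[mu]_y (\1_A y * H y) <= 0.
  apply/ler_addgt0Pr => e e0; rewrite add0r.
  have [_ /(_ e e0)[rho [mr cr r01 re]]] := measurable_approximable H mH H0 iH A mA.
  have rn y : `|rho y| <= 1 by have /andP[? ?] := r01 y; rewrite ger0_norm.
  have tr : test01 (fun y => rho y * cutoff n y).
    split.
    - exact: measurable_funM.
    - exact: continuous_mulf.
    - move=> y; have /andP[? ?] := r01 y; have /andP[? ?] := k01 y.
      by rewrite mulr_ge0//= mulr_ile1.
    - by exists r => y cy; rewrite kr ?mulr0.
  have ih : mu.-integrable setT (EFin \o (fun y => h y * (rho y * cutoff n y))).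
    case: tr => m1 _ m3 m4; apply: integrable_test => // y.
    by have /andP[? ?] := m3 y; rewrite ger0_norm.
  have ie := @integrable_err _ _ H mH H0 iH rho A mr mA r01.
  have := hpos _ tr; rewrite -(lerD2r (\int[mu]_y (\1_A y * H y))) add0r => h1.
  apply: (le_trans h1); apply: le_trans re.
  rewrite -RintegralD//; apply: le_Rintegral => //; first exact: integrableRD.
  move=> y _; rewrite /H indicE.
  have /andP[? ?] := r01 y; have /andP[? ?] := k01 y.
  have [yA|yA] := boolP (y \in A).
    have : h y < 0 by move: yA; rewrite inE.
    move=> hy; rewrite /= (ltr0_norm hy) (ler0_norm (_ : rho y - 1 <= 0)); last lra.
    by nra.
  have : 0 <= h y by move: yA; rewrite notin_setE /A /= => /negP; rewrite -leNgt.
  move=> hy; rewrite /= mul0r addr0 subr0 !ger0_norm//.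
  by rewrite le_eqVlt; apply/orP; left; apply/eqP; ring.
have p0 y : 0 <= \1_A y * H y by rewrite mulr_ge0//; have /andP[] := indic01 A y.
have eq0 : (\int[mu]_y `|(\1_A y * H y)%:E|)%E = 0%E.
  under eq_integral => y _ do rewrite gee0_abs ?lee_fin//.
  apply/eqP; rewrite eq_le; apply/andP; split; last first.
    by apply: integral_ge0 => y _; rewrite lee_fin.
  rewrite -(fineK (integrable_fin_num measurableT i1A)) lee_fin; exact: le0.
have := (ae_eq_integral_abs mu measurableT (measurable_int mu i1A)).1 eq0.
apply: filterS => y /(_ I) [] /eqP; rewrite mulf_eq0 indicE => /orP[|].
  by rewrite pnatr_eq0 eqb0 notin_setE /A /= => /negP; rewrite -leNgt.
rewrite /H mulf_eq0 normr_eq0 => /orP[/eqP ->//|/eqP k0 yn].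
suff : 0 < cutoff n y by rewrite k0 ltxx.
by rewrite /cutoff lt_min ltr01 lt_max subr_gt0 yn.
Qed.

Lemma bumpC m dl x y : bump m dl x y = bump m dl y x :> R.
Proof. by rewrite /bump -[y - x]opprB sqnN. Qed.

Definition mass (dl : R) : R := avg 5 dl (fun=> 1 : R) (0 : 'rV[R]_d).

Lemma integral_bump m dl x :
  \int[mu]_y bump m dl x y = \int[mu]_y bump m dl 0 y :> R.
Proof.
rewrite /Rintegral; congr fine.
rewrite -(@ge0_integral_shift_rv R d (- x) (fun y => (bump m dl 0 y)%:E)).
- by apply: eq_integral => y _; rewrite /bump subr0.
- by apply/measurable_EFinP; exact: measurable_bump.
- by move=> y; rewrite lee_fin bump_ge0.
Qed.

Lemma massE dl x : mass dl = \int[mu]_y bump 5 dl x y.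
Proof.
by rewrite integral_bump; apply: eq_Rintegral => y _; rewrite mul1r.
Qed.

Lemma integrable_bump m dl x : (0 < m)%N -> 0 <= dl -> dl <= 1 ->
  mu.-integrable setT (EFin \o bump m dl x).
Proof.
move=> m0 d0 d1; apply: (eq_integrable _ (EFin \o (fun y => 1 * bump m dl x y))) => //.
  by move=> y _ /=; rewrite mul1r.
apply: (@integrable_avg _ _ _ (sqn x + 1) 1) => //; first exact: cube_sqn.
by move=> y _; rewrite normr1.
Qed.

End weak_inequalities.

Section weak_to_strong.
Context {R : realType} {d : nat}.
Implicit Types (x y : 'rV[R]_d) (w h chi : 'rV[R]_d -> R).
Let mu := lebesgue_rv R d.

Lemma integrable_indic_cube (r : R) :
  mu.-integrable setT (EFin \o (\1_(cube r) : 'rV[R]_d -> R)).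
Proof.
apply: (eq_integrable _ (EFin \o (fun y => 1 * \1_(cube r) y))) => //.
  by move=> y _ /=; rewrite mul1r.
apply: (integrable_kernel (e := 1) (r := r) (M := 1) _ _ _ _ _).1 => //.
- by apply: measurable_indic; exact: measurable_cube.
- by move=> y cy; rewrite indicE memNset.
- by move=> y _; rewrite normr1.
- by move=> y _; have /andP[? ?] := indic01 (cube r) y; rewrite ger0_norm.
Qed.

(** The bump is bounded below on a small cube around its centre, which has
    positive volume. *)
Lemma mass_gt0 (dl : R) : 0 < dl -> dl <= 1 -> 0 < @mass R d dl.
Proof.
move=> d0 d1; have d0' := ltW d0.
(* on the cube of half-side s one has |y|^2 <= d s^2 <= dl^2 / 2 *)
pose s := dl / (d%:R + 2).
have s0 : 0 < s by rewrite divr_gt0// ltr_wpDl.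
have sb y : cube s y -> sqn y <= dl ^+ 2 / 2.
  move=> cy; rewrite sqnE (@le_trans _ _ (\sum_(i < d) s ^+ 2))//.
    apply: ler_sum => i _; rewrite -real_normK ?num_real// lerXn2r// nnegrE//.
    exact: ltW.
  rewrite sumr_const card_ord -[leLHS]mulr_natl /s expr_div_n mulrCA ler_wpM2l ?sqr_ge0//.
  rewrite ler_pdivrMr ?exprn_gt0 ?ltr_wpDl//.
  have : (0 : R) <= d%:R by []. nra.
rewrite (massE _ 0).
apply: (@lt_le_trans _ _ (\int[mu]_y ((dl ^+ 2 / 2) ^+ 5 * \1_(cube s) y))).
  rewrite RintegralZl//; last exact: integrable_indic_cube.
  rewrite mulr_gt0 ?exprn_gt0 ?divr_gt0 ?exprn_gt0//.
  rewrite /Rintegral integral_indic ?setIT//; last exact: measurable_cube.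
  by rewrite [X in fine X]lebesgue_rv_cubeE//= exprn_gt0 ?mulr_gt0.
apply: le_Rintegral => //.
- by apply: integrableRZ; exact: integrable_indic_cube.
- exact: integrable_bump.
- move=> y _; rewrite indicE; have [yc|] := boolP (y \in cube s); last first.
    by rewrite mulr0 bump_ge0.
  rewrite mulr1 /bump subr0; have := sb y; move: yc; rewrite inE => yc /(_ yc) h.
  have dd : 0 <= dl ^+ 2 by rewrite sqr_ge0.
  rewrite ppow_pos; last lra.
  by rewrite lerXn2r ?nnegrE; lra.
Qed.

Lemma EFin_RintegralZ a (f : 'rV[R]_d -> R) : mu.-integrable setT (EFin \o f) ->
  ((a * \int[mu]_y f y)%:E = \int[mu]_y (a * f y)%:E)%E.
Proof.
move=> fi; rewrite -RintegralZl// /Rintegral fineK//.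
exact: integrable_fin_num (integrableRZ a _ fi).
Qed.

(** Fubini, the bump being symmetric in its centre and its argument. *)
Lemma avg_adjoint m (dl : R) w chi : (0 < m)%N -> 0 <= dl -> dl <= 1 ->
  measurable_fun setT w -> locally_bounded w -> test01 chi ->
  mu.-integrable setT (EFin \o (fun x => chi x * avg m dl w x)) /\
  \int[mu]_x (chi x * avg m dl w x) = \int[mu]_y (w y * avg m dl chi y).
Proof.
move=> m0 d0 d1 mw lw [mc _ c01 [r cr]].
have [M wM] := lw (r + 1).
pose D : set ('rV[R]_d * 'rV[R]_d) := cube r `*` cube (r + 1).
pose f (z : 'rV[R]_d * 'rV[R]_d) : R := chi z.1 * (w z.2 * bump m dl z.1 z.2).
have mD : measurable D by apply: measurableX; exact: measurable_cube.
have mf : measurable_fun setT f.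
  apply: measurable_funM; first exact: (measurableT_comp mc (@measurable_fst _ _ _ _)).
  apply: measurable_funM; first exact: (measurableT_comp mw (@measurable_snd _ _ _ _)).
  exact: measurable_bump2.
have f0 z : ~ D z -> f z = 0.
  move=> nD; rewrite /f; have [c1|c1] := pselect (cube r z.1); last by rewrite cr// mul0r.
  have c2 : ~ cube (r + 1) z.2 by move=> c2; apply: nD.
  by rewrite (bump_supp r)// !mulr0.
have fM z : D z -> `|f z| <= M.
  move=> [c1 c2]; rewrite /f normrM (@le_trans _ _ (1 * (M * 1)))//; last by rewrite mul1r mulr1.
  rewrite ler_pM//; first by have /andP[? ?] := c01 z.1; rewrite ger0_norm.
  by rewrite normrM ler_pM// ?wM// normr_bump.
have fD : ((mu \x mu) D < +oo)%E.
  rewrite [ltLHS]product_measure1E; [|exact: measurable_cube|exact: measurable_cube].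
  by apply: lte_mul_pinfty => //; [rewrite ge0_fin_numE//|]; exact: lebesgue_rv_cube.
have i1 : (mu \x mu)%E.-integrable D (EFin \o f).
  apply: measurable_bounded_integrable => //; first exact: measurable_funTS.
  exists M; split; first exact: num_real.
  by move=> z Mz y cy /=; exact: le_trans (fM _ cy) (ltW Mz).
have i2 : (mu \x mu)%E.-integrable setT (EFin \o f).
  move: i1; rewrite integrable_mkcond//.
  apply: eq_integrable => // y _ /=; rewrite /patch; case: ifPn => //.
  by rewrite notin_setE => /f0 ->.
have := Fubini i2; rewrite /= => FU.
have FE x : ((chi x * avg m dl w x)%:E = \int[mu]_y (f (x, y))%:E)%E.
  rewrite /f /=.
  have [c1|c1] := pselect (cube r x); last first.
    rewrite (cr _ c1).
    rewrite [X in X%:E]mul0r.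
    apply/esym.
    apply: integral0_eq => y _.
    by rewrite mul0r.
  have iw := @integrable_avg R d w r M m dl x m0 d0 d1 mw c1 wM.
  exact: EFin_RintegralZ iw.
split.
  have iF := integrable_fubini_F i2.
  have E : fubini_F mu (EFin \o f) = (EFin \o (fun x => chi x * avg m dl w x)).
    by apply/funext => x; rewrite [RHS]FE.
  by rewrite -E.
rewrite {1}/Rintegral; under eq_integral do rewrite FE.
rewrite FU; congr fine; apply: eq_integral => y _; rewrite /f /=.
have cy := cube_sqn y.
have c1 z : cube (sqn y + 1 + 1) z -> `|chi z| <= 1.
  by have /andP[? ?] := c01 z; rewrite ger0_norm.
have ic := integrable_avg m0 d0 d1 mc cy c1.
transitivity (\int[mu]_x (w y * (chi x * bump m dl y x))%:E)%E; last first.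
  by symmetry; exact: (EFin_RintegralZ (w y) _ ic).
by apply: eq_integral => x _; congr EFin; rewrite mulrCA bumpC.
Qed.

(** Radii tend to zero and stay below 1/2, which keeps the constants of the
    barrier bounded. *)
Definition radius (n : nat) : R := n.+2%:R^-1.

Lemma radius_gt0 n : 0 < radius n. Proof. by rewrite invr_gt0. Qed.

Lemma radius_le n : radius n <= 2^-1.
Proof. by rewrite lef_pV2 ?posrE// ler_nat. Qed.

Lemma radius_le1 n : radius n <= 1.
Proof. by have := radius_le n; lra. Qed.

Lemma near_radius (e : R) : 0 < e -> \forall n \near \oo, radius n < e.
Proof.
move=> e0; near=> n.
rewrite /radius invf_plt ?posrE//.
rewrite (@lt_trans _ _ n%:R) ?ltr_nat//.
by near: n; exact: nbhs_infty_gtr.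
Unshelve. all: by end_near. Qed.

Lemma cvg_avg chi y : test01 chi ->
  avg 5 (radius n) chi y / @mass R d (radius n) @[n --> \oo] --> chi y.
Proof.
move=> [mc cc c01 _]; apply/cvgrPdist_le => e e0.
have /cvgrPdist_lt/(_ e e0) := cc y.
move=> /nbhs_ballP[dl /= dl0 Hdl].
near=> n.
have dn : radius n < dl by near: n; exact: near_radius.
have m0 := mass_gt0 (radius n) (radius_gt0 n) (radius_le1 n).
rewrite -(mulfK (lt0r_neq0 m0) (chi y)) -mulrBl normrM normfV (gtr0_norm m0).
rewrite ler_pdivrMr// (massE _ y).
have [r0 r1] := (ltW (radius_gt0 n), radius_le1 n).
have ib := @integrable_bump R d 5 _ y isT r0 r1.
have c1 z : cube (sqn y + 1 + 1) z -> `|chi z| <= 1.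
  by have /andP[? ?] := c01 z; rewrite ger0_norm.
have ic := @integrable_avg _ _ chi _ _ 5 _ y isT r0 r1 mc (cube_sqn y) c1.
rewrite -(RintegralZl (chi y) measurableT ib) -(RintegralZl e measurableT ib).
rewrite -(RintegralB measurableT (integrableRZ _ _ ib) ic).
have id : mu.-integrable setT (EFin \o (fun x => chi y * bump 5 (radius n) y x - chi x * bump 5 (radius n) y x)).
  by apply: integrableRB => //; exact: integrableRZ.
apply: (le_trans (le_normr_Rintegral measurableT id)).
apply: le_Rintegral => //.
- exact: integrable_norm.
- exact: integrableRZ.
move=> x _; rewrite -mulrBl normrM (ger0_norm (bump_ge0 _ _ _ _)).
have [xy|xy] := pselect (ball y dl x).
  by rewrite ler_wpM2r ?bump_ge0//; exact/ltW/Hdl.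
suff -> : bump 5 (radius n) y x = 0 by rewrite !mulr0.
apply: ppow_neg => //.
apply: contrapT => /negP; rewrite -ltNge subr_gt0 => h; apply: xy; split => // i j.
rewrite (ord1 i) /ball /=.
have := sqr_coord_le (x - y) j; rewrite !mxE => h2.
rewrite distrC -ltr_sqr ?nnegrE ?(ltW dl0)// real_normK ?num_real//.
rewrite (le_lt_trans h2)// (lt_trans h)// ltr_sqr ?nnegrE// ltW//.
Unshelve. all: by end_near. Qed.

(** Integrate the inequality against a continuous test function chi and move the
    average from w to chi with [avg_adjoint]; normalized averages of chi tend
    to chi, so the inequality holds between the integrals of w and h against
    every such chi. *)
Lemma ae_le_of_avg w h : measurable_fun setT w -> locally_bounded w ->
  measurable_fun setT h -> locally_bounded h ->
  (forall r e : R, 0 < e -> \forall n \near \oo, forall x, cube r x ->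
     avg 5 (radius n) w x <= @mass R d (radius n) * (h x + e)) ->
  {ae mu, forall y, w y <= h y}.
Proof.
move=> mw lw mh lh H.
suff : {ae mu, forall y, 0 <= h y - w y}.
  by apply: filterS => y; rewrite subr_ge0.
apply: ae_ge0_of_test.
- exact: measurable_funB.
- move=> r; have [M1 h1] := lh r; have [M2 h2] := lw r.
  by exists (M1 + M2) => y cy; rewrite (le_trans (ler_normB _ _))// lerD ?h1 ?h2.
move=> chi tchi; have [mc cc c01 [r cr]] := tchi.
have cn y : `|chi y| <= 1 by have /andP[? ?] := c01 y; rewrite ger0_norm.
have iw : mu.-integrable setT (EFin \o (fun y => w y * chi y)).
  by apply: integrable_test => //; exists r.
have ih : mu.-integrable setT (EFin \o (fun y => h y * chi y)).
  by apply: integrable_test => //; exists r.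
have i1 : mu.-integrable setT (EFin \o (fun y => 1 * chi y)).
  by apply: integrable_test => //; [move=> s; exists 1 => y _; rewrite normr1|exists r].
under eq_Rintegral do rewrite mulrBl.
rewrite RintegralB// subr_ge0.
have [M wM] := lw (r + 1).
pose k n y : R := `|avg 5 (radius n) chi y / @mass R d (radius n) - chi y|.
pose Hw y : R := `|w y| * \1_(cube (r + 1)) y.
have avg0 n y : ~ cube (r + 1) y -> avg 5 (radius n) chi y = 0.
  move=> cy; rewrite /avg /Rintegral; under eq_integral => z _.
    rewrite (_ : chi z * bump 5 (radius n) y z = 0); last first.
      have [cz|/cr ->] := pselect (cube r z); last by rewrite mul0r.
      rewrite bumpC (bump_supp r)// ?mulr0//; [exact/ltW/radius_gt0|exact: radius_le1].
    over.
  by rewrite integral0.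
have avg1 n y : 0 <= avg 5 (radius n) chi y / @mass R d (radius n) <= 1.
  have m0 := mass_gt0 (radius n) (radius_gt0 n) (radius_le1 n).
  have [r0 r1] := (ltW (radius_gt0 n), radius_le1 n).
  apply/andP; split.
    apply: divr_ge0; last exact: ltW.
    apply: Rintegral_ge0 => z _.
    by rewrite mulr_ge0 ?bump_ge0//; have /andP[] := c01 z.
  rewrite ler_pdivrMr// mul1r (massE _ y); apply: le_Rintegral => //.
  - exact: (@integrable_avg _ _ chi _ _ 5 _ y isT r0 r1 mc (cube_sqn y) (fun z _ => cn z)).
  - exact: integrable_bump.
  - by move=> z _; rewrite ler_piMl ?bump_ge0//; have /andP[] := c01 z.
have mavg n : measurable_fun setT (avg 5 (radius n) chi).
  apply: (measurableT_comp (fine_measurable measurableT)).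
  apply: (@measurable_fun_fubini_tonelli_F _ _ _ _ _ mu (fun z => (chi z.2 * bump 5 (radius n) z.1 z.2)%:E)).
    apply/measurable_EFinP; apply: measurable_funM; last exact: measurable_bump2.
    exact: (measurableT_comp mc (@measurable_snd _ _ _ _)).
  by move=> z; rewrite lee_fin mulr_ge0 ?bump_ge0//; have /andP[] := c01 z.2.
have mHw : measurable_fun setT Hw.
  apply: measurable_funM; first exact: measurableT_comp.
  by apply: measurable_indic; exact: measurable_cube.
have Hw0 y : 0 <= Hw y by rewrite mulr_ge0.
have iHw : mu.-integrable setT (EFin \o Hw).
  apply: (integrable_kernel (e := 1) (r := r + 1) (M := M) _ _ _ _ _).1 => //.
  - exact: measurableT_comp.
  - by apply: measurable_indic; exact: measurable_cube.
  - by move=> y cy; rewrite indicE memNset.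
  - by move=> y cy; rewrite normr_id wM.
  - by move=> y _; have /andP[? ?] := indic01 (cube (r + 1)) y; rewrite ger0_norm.
have cv : \int[mu]_y (k n y * Hw y) @[n --> \oo] --> (0 : R).
  apply: (@cvg_Rint_weight R d Hw mHw Hw0 iHw k 1).
  - move=> n; apply: measurableT_comp => //; apply: measurable_funB => //.
    exact: measurable_funM.
  - by move=> n y; rewrite normr_id normr_sub01_le1.
  - move=> y; have /cvgrPdist_le h0 := cvg_avg chi y tchi.
    apply/cvgrPdist_le => e e0; have := h0 e e0; apply: filterS => n.
    by rewrite sub0r normrN normr_id distrC.
apply/ler_addgt0Pr => e e0.
have I0 : 0 <= \int[mu]_y chi y by apply: Rintegral_ge0 => y _; have /andP[] := c01 y.
set I := \int[mu]_y chi y in I0 *.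
pose e1 := e / (2 * (I + 1)).
have e10 : 0 < e1 by rewrite divr_gt0 ?mulr_gt0// ltr_wpDl.
have e20 : 0 < e / 2 by rewrite divr_gt0.
have [n [hn1 hn2]] : exists n, (forall x, cube r x ->
     avg 5 (radius n) w x <= @mass R d (radius n) * (h x + e1)) /\
     `|\int[mu]_y (k n y * Hw y)| <= e / 2.
  have /cvgrPdist_le/(_ _ e20) h1 := cv.
  near \oo => n; exists n; split; first by near: n; exact: H.
  rewrite -normrN -[X in `|X|]add0r. near: n; exact: h1.
have m0 := mass_gt0 (radius n) (radius_gt0 n) (radius_le1 n).
have [r0 r1] := (ltW (radius_gt0 n), radius_le1 n).
have iwa : mu.-integrable setT (EFin \o (fun y => w y * (avg 5 (radius n) chi y / @mass R d (radius n)))).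
  apply: (integrable_test w (fun y => avg 5 (radius n) chi y / @mass R d (radius n)) mw lw).
  - exact: measurable_funM.
  - by move=> y; have /andP[? ?] := avg1 n y; rewrite ger0_norm.
  - by exists (r + 1) => y cy; rewrite avg0// mul0r.
have s1 : \int[mu]_y (w y * chi y) <=
    \int[mu]_y (w y * (avg 5 (radius n) chi y / @mass R d (radius n))) + e / 2.
  rewrite -lerBlDl -RintegralB//.
  apply: le_trans hn2; apply: le_trans (ler_norm _).
  apply: le_Rintegral => //; first exact: integrableRB.
    apply: (@integrable_weight R d Hw mHw Hw0 iHw _ 1).
      by apply: measurableT_comp => //; apply: measurable_funB => //; exact: measurable_funM.
    by move=> y; rewrite normr_id normr_sub01_le1.
  move=> y _; rewrite -mulrBr /k /Hw indicE.
  have [yc|yc] := boolP (y \in cube (r + 1)).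
    by rewrite mulr1 (le_trans (ler_norm _))// normrM distrC mulrC.
  move: yc; rewrite notin_setE => yc; rewrite avg0// cr ?mul0r ?subrr ?mulr0//.
  by move=> yr; apply: yc; apply: cubeS yr; rewrite lerDl.
have s2 : \int[mu]_y (w y * (avg 5 (radius n) chi y / @mass R d (radius n))) <=
   \int[mu]_y (h y * chi y) + e1 * I.
  have [ia ea] := avg_adjoint 5 (radius n) w chi isT r0 r1 mw lw tchi.
  have i1' : mu.-integrable setT (EFin \o chi).
    rewrite (_ : chi = fun y => 1 * chi y) //; by apply/funext => y; rewrite mul1r.
  have iwm : mu.-integrable setT (EFin \o (fun y => w y * avg 5 (radius n) chi y)).
    rewrite (_ : (fun y => w y * avg 5 (radius n) chi y) = (fun y =>
      @mass R d (radius n) * (w y * (avg 5 (radius n) chi y / @mass R d (radius n))))).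
      exact: integrableRZ.
    by apply/funext => y; rewrite [RHS]mulrC -mulrA divfK// lt0r_neq0.
  have ie := integrableRZ e1 _ i1'.
  have ihe := integrableRD _ _ ih ie.
  under eq_Rintegral do rewrite mulrA.
  rewrite (RintegralZr _ measurableT iwm) -ea -(RintegralZl e1 measurableT i1').
  rewrite -(RintegralD measurableT ih ie) ler_pdivrMr//.
  rewrite -(RintegralZr _ measurableT ihe).
  apply: (le_Rintegral measurableT ia).
    rewrite (_ : (fun y => _ * _) = (fun y => @mass R d (radius n) * (h y * chi y + e1 * chi y))).
      exact: integrableRZ.
    by apply/funext => y; rewrite mulrC.
  move=> y _; have [cy|/cr ->] := pselect (cube r y); last by rewrite !mulr0 !mul0r addr0 mul0r.
  have /andP[c0 _] := c01 y.
  rewrite -mulrDl mulrAC mulrC ler_wpM2r// mulrC; exact: hn1.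
have s3 : e1 * I <= e / 2.
  rewrite /e1 invfM mulrA mulrAC -[X in _ <= X]mulr1 -mulrA ler_wpM2l ?(ltW e20)//.
  by rewrite ler_pdivrMr ?mul1r ?ltr_wpDl// lerDl.
lra.
Unshelve. all: by end_near. Qed.

End weak_to_strong.

(** * Estimates for the barrier *)

Section barrier.
Context {R : realType} {d : nat}.
Implicit Types (x y : 'rV[R]_d) (w : 'rV[R]_d -> R).
Let mu := lebesgue_rv R d.

(** The loss of a factor 1 + 2 dl when x is replaced by a point at distance at
    most dl is absorbed in the exponent of the barrier. *)
Lemma sqn_near (dl : R) x y : 0 < dl -> dl <= 1 -> sqn (y - x) <= dl ^+ 2 ->
  1 + sqn y <= (1 + 2 * dl) * (1 + sqn x).
Proof.
move=> d0 d1 yx.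
have h : sqn y <= (1 + dl) * sqn x + (1 + dl^-1) * sqn (y - x).
  rewrite !sqnE !mulr_sumr -big_split/=; apply: ler_sum => i _; rewrite !mxE.
  set a := x ord0 i; set b := y ord0 i.
  have e : dl * dl^-1 = 1 by rewrite divff// lt0r_neq0.
  have := sqr_ge0 (dl * a - (b - a)); have := sqr_ge0 (b - a).
  have i0 : 0 < dl^-1 by rewrite invr_gt0.
  move=> h1 h2.
  have := mulr_ge0 (ltW i0) h2.
  have -> : dl^-1 * (dl * a - (b - a)) ^+ 2 =
    (dl * dl^-1) * dl * a ^+ 2 - (dl * dl^-1) * (2 * a * (b - a)) + dl^-1 * (b - a) ^+ 2 by ring.
  rewrite e; nra.
have h2 : (1 + dl^-1) * sqn (y - x) <= dl ^+ 2 + dl.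
  rewrite (le_trans (ler_wpM2l _ yx))//; first by rewrite addr_ge0// invr_ge0 ltW.
  by rewrite mulrDl mul1r expr2 mulrA mulVf ?lt0r_neq0// mul1r.
have := sqn_ge0 x; nra.
Qed.

Lemma avg_ae_bound w (C : R) (dl : R) x : 0 < dl -> dl <= 1 -> 0 <= C ->
  measurable_fun setT w -> locally_bounded w ->
  {ae mu, forall y, sqn (y - x) <= dl ^+ 2 -> `|w y| <= C} ->
  `|avg 5 dl w x| <= C * @mass R d dl.
Proof.
move=> d0 d1 C0 mw lw wC; have [M wM] := lw (sqn x + 1 + 1).
have iw := @integrable_avg R d w _ M 5 dl x isT (ltW d0) d1 mw (cube_sqn x) wM.
have ib := @integrable_bump R d 5 dl x isT (ltW d0) d1.
rewrite (massE _ x) -(RintegralZl C measurableT ib).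
apply: (le_trans (le_normr_Rintegral measurableT iw)).
have i1 := integrable_norm iw.
have i2 := integrableRZ C _ ib.
rewrite /Rintegral; apply: fine_le.
- exact: (integrable_fin_num measurableT i1).
- exact: (integrable_fin_num measurableT i2).
apply: ae_ge0_le_integral => //.
- exact: (measurable_int mu i1).
- by move=> y _; rewrite lee_fin mulr_ge0 ?bump_ge0.
- exact: (measurable_int mu i2).
apply: filterS wC => y wy _; rewrite lee_fin normrM (ger0_norm (bump_ge0 _ _ _ _)).
have [/wy h|h] := leP (sqn (y - x)) (dl ^+ 2); first by rewrite ler_wpM2r ?bump_ge0.
rewrite (_ : bump 5 dl x y = 0) ?mulr0//.
by apply: ppow_neg => //; rewrite subr_le0 ltW.
Qed.

(** From exp(- u) >= 1 - u and (1 + u + 2 u^2) (1 - u) >= 1. *)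
Lemma expR_quad (u : R) : u <= 2^-1 -> expR u <= 1 + u + 2 * u ^+ 2.
Proof.
move=> u2; have h : 0 < 1 - u by lra.
have h1 : 1 - u <= expR (- u) by exact: expR_ge1Dx.
have e : expR u * expR (- u) = 1 by rewrite -expRD subrr expR0.
have h2 : expR u * (1 - u) <= 1 by rewrite -[leRHS]e ler_wpM2l ?expR_ge0.
have h3 : 1 <= (1 + u + 2 * u ^+ 2) * (1 - u).
  have -> : (1 + u + 2 * u ^+ 2) * (1 - u) = 1 + u ^+ 2 * (1 - 2 * u) by ring.
  by rewrite lerDl mulr_ge0 ?sqr_ge0//; lra.
by rewrite -(ler_pM2r h); exact: le_trans h2 h3.
Qed.

Lemma expR_convex (u s : R) : (u - s) * expR s <= expR u - expR s.
Proof.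
have -> : expR u = expR (u - s) * expR s by rewrite -expRD subrK.
have := expR_ge1Dx (u - s); have := expR_gt0 s; nra.
Qed.

(** Second differences stand for the Laplacian of exp(b (1 + |x|^2)), which is
    (2 b d + 4 b^2 |x|^2) exp(b (1 + |x|^2)); the larger constant 16 is harmless
    and comes from the crude bound [expR_quad]. *)
Lemma barrier_second (b h : R) x : 0 <= b -> 0 < h ->
  h * (b * (2 * (sqn x + 1) + 1)) <= 2^-1 -> h <= 1 ->
  \sum_(i < d) (expR (b * (1 + sqn (x + h *: delta_mx ord0 i))) +
    expR (b * (1 + sqn (x - h *: delta_mx ord0 i))) - 2 * expR (b * (1 + sqn x)))
  <= expR (b * (1 + sqn x)) * h ^+ 2 *
     (2 * b * d%:R + 16 * b ^+ 2 * sqn x + 4 * b ^+ 2 * d%:R * h).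
Proof.
move=> b0 h0 hb h1; set E := expR _.
have E0 : 0 < E by exact: expR_gt0.
rewrite (@le_trans _ _ (\sum_(i < d) E * h ^+ 2 *
   (2 * b + 16 * b ^+ 2 * x ord0 i ^+ 2 + 4 * b ^+ 2 * h)))//; last first.
  rewrite -mulr_sumr; have -> : \sum_(i < d) (2 * b + 16 * b ^+ 2 * x ord0 i ^+ 2 + 4 * b ^+ 2 * h) =
      2 * b * d%:R + 16 * b ^+ 2 * sqn x + 4 * b ^+ 2 * d%:R * h.
    rewrite sqnE mulr_sumr !big_split/= !sumr_const card_ord.
    by rewrite -[2 * b *+ d]mulr_natr -[4 * b ^+ 2 * h *+ d]mulr_natr; ring.
  by [].
apply: ler_sum => i _; rewrite -scaleNr !sqn_shift.
have xi := cube_sqn x i.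
have step (s : R) : `|s| = h -> expR (b * (1 + (sqn x + 2 * s * x ord0 i + s ^+ 2))) <=
   E * (1 + b * (2 * s * x ord0 i + h ^+ 2) + 2 * (b * (2 * s * x ord0 i + h ^+ 2)) ^+ 2).
  move=> sh; have s2 : s ^+ 2 = h ^+ 2 by rewrite -real_normK ?num_real// sh.
  have -> : b * (1 + (sqn x + 2 * s * x ord0 i + s ^+ 2)) =
    b * (1 + sqn x) + b * (2 * s * x ord0 i + h ^+ 2) by rewrite s2; ring.
  rewrite expRD ler_wpM2l ?(ltW E0)// expR_quad// (le_trans _ hb)//.
  rewrite mulrCA ler_wpM2l//.
  have : s * x ord0 i <= h * (sqn x + 1).
    by rewrite (le_trans (ler_norm _))// normrM sh ler_wpM2l// ltW.
  have : h ^+ 2 <= h by rewrite expr2 ler_piMr// ltW.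
  lra.
have s1 := step h (ger0_norm (ltW h0)).
have s2 := step (- h) (etrans (normrN _) (ger0_norm (ltW h0))).
rewrite -/E; apply: (@le_trans _ _ (E * (1 + b * (2 * h * x ord0 i + h ^+ 2) + 2 * (b * (2 * h * x ord0 i + h ^+ 2)) ^+ 2)
  + E * (1 + b * (2 * - h * x ord0 i + h ^+ 2) + 2 * (b * (2 * - h * x ord0 i + h ^+ 2)) ^+ 2) - 2 * E)).
  by rewrite lerD2r lerD.
have -> : E * (1 + b * (2 * h * x ord0 i + h ^+ 2) + 2 * (b * (2 * h * x ord0 i + h ^+ 2)) ^+ 2)
  + E * (1 + b * (2 * - h * x ord0 i + h ^+ 2) + 2 * (b * (2 * - h * x ord0 i + h ^+ 2)) ^+ 2) - 2 * E =
  E * h ^+ 2 * (2 * b + 16 * b ^+ 2 * x ord0 i ^+ 2 + 4 * b ^+ 2 * h ^+ 2) by ring.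
have hh : h ^+ 2 <= h by rewrite expr2 ler_piMr// ltW.
have := mulr_ge0 (sqr_ge0 b) (mulr_ge0 (ltW E0) (sqr_ge0 h)).
nra.
Qed.

Lemma le_of_le_small (L Q C h0 : R) : 0 < h0 ->
  (forall h, 0 < h -> h <= h0 -> L <= Q + C * h) -> L <= Q.
Proof.
move=> h0p H; apply/ler_addgt0Pr => e e0.
have c1 : 0 < `|C| + 1 by rewrite ltr_wpDl.
pose h := Num.min h0 (e / (`|C| + 1)).
have hp : 0 < h by rewrite lt_min h0p divr_gt0.
have hh : h <= h0 by rewrite ge_min lexx.
rewrite (le_trans (H h hp hh))// lerD2l.
rewrite (le_trans (ler_norm _))// normrM (gtr0_norm hp).
rewrite (@le_trans _ _ ((`|C| + 1) * h))//; first by rewrite ler_wpM2r ?(ltW hp)// lerDl.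
by rewrite mulrC -ler_pdivlMr// ge_min lexx orbT.
Qed.

Lemma avgN m dl w x : (0 < m)%N -> 0 <= dl -> dl <= 1 ->
  measurable_fun setT w -> locally_bounded w ->
  avg m dl (fun y => - w y) x = - avg m dl w x.
Proof.
move=> m0 d0 d1 mw lw; have [M wM] := lw (sqn x + 1 + 1).
have iw := @integrable_avg R d w _ M m dl x m0 d0 d1 mw (cube_sqn x) wM.
rewrite -[RHS]mulN1r -(RintegralZl (-1) measurableT iw).
by apply: eq_Rintegral => y _; rewrite mulN1r mulNr.
Qed.

End barrier.

(** * Evolutions tested against bumps *)

Section evolution.
Context {R : realType} {d : nat}.
Implicit Types (x y : 'rV[R]_d) (v g : R -> 'rV[R]_d -> R).
Let mu := lebesgue_rv R d.

(** The average of (1/2) Laplacian(w) + k, with the Laplacian moved to the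
    bump. *)
Definition drift m (dl : R) (w k : 'rV[R]_d -> R) x : R :=
  2^-1 * lapavg m dl w x + avg m dl k x.

(** A weak form of dv/dt <= (1/2) Laplacian(v) + g.  An upper bound of the drift
    over an interval of time bounds the increment of the average: in this form
    no measurability in time is needed, and the property passes to the limit
    in the centre x of the bump. *)
Definition subevolution v g (a b : R) : Prop :=
  forall m n x s t M, (2 < m)%N -> a <= s -> s <= t -> t <= b ->
    (forall r, s <= r -> r <= t -> drift m (radius n) (v r) (g r) x <= M) ->
    avg m (radius n) (v t) x - avg m (radius n) (v s) x <= M * (t - s).

(** Both v and - v satisfy the weak inequality, so that v is a weak solution;
    the force g is controlled by v with a quadratically growing factor. *)
Record evolution (K c : R) v g (a b : R) : Prop := Evolution {
  ev_measurable : forall t, a <= t -> t <= b -> measurable_fun setT (v t);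
  ev_measurable_force : forall t, a <= t -> t <= b -> measurable_fun setT (g t);
  ev_growth : forall t y, a <= t -> t <= b -> `|v t y| <= K * expR (2^-1 * sqn y);
  ev_force : forall t y, a <= t -> t <= b -> `|g t y| <= c * (1 + sqn y) * `|v t y|;
  ev_sub : subevolution v g a b;
  ev_super : subevolution (fun t y => - v t y) (fun t y => - g t y) a b }.

Lemma evolutionN K c v g a b : evolution K c v g a b ->
  evolution K c (fun t y => - v t y) (fun t y => - g t y) a b.
Proof.
case=> mv mg vK gv s1 s2; split => //.
- by move=> t a1 b1; apply: measurableT_comp => //; exact: mv.
- by move=> t a1 b1; apply: measurableT_comp => //; exact: mg.
- by move=> t y a1 b1; rewrite normrN vK.
- by move=> t y a1 b1; rewrite !normrN gv.
- rewrite (_ : (fun t y => - - v t y) = v); last by apply/funext => t; apply/funext => y; rewrite opprK.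
  by rewrite (_ : (fun t y => - - g t y) = g)//; apply/funext => t; apply/funext => y; rewrite opprK.
Qed.

Lemma evolutionS K c v g a b a' b' : a <= a' -> b' <= b ->
  evolution K c v g a b -> evolution K c v g a' b'.
Proof.
move=> aa bb [mv mg vK gv s1 s2]; split.
- by move=> t h1 h2; apply: mv; [exact: le_trans h1|exact: le_trans bb].
- by move=> t h1 h2; apply: mg; [exact: le_trans h1|exact: le_trans bb].
- by move=> t y h1 h2; apply: vK; [exact: le_trans h1|exact: le_trans bb].
- by move=> t y h1 h2; apply: gv; [exact: le_trans h1|exact: le_trans bb].
- by move=> m n x s t M m2 h1 h2 h3; apply: s1 => //; [exact: le_trans h1|exact: le_trans bb].
- by move=> m n x s t M m2 h1 h2 h3; apply: s2 => //; [exact: le_trans h1|exact: le_trans bb].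
Qed.

Section bounds.
Variables (K c : R) (v g : R -> 'rV[R]_d -> R) (a b : R).
Hypotheses (K0 : 0 <= K) (c0 : 0 <= c).
Hypothesis ev : evolution K c v g a b.

Lemma sqn_cube r y : cube r y -> sqn y <= d%:R * r ^+ 2.
Proof.
move=> cy; rewrite sqnE (@le_trans _ _ (\sum_(i < d) r ^+ 2))//; last first.
  by rewrite sumr_const card_ord -[leLHS]mulr_natl.
apply: ler_sum => i _; rewrite -real_normK ?num_real// lerXn2r ?nnegrE//.
exact: le_trans (cy i).
Qed.

Definition vbound (r : R) : R := K * expR (2^-1 * (d%:R * r ^+ 2)).
Definition gbound (r : R) : R := c * (1 + d%:R * r ^+ 2) * vbound r.

Lemma vboundP r t y : a <= t -> t <= b -> cube r y -> `|v t y| <= vbound r.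
Proof.
move=> h1 h2 cy; rewrite (le_trans (ev_growth _ _ _ _ _ _ ev t y h1 h2))//.
by rewrite ler_wpM2l// ler_expR ler_wpM2l// sqn_cube.
Qed.

Lemma gboundP r t y : a <= t -> t <= b -> cube r y -> `|g t y| <= gbound r.
Proof.
move=> h1 h2 cy; rewrite (le_trans (ev_force _ _ _ _ _ _ ev t y h1 h2))//.
rewrite ler_pM// ?vboundP// ?mulr_ge0 ?addr_ge0 ?sqn_ge0//.
by rewrite ler_wpM2l// lerD2l sqn_cube.
Qed.

Lemma locally_bounded_v t : a <= t -> t <= b -> locally_bounded (v t).
Proof. by move=> h1 h2 r; exists (vbound r) => y; exact: vboundP. Qed.

Lemma locally_bounded_g t : a <= t -> t <= b -> locally_bounded (g t).
Proof. by move=> h1 h2 r; exists (gbound r) => y; exact: gboundP. Qed.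

Definition lipt m r : R := 2^-1 *
   (4 * m%:R * m.-1%:R * (2 * (vbound (r + 1) * vol (d := d) (r + 1)))
    + 2 * m%:R * d%:R * (vbound (r + 1) * vol (d := d) (r + 1)))
   + gbound (r + 1) * vol (d := d) (r + 1).

Lemma drift_bound m n r x t : (2 < m)%N -> cube r x -> a <= t -> t <= b ->
  `|drift m (radius n) (v t) (g t) x| <= lipt m r.
Proof.
move=> m2 cx h1 h2; have [r0 r1] := (ltW (radius_gt0 (R := R) n), radius_le1 (R := R) n).
have A k : (0 < k)%N -> `|avg k (radius n) (v t) x| <= vbound (r + 1) * vol (d := d) (r + 1).
  move=> k0; apply: (avg_bound k0 r0 r1 (ev_measurable _ _ _ _ _ _ ev t h1 h2) cx).
  by move=> y; exact: vboundP.
rewrite /drift /lipt (le_trans (ler_normD _ _))// lerD//; last first.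
  apply: (avg_bound _ r0 r1 (ev_measurable_force _ _ _ _ _ _ ev t h1 h2) cx).
    exact: ltn_trans m2.
  by move=> y; exact: gboundP.
rewrite normrM ger0_norm// ler_wpM2l// /lapavg (le_trans (ler_normB _ _))// lerD//.
  rewrite normrM ger0_norm ?mulr_ge0// ler_wpM2l ?mulr_ge0// (le_trans (ler_normB _ _))//.
  rewrite mulrDl mul1r lerD//; last by apply: A; case: m m2 => [|[|]].
  rewrite normrM ger0_norm ?sqr_ge0// -[leRHS]mul1r ler_pM//; first exact: sqr_ge0.
    by rewrite exprn_ile1.
  by apply: A; case: m m2 => [|[|[|]]].
rewrite normrM ger0_norm ?mulr_ge0// ler_wpM2l ?mulr_ge0//.
by apply: A; case: m m2 => [|[|]].
Qed.

(** The drift is locally bounded, because the Laplacian acts on the bump. *)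
Lemma avg_lip_time m n r x s t : (2 < m)%N -> cube r x -> a <= s -> s <= t -> t <= b ->
  `|avg m (radius n) (v t) x - avg m (radius n) (v s) x| <= lipt m r * (t - s).
Proof.
move=> m2 cx h1 h2 h3; rewrite ler_norml; apply/andP; split; last first.
  apply: (ev_sub _ _ _ _ _ _ ev) => // q q1 q2.
  by rewrite (le_trans (ler_norm _))//; apply: drift_bound => //; [exact: le_trans q1|exact: le_trans h3].
have m0 : (0 < m)%N by exact: ltn_trans m2.
have [r0 r1] := (ltW (radius_gt0 (R := R) n), radius_le1 (R := R) n).
have N t' : a <= t' -> t' <= b -> forall m', (0 < m')%N ->
    avg m' (radius n) (fun y => - v t' y) x = - avg m' (radius n) (v t') x.
  move=> q1 q2 m' m'0; apply: avgN => //; first exact: (ev_measurable _ _ _ _ _ _ ev).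
  exact: locally_bounded_v.
rewrite lerNl opprB.
have -> : avg m (radius n) (v s) x - avg m (radius n) (v t) x =
  avg m (radius n) (fun y => - v t y) x - avg m (radius n) (fun y => - v s y) x.
  by rewrite !N//; [ring|exact: le_trans h3|exact: le_trans h2].
apply: (ev_super _ _ _ _ _ _ ev) => // q q1 q2.
have h : a <= q /\ q <= b by split; [exact: le_trans q1|exact: le_trans h3].
have -> : drift m (radius n) (fun y => - v q y) (fun y => - g q y) x =
   - drift m (radius n) (v q) (g q) x.
  rewrite /drift /lapavg !N ?h.1 ?h.2//; [|by case: m m2 {m0} => [|[|[|]]]|by case: m m2 {m0} => [|[|]]].
  rewrite (avgN _ _ (g q))//; [ring|exact: (ev_measurable_force _ _ _ _ _ _ ev _ h.1 h.2)|].
  by apply: locally_bounded_g; case: h.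
rewrite (le_trans (ler_norm _))// normrN.
by apply: drift_bound => //; case: h.
Qed.

End bounds.
End evolution.

(** * Comparison with a Gaussian barrier *)

Section maximum_principle.
Context {R : realType} {d : nat}.
Implicit Types (x y : 'rV[R]_d) (K c N s t dl : R) (v g : R -> 'rV[R]_d -> R).
Let mu := lebesgue_rv R d.

(** The rate kappa of growth of the exponent.  It has to exceed 4 c, from the
    force, plus 4 d + 128, which comes from half of the bound [barrier_second]
    with an exponent b at most 4. *)
Definition rate c : R := 4 * c + 4 * d%:R + 129.

Definition slope c t0 t : R := 1 + rate c * (t - t0).

Definition expo c t0 dl t : R := (1 + 2 * dl) * slope c t0 t.

(** Compared with (N / 2) psi, the exponent has an extra factor 1 + 2 dl that
    makes up for averaging over a ball of radius dl; the mass of the bump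
    appears as the averages are not normalized. *)
Definition barrier c t0 N dl t x : R :=
  N / 2 * @mass R d dl * expR (expo c t0 dl t * (1 + sqn x)).

(** The interval is so short that the exponent stays between 1 and 2. *)
Record comparison K c N t0 t1 v g : Prop := Comparison {
  cmp_K : 0 <= K;
  cmp_c : 0 < c;
  cmp_N : 0 < N;
  cmp_ev : evolution K c v g t0 t1;
  cmp_short : rate c * (t1 - t0) <= 1;
  cmp_init : {ae mu, forall y, v t0 y = 0};
  cmp_apriori : forall t, t0 <= t -> t <= t1 ->
    {ae mu, forall y, `|v t y| <= N * expR (slope c t0 t * (1 + sqn y))} }.

Lemma rate_gt0 c : 0 < c -> 0 < rate c.
Proof. by move=> c0; have : (0 : R) <= d%:R by []; rewrite /rate; lra. Qed.

Lemma slope_ge1 c t0 t : 0 < c -> t0 <= t -> 1 <= slope c t0 t.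
Proof.
by move=> c0 h; rewrite /slope lerDl mulr_ge0 ?(ltW (rate_gt0 c c0))// subr_ge0.
Qed.

Lemma slope_le2 c t0 t1 t : 0 < c -> rate c * (t1 - t0) <= 1 -> t <= t1 ->
  slope c t0 t <= 2.
Proof.
move=> c0 short h.
have : rate c * (t - t0) <= rate c * (t1 - t0).
  by rewrite ler_wpM2l ?(ltW (rate_gt0 c c0))// lerD2r.
by rewrite /slope; lra.
Qed.

Lemma expoB c t0 dl t s :
  expo c t0 dl t - expo c t0 dl s = (1 + 2 * dl) * rate c * (t - s).
Proof. by rewrite /expo /slope; ring. Qed.

Lemma expo_le c t0 dl s t : 0 < c -> 0 < dl -> s <= t ->
  expo c t0 dl s <= expo c t0 dl t.
Proof.
move=> c0 dl0 st; rewrite -subr_ge0 expoB mulr_ge0 ?subr_ge0//.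
by rewrite mulr_ge0 ?(ltW (rate_gt0 c c0))//; lra.
Qed.

Lemma expo_ge1 c t0 dl t : 0 < c -> 0 < dl -> t0 <= t -> 1 <= expo c t0 dl t.
Proof. by move=> c0 dl0 h; have := slope_ge1 c t0 t c0 h; rewrite /expo; nra. Qed.

Lemma expo_le4 c t0 t1 dl t : 0 < c -> 0 < dl -> dl <= 2^-1 ->
  rate c * (t1 - t0) <= 1 -> t0 <= t -> t <= t1 -> expo c t0 dl t <= 4.
Proof.
move=> c0 dl0 dl2 short h h'; have := slope_ge1 c t0 t c0 h.
by have := slope_le2 c t0 t1 t c0 short h'; rewrite /expo; nra.
Qed.

Lemma coef_gt0 N dl : 0 < N -> 0 < dl -> dl <= 1 -> 0 < N / 2 * @mass R d dl.
Proof. by move=> N0 d0 d1; rewrite mulr_gt0 ?divr_gt0 ?mass_gt0. Qed.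

Lemma barrier_gt0 c t0 N dl t x : 0 < N -> 0 < dl -> dl <= 1 ->
  0 < barrier c t0 N dl t x.
Proof. by move=> N0 d0 d1; rewrite mulr_gt0 ?expR_gt0 ?coef_gt0. Qed.

Lemma barrier_le c t0 N dl s t x : 0 < c -> 0 < N -> 0 < dl -> dl <= 1 -> s <= t ->
  barrier c t0 N dl s x <= barrier c t0 N dl t x.
Proof.
move=> c0 N0 d0 d1 st; rewrite ler_wpM2l ?(ltW (coef_gt0 N dl N0 d0 d1))//.
rewrite ler_expR ler_wpM2r ?expo_le//.
by rewrite addr_ge0 ?sqn_ge0.
Qed.

(** Here the a priori bound of v by N psi is used: on the ball of radius dl the
    factor 1 + |y|^2 at most doubles. *)
Lemma force_le_barrier K c N t0 t1 v g dl t x : comparison K c N t0 t1 v g ->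
  0 < dl -> dl <= 2^-1 -> t0 <= t -> t <= t1 ->
  avg 5 dl (g t) x <= 4 * c * (1 + sqn x) * barrier c t0 N dl t x.
Proof.
move=> [K0 c0 N0 ev short init apriori] dl0 dl2 h1 h2; have s0 := sqn_ge0 x.
have dl1 : dl <= 1 by lra.
pose C := 2 * c * (1 + sqn x) * (N * expR (expo c t0 dl t * (1 + sqn x))).
have -> : 4 * c * (1 + sqn x) * barrier c t0 N dl t x = C * @mass R d dl.
  rewrite /C /barrier; have e : N / 2 * 2 = N by rewrite divfK.
  have -> : 4 * c * (1 + sqn x) * (N / 2 * @mass R d dl * expR (expo c t0 dl t * (1 + sqn x))) =
   2 * c * (1 + sqn x) * ((N / 2 * 2) * expR (expo c t0 dl t * (1 + sqn x))) * @mass R d dl by ring.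
  by rewrite e.
apply: (le_trans (ler_norm _)); apply: avg_ae_bound => //.
- apply: mulr_ge0; first by apply: mulr_ge0; lra.
  by rewrite mulr_ge0 ?expR_ge0 ?(ltW N0).
- exact: (ev_measurable_force _ _ _ _ _ _ ev).
- exact: (locally_bounded_g K c v g t0 t1 K0 (ltW c0) ev).
apply: filterS (apriori t h1 h2) => y hy yx.
rewrite (le_trans (ev_force _ _ _ _ _ _ ev t y h1 h2))//.
have q := sqn_near dl x y dl0 dl1 yx; have y0 := sqn_ge0 y.
apply: ler_pM => //.
- by rewrite mulr_ge0 ?(ltW c0)//; lra.
- have : 1 + sqn y <= 2 * (1 + sqn x) by nra.
  move=> q2; have q3 := ler_wpM2l (ltW c0) q2. lra.
- apply: (le_trans hy); rewrite ler_wpM2l ?(ltW N0)// ler_expR /expo.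
  have := ler_wpM2l (le_trans ler01 (slope_ge1 c t0 t c0 h1)) q; lra.
Qed.

(** The growth rate 1/2 in the exponent of v is less than that of the
    barrier, which is at least 1. *)
Lemma barrier_dominates K c N t0 t1 v g dl : comparison K c N t0 t1 v g ->
  0 < dl -> dl <= 2^-1 -> exists rho : R, forall t x, t0 <= t -> t <= t1 ->
  rho <= sqn x -> avg 5 dl (v t) x < barrier c t0 N dl t x.
Proof.
move=> [K0 c0 N0 ev short init apriori] dl0 dl2; have dl1 : dl <= 1 by lra.
(* from this point on exp(X / 2) > 2 K / N, with X as below *)
exists (4 * K / N) => t x h1 h2 rx; have s0 := sqn_ge0 x.
pose X := (1 + 2 * dl) * (1 + sqn x).
have m0 := mass_gt0 (d := d) dl dl0 dl1.
have A : avg 5 dl (v t) x <= K * expR (2^-1 * X) * @mass R d dl.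
  apply: (le_trans (ler_norm _)); apply: avg_ae_bound => //.
  - by rewrite mulr_ge0 ?expR_ge0.
  - exact: (ev_measurable _ _ _ _ _ _ ev).
  - exact: (locally_bounded_v K c v g t0 t1 K0 ev).
  apply: aeW => y yx; have q := sqn_near dl x y dl0 dl1 yx.
  rewrite (le_trans (ev_growth _ _ _ _ _ _ ev t y h1 h2))// ler_wpM2l// ler_expR.
  by rewrite ler_wpM2l// /X; lra.
apply: (le_lt_trans A).
have eX : expR X = expR (2^-1 * X) * expR (2^-1 * X) by rewrite -expRD; congr expR; lra.
apply: (@lt_le_trans _ _ (N / 2 * @mass R d dl * expR X)); last first.
  rewrite ler_wpM2l ?(ltW (coef_gt0 N dl N0 dl0 dl1))// ler_expR /X /expo.
  rewrite [leRHS]mulrAC ler_peMr ?slope_ge1//.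
  by rewrite mulr_ge0; lra.
rewrite eX; have e0 := expR_gt0 (2^-1 * X); have e1 := expR_ge1Dx (2^-1 * X).
have X1 : 1 + sqn x <= X by rewrite /X; nra.
have : 2 * K / N < expR (2^-1 * X).
  have : 4 * K / N = 2 * (2 * K / N) by ring.
  lra.
rewrite ltr_pdivrMr// => h.
have -> : N / 2 * @mass R d dl * (expR (2^-1 * X) * expR (2^-1 * X)) =
   (expR (2^-1 * X) * N) / 2 * (expR (2^-1 * X) * @mass R d dl) by ring.
rewrite -mulrA ltr_pM2r ?mulr_gt0//; lra.
Qed.

End maximum_principle.

Section weak_maximum_principle.
Context {R : realType} {d : nat}.
Implicit Types (x y : 'rV[R]_d) (K c N s t dl : R) (v g : R -> 'rV[R]_d -> R).
Let mu := lebesgue_rv R d.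
Local Notation rate := (@rate R d).
Local Notation slope := (@slope R d).
Local Notation expo := (@expo R d).

Lemma continuous_barrier c t0 N dl :
  continuous (fun p : R * 'rV[R]_d => barrier c t0 N dl p.1 p.2).
Proof.
have c1 : continuous (fun p : R * 'rV[R]_d => p.1) by move=> p; exact: cvg_fst.
have c2 : continuous (fun p : R * 'rV[R]_d => sqn p.2).
  by move=> p; apply: (continuous_comp (f := snd)); [exact: cvg_snd|exact: continuous_sqn].
have ce : continuous (fun p : R * 'rV[R]_d => expo c t0 dl p.1 * (1 + sqn p.2)).
  rewrite /expo /slope.
  apply: continuous_mulf.
    apply: continuous_mulf; first exact: continuous_cstf.
    apply: continuous_addf; first exact: continuous_cstf.
    apply: continuous_mulf; first exact: continuous_cstf.
    by apply: continuous_subf => //; exact: continuous_cstf.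
  by apply: continuous_addf => //; exact: continuous_cstf.
apply: continuous_mulf; first exact: continuous_cstf.
by move=> p; apply: (continuous_comp (ce p)); exact: continuous_expR.
Qed.

Lemma continuous_gap K c N t0 t1 v g n (r : R) : 0 <= r -> comparison K c N t0 t1 v g ->
  {within `[t0, t1] `*` cube r, continuous (fun p : R * 'rV[R]_d =>
     avg 5 (radius n) (v p.1) p.2 - barrier c t0 N (radius n) p.1 p.2)}.
Proof.
move=> r0 [K0 c0 N0 ev short init apriori].
have [dl0 dl1] := (ltW (radius_gt0 (R := R) n), radius_le1 (R := R) n).
apply/subspace_continuousP => -[s x] [/= + cx]; rewrite in_itv/= => /andP[s0 s1].
apply/cvgrPdist_le => e e0.
pose A := lipt (d := d) K c 5 r.
pose C := vbound (d := d) K (r + 1) * (5 * (d%:R * (4 * r + 2))) * vol (d := d) (r + 1).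
pose et := e / 2 / (`|A| + `|C| + 1).
have ac : 0 < `|A| + `|C| + 1 by rewrite ltr_wpDl// addr_ge0.
have et0 : 0 < et by rewrite !divr_gt0.
have /cvgrPdist_le/(_ (e / 2)) := continuous_barrier c t0 N (radius n) (s, x).
rewrite divr_gt0// => /(_ isT) hB.
rewrite near_withinE; near=> q => -[/=]; rewrite in_itv/= => /andP[q0 q1] cq.
have sq : `|s - q.1| <= et /\ forall i, `|x ord0 i - q.2 ord0 i| <= et.
  have : ball ((s, x) : R * 'rV[R]_d) et q by near: q; exact: nbhsx_ballx.
  by move=> [/= b1 [_ b2]]; split; [exact: ltW|move=> i; exact/ltW/b2].
have [sq1 sq2] := sq.
have h1 : `|avg 5 (radius n) (v s) x - avg 5 (radius n) (v q.1) x| <= A * et.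
  have A0 : 0 <= A.
    by have := drift_bound K c v g t0 t1 K0 (ltW c0) ev 5 n r x s isT cx s0 s1; exact: le_trans.
  have [sq'|sq'] := leP s q.1.
    rewrite distrC (le_trans (avg_lip_time K c v g t0 t1 K0 (ltW c0) ev 5 n r x s q.1 isT cx s0 sq' q1))//.
    by rewrite ler_wpM2l// (le_trans _ sq1)// distrC ler_norm.
  rewrite (le_trans (avg_lip_time K c v g t0 t1 K0 (ltW c0) ev 5 n r x q.1 s isT cx q0 (ltW sq') s1))//.
  by rewrite ler_wpM2l// (le_trans _ sq1)// ler_norm.
have h2 : `|avg 5 (radius n) (v q.1) x - avg 5 (radius n) (v q.1) q.2| <= C * et.
  have -> : C * et = vbound (d := d) K (r + 1) * (5%:R * (d%:R * (et * (4 * r + 2)))) * vol (d := d) (r + 1).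
    by rewrite /C; ring.
  apply: (avg_lip (m := 5) isT dl0 dl1 (ev_measurable _ _ _ _ _ _ ev _ q0 q1) cx cq) => //.
  by move=> y; exact: (vboundP K c v g t0 t1 K0 ev).
have h3 : `|barrier c t0 N (radius n) s x - barrier c t0 N (radius n) q.1 q.2| <= e / 2.
  by near: q; exact: hB.
have h4 : A * et + C * et <= e / 2.
  rewrite -mulrDl /et mulrCA ler_piMr ?divr_ge0 ?(ltW e0)//.
  rewrite ler_pdivrMr// mul1r (le_trans (lerD (ler_norm A) (ler_norm C)))//.
  by rewrite lerDl.
have id3 (a a' b p p' : R) : a - p - (b - p') = (a - a') + (a' - b) - (p - p') by ring.
rewrite (id3 _ (avg 5 (radius n) (v q.1) x)) (le_trans (ler_normB _ _))//.
rewrite (le_trans (lerD (ler_normD _ _) (lexx _)))//.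
apply: (le_trans (lerD (lerD h1 h2) h3)).
by rewrite [leRHS](splitr e) lerD2r.
Unshelve. all: by end_near. Qed.

(** At a maximum of the average minus the barrier all second differences of this
    function are nonpositive;
    divide their sum by h^2 and let h tend to 0. *)
Lemma lapavg_at_max (w : 'rV[R]_d -> R) (beta b dl : R) x : 0 < dl -> dl <= 1 ->
  0 <= beta -> 0 <= b -> measurable_fun setT w -> locally_bounded w ->
  (forall y, avg 5 dl w y - beta * expR (b * (1 + sqn y)) <=
     avg 5 dl w x - beta * expR (b * (1 + sqn x))) ->
  lapavg 5 dl w x <= beta * expR (b * (1 + sqn x)) *
    (2 * b * d%:R + 16 * b ^+ 2 * sqn x).
Proof.
move=> dl0 dl1 be0 b0 mw lw hmax; have [M wM] := lw (sqn x + 1 + 2).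
have [C hC] := avg_second (ltW dl0) dl1 mw (cube_sqn x) wM.
have b1 : 0 <= b * (2 * (sqn x + 1) + 1).
  by rewrite mulr_ge0//; have := sqn_ge0 x; lra.
(* for h <= 1 / D the increments of the exponent are at most 1/2 *)
pose D := 2 * (b * (2 * (sqn x + 1) + 1) + 1).
have D0 : 0 < D by rewrite /D; lra.
set E := expR (b * (1 + sqn x)).
apply: (@le_of_le_small _ _ _ (C + beta * E * (4 * b ^+ 2 * d%:R)) (Num.min 1 D^-1)).
  by rewrite lt_min ltr01 invr_gt0.
move=> h h0; rewrite le_min => /andP[h1 hD].
have hb : h * (b * (2 * (sqn x + 1) + 1)) <= 2^-1.
  have : h * D <= 1 by rewrite -ler_pdivlMr// div1r.
  by rewrite /D; lra.
have A := hC h (ltW h0) h1.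
have B := barrier_second b h x b0 h0 hb h1.
have S : \sum_(i < d) (avg 5 dl w (x + h *: delta_mx ord0 i) +
       avg 5 dl w (x - h *: delta_mx ord0 i) - 2 * avg 5 dl w x) <=
   beta * \sum_(i < d) (expR (b * (1 + sqn (x + h *: delta_mx ord0 i))) +
    expR (b * (1 + sqn (x - h *: delta_mx ord0 i))) - 2 * expR (b * (1 + sqn x))).
  rewrite mulr_sumr; apply: ler_sum => i _.
  have := hmax (x + h *: delta_mx ord0 i); have := hmax (x - h *: delta_mx ord0 i).
  move: (avg 5 dl w _) (avg 5 dl w _) (avg 5 dl w x) (expR _) (expR _) => a1 a2 a3 e1 e2.
  rewrite -/E; lra.
have h2 : 0 < h ^+ 2 by rewrite exprn_gt0.
rewrite -(ler_pM2l h2).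
move: A; rewrite ler_norml => /andP[A _].
have {}A : h ^+ 2 * lapavg 5 dl w x <= C * h ^+ 3 + \sum_(i < d) (avg 5 dl w (x + h *: delta_mx ord0 i) +
       avg 5 dl w (x - h *: delta_mx ord0 i) - 2 * avg 5 dl w x).
  by rewrite -lerBlDr; move: A; rewrite lerNl opprB.
apply: (le_trans A); rewrite addrC.
apply: (@le_trans _ _ (beta * (E * h ^+ 2 * (2 * b * d%:R + 16 * b ^+ 2 * sqn x
    + 4 * b ^+ 2 * d%:R * h)) + C * h ^+ 3)).
  by rewrite lerD2r; apply: (le_trans S); rewrite ler_wpM2l.
by rewrite le_eqVlt; apply/orP; left; apply/eqP; ring.
Qed.

(** If the average exceeded the barrier somewhere, their difference would have a
    positive maximum, by [barrier_dominates] and compactness, at a time s > t0.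
    There the drift of v is less than the time derivative of the barrier, which
    contradicts the fact that the average minus the barrier was not larger just
    before s.  As the averages are only known to satisfy integrated
    inequalities, the contradiction is reached with difference quotients over
    [s - h, s]. *)
Lemma avg_le_barrier K c N t0 t1 v g n t x : comparison K c N t0 t1 v g ->
  t0 <= t -> t <= t1 ->
  avg 5 (radius n) (v t) x <= barrier c t0 N (radius n) t x.
Proof.
move=> cmp ht0 ht1; rewrite leNgt; apply/negP => bad.
set dl : R := radius n in bad *.
have dl0 : 0 < dl by exact: radius_gt0.
have dl2 : dl <= 2^-1 by exact: radius_le.
have dl1 : dl <= 1 by exact: radius_le1.
have [rho hrho] := barrier_dominates K c N t0 t1 v g dl cmp dl0 dl2.
have [K0 c0 N0 ev short init apriori] := cmp.
pose r := `|rho| + 1.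
pose z (p : R * 'rV[R]_d) := avg 5 dl (v p.1) p.2 - barrier c t0 N dl p.1 p.2.
have cubez p : t0 <= p.1 -> p.1 <= t1 -> 0 < z p -> cube r p.2.
  move=> p1 p2 zp; have h : sqn p.2 < rho.
    rewrite ltNge; apply/negP => h; have := hrho _ _ p1 p2 h.
    by move: zp; rewrite /z subr_gt0 => zp /lt_trans /(_ zp); rewrite ltxx.
  by apply: cubeS (cube_sqn p.2); rewrite /r lerD2r (le_trans (ltW h))// ler_norm.
have zx : 0 < z (t, x) by rewrite subr_gt0.
have Atx : (`[t0, t1]%classic `*` cube r) (t, x).
  by split => /=; [rewrite in_itv/= ht0 ht1|exact: (cubez (t, x) ht0 ht1 zx)].
have [|||[s w]] := @compact_EVT_max _ R z (`[t0, t1]%classic `*` cube r).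
- by exists (t, x).
- by apply: compact_setX; [exact: segment_compact|exact: compact_cube].
- by apply: continuous_gap cmp; rewrite addr_ge0.
rewrite inE => -[/=]; rewrite in_itv/= => /andP[s0 s1] cw zmax.
have zsw : 0 < z (s, w) by apply: (lt_le_trans zx); apply: zmax; rewrite inE.
have zmax' s' w' : t0 <= s' -> s' <= t1 -> z (s', w') <= z (s, w).
  move=> h1 h2; have [h3|h3] := leP (z (s', w')) 0; first exact: le_trans (ltW zsw).
  apply: zmax; rewrite inE; split => /=; first by rewrite in_itv/= h1 h2.
  exact: (cubez (s', w') h1 h2 h3).
(* the maximum is not attained at the initial time *)
have ts : t0 < s.
  rewrite lt_neqAle s0 andbT; apply/eqP => st; move: zsw; rewrite /z /= -st.
  have -> : avg 5 dl (v t0) w = 0.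
    apply/eqP; rewrite -normr_le0 -(mul0r (@mass R d dl)).
    have t01 := le_trans s0 s1.
    apply: avg_ae_bound => //.
    - exact: (ev_measurable _ _ _ _ _ _ ev).
    - exact: (locally_bounded_v K c v g t0 t1 K0 ev).
    - by apply: filterS init => y ->; rewrite normr0.
  by rewrite sub0r oppr_gt0 ltNge ltW// barrier_gt0.
pose X := 1 + sqn w; pose Bs := barrier c t0 N dl s w.
have X1 : 1 <= X by rewrite /X lerDl sqn_ge0.
have B0 : 0 < Bs by exact: barrier_gt0.
have lap : lapavg 5 dl (v s) w <= Bs * (2 * expo c t0 dl s * d%:R + 16 * expo c t0 dl s ^+ 2 * sqn w).
  apply: lapavg_at_max => //.
  - exact: ltW (coef_gt0 N dl N0 dl0 dl1).
  - by apply: le_trans (expo_ge1 c t0 dl s c0 dl0 s0).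
  - exact: (ev_measurable _ _ _ _ _ _ ev).
  - exact: (locally_bounded_v K c v g t0 t1 K0 ev).
  - by move=> y; exact: (zmax' s y s0 s1).
have e4 := expo_le4 c t0 t1 dl s c0 dl0 dl2 short s0 s1.
have e1 := expo_ge1 (d := d) c t0 dl s c0 dl0 s0.
have q0 := sqn_ge0 w.
have lap2 : 2^-1 * lapavg 5 dl (v s) w <= X * Bs * (4 * d%:R + 128).
  rewrite (le_trans (ler_wpM2l _ lap))//.
  have : 2 * expo c t0 dl s * d%:R + 16 * expo c t0 dl s ^+ 2 * sqn w <= 2 * (X * (4 * d%:R + 128)).
    move: e1 e4; move: (expo c t0 dl s) => E E1 E4.
    have D0 : (0 : R) <= d%:R by [].
    have h1 : E * d%:R <= 4 * d%:R by rewrite ler_wpM2r.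
    have E0 : 0 <= E by exact: le_trans ler01 E1.
    have h2 : E ^+ 2 <= 4 * 4 by rewrite expr2 ler_pM.
    have h3 : E ^+ 2 * sqn w <= 4 * 4 * sqn w by rewrite ler_wpM2r.
    have h4 : 0 <= d%:R * sqn w by rewrite mulr_ge0.
    rewrite /X; lra.
  move=> /(ler_wpM2l (ltW B0)) h; apply: (le_trans (ler_wpM2l _ h)) => //.
  by rewrite le_eqVlt; apply/orP; left; apply/eqP; field.
(* a Lipschitz constant in time of half the averaged Laplacian *)
pose A' := 40 * dl ^+ 2 * lipt (d := d) K c 3 (sqn w + 1) + (40 + 5 * d%:R) * lipt (d := d) K c 4 (sqn w + 1).
have lapLip q : t0 <= q -> q <= s ->
    2^-1 * lapavg 5 dl (v q) w <= 2^-1 * lapavg 5 dl (v s) w + A' * (s - q).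
  move=> h1 h2.
  have := avg_lip_time K c v g t0 t1 K0 (ltW c0) ev 3 n _ w q s isT (cube_sqn w) h1 h2 s1.
  have := avg_lip_time K c v g t0 t1 K0 (ltW c0) ev 4 n _ w q s isT (cube_sqn w) h1 h2 s1.
  rewrite -/dl !ler_norml => /andP[_ l4] /andP[l3 _]; rewrite !lapavg5E /A'.
  have c3 : 0 <= 40 * dl ^+ 2 by rewrite mulr_ge0 ?sqr_ge0.
  have c4 : 0 <= 40 + 5 * d%:R :> R by rewrite addr_ge0 ?mulr_ge0.
  have m3 := ler_wpM2l c3 l3; have m4 := ler_wpM2l c4 l4.
  move: m3 m4; move: (avg 3 dl (v s) w) (avg 3 dl (v q) w) (avg 4 dl (v s) w) (avg 4 dl (v q) w).
  move: (lipt _ _ _ _) (lipt _ _ _ _) (dl ^+ 2) => l3' l4' D a1 a2 a3 a4 m3 m4.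
  lra.
have rc := rate_gt0 (d := d) c c0.
(* the time derivative of the barrier is rate c * X * Bs, too fast for the drift *)
suff : rate c * X * Bs <= 2^-1 * lapavg 5 dl (v s) w + 4 * c * X * Bs.
  have XB : 0 < X * Bs by rewrite mulr_gt0//; lra.
  move: lap2; move: (2^-1 * _) => l; rewrite /rate.
  have -> : (4 * c + 4 * d%:R + 129) * X * Bs = 4 * c * X * Bs + X * Bs * (4 * d%:R + 128) + X * Bs by ring.
  move: (X * Bs * _) XB => P; move: (X * Bs) (4 * c * X * Bs) => Q S; lra.
apply: (@le_of_le_small _ _ _ (A' + 2 * (rate c * X) ^+ 2 * Bs) (s - t0)); first by rewrite subr_gt0.
move=> h h0 hs; pose q := s - h.
have q1 : t0 <= q by rewrite /q; lra.
have q2 : q <= s by rewrite /q; lra.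
have hq : s - q = h by rewrite /q; lra.
pose Bq := barrier c t0 N dl q w.
have coef := coef_gt0 (d := d) N dl N0 dl0 dl1.
have eB : (expo c t0 dl s - expo c t0 dl q) = (1 + 2 * dl) * rate c * h by rewrite expoB hq.
have X0 : 0 <= X by lra.
have lowB : rate c * X * h * Bq <= Bs - Bq.
  have := expR_convex (expo c t0 dl s * X) (expo c t0 dl q * X).
  rewrite -mulrBl eB => /(ler_wpM2l (ltW coef)).
  rewrite mulrBr -/(barrier c t0 N dl s w) -/(barrier c t0 N dl q w) -/Bs -/Bq => H.
  apply: le_trans H.
  have -> : N / 2 * @mass R d dl * ((1 + 2 * dl) * rate c * h * X * expR (expo c t0 dl q * X)) =
     (1 + 2 * dl) * (rate c * X * h * Bq) by rewrite /Bq /barrier -/X; ring.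
  rewrite ler_peMl//; last lra.
  have Bq0 : 0 < Bq by exact: barrier_gt0.
  by rewrite mulr_ge0 ?(ltW Bq0)// mulr_ge0 ?(ltW h0)// mulr_ge0 ?(ltW rc).
have upB : Bs - 2 * rate c * h * X * Bs <= Bq.
  have := expR_convex (expo c t0 dl q * X) (expo c t0 dl s * X).
  rewrite -mulrBl -opprB eB => /(ler_wpM2l (ltW coef)).
  rewrite mulrBr -/(barrier c t0 N dl s w) -/(barrier c t0 N dl q w) -/Bs -/Bq => H.
  rewrite -lerBrDl; apply: le_trans H.
  have -> : N / 2 * @mass R d dl * (- ((1 + 2 * dl) * rate c * h) * X * expR (expo c t0 dl s * X)) =
     - ((1 + 2 * dl) * (rate c * h * X * Bs)) by rewrite /Bs /barrier -/X; ring.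
  have -> : 2 * rate c * h * X * Bs = 2 * (rate c * h * X * Bs) by ring.
  rewrite lerN2 ler_wpM2r//; last lra.
  by rewrite mulr_ge0 ?(ltW B0)// mulr_ge0// mulr_ge0 ?(ltW rc) ?(ltW h0).
have incr : Bs - Bq <= (2^-1 * lapavg 5 dl (v s) w + A' * h + 4 * c * X * Bs) * h.
  have : avg 5 dl (v s) w - avg 5 dl (v q) w <= (2^-1 * lapavg 5 dl (v s) w + A' * h + 4 * c * X * Bs) * (s - q).
    apply: (ev_sub _ _ _ _ _ _ ev) => // q' h1 h2.
    have h3 : t0 <= q' by exact: le_trans h1.
    have h4 : q' <= t1 by exact: le_trans s1.
    rewrite /drift -/dl lerD//.
      have lg m : (2 < m)%N -> 0 <= lipt (d := d) K c m (sqn w + 1).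
        move=> m2; have := drift_bound K c v g t0 t1 K0 (ltW c0) ev m n _ w s m2 (cube_sqn w) s0 s1.
        exact: le_trans.
      have A'0 : 0 <= A'.
        apply: addr_ge0; apply: mulr_ge0; try exact: lg.
          by rewrite mulr_ge0 ?sqr_ge0.
        by rewrite addr_ge0 ?mulr_ge0.
      by rewrite (le_trans (lapLip q' h3 h2))// lerD2l ler_wpM2l// -hq lerD2l lerN2.
    rewrite (le_trans (force_le_barrier K c N t0 t1 v g dl q' w cmp dl0 dl2 h3 h4))//.
    by rewrite ler_wpM2l ?barrier_le// !mulr_ge0 ?(ltW c0).
  rewrite hq; apply: le_trans.
  have := zmax' q w q1 (le_trans q2 s1); rewrite /z /= -/Bs -/Bq.
  move=> hz; rewrite -subr_ge0; move: hz; rewrite -subr_ge0; congr (0 <= _); ring.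
rewrite -(ler_pM2r h0).
have H1 := ler_wpM2l (mulr_ge0 (mulr_ge0 (ltW rc) X0) (ltW h0)) upB.
have H2 := le_trans H1 (le_trans lowB incr).
move: H2; move: (lapavg _ _ _ _) => l H2.
rewrite -subr_ge0; move: H2; rewrite -subr_ge0; congr (0 <= _); ring.
Qed.

End weak_maximum_principle.

(** * Uniqueness for tested evolutions *)

Section uniqueness.
Context {R : realType} {d : nat}.
Implicit Types (x y : 'rV[R]_d) (K c N s t dl : R) (v g : R -> 'rV[R]_d -> R).
Let mu := lebesgue_rv R d.
Local Notation rate := (@rate R d).
Local Notation slope := (@slope R d).
Local Notation expo := (@expo R d).

Lemma comparisonN K c N t0 t1 v g : comparison K c N t0 t1 v g ->
  comparison K c N t0 t1 (fun t y => - v t y) (fun t y => - g t y).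
Proof.
move=> [K0 c0 N0 ev short init apriori]; split => //; first exact: evolutionN.
- by apply: filterS init => y ->; rewrite oppr0.
- by move=> t h1 h2; apply: filterS (apriori t h1 h2) => y; rewrite normrN.
Qed.

(** As the radius of the bump tends to 0, the extra factor 1 + 2 dl in the
    exponent of the barrier tends to 1, locally uniformly. *)
Lemma ae_le_half K c N t0 t1 v g t : comparison K c N t0 t1 v g ->
  t0 <= t -> t <= t1 ->
  {ae mu, forall y, v t y <= N / 2 * expR (slope c t0 t * (1 + sqn y))}.
Proof.
move=> cmp h1 h2; have [K0 c0 N0 ev short init apriori] := cmp.
have a1 := slope_ge1 (d := d) c t0 t c0 h1.
have a2 := slope_le2 c t0 t1 t c0 short h2.
have N20 : 0 < N / 2 by rewrite divr_gt0.
have Xle r y : cube r y -> slope c t0 t * (1 + sqn y) <= 2 * (1 + d%:R * r ^+ 2).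
  move=> cy; apply: ler_pM => //; first exact: le_trans a1.
    by rewrite addr_ge0 ?sqn_ge0.
  by rewrite lerD2l sqn_cube.
apply: ae_le_of_avg.
- exact: (ev_measurable _ _ _ _ _ _ ev).
- exact: (locally_bounded_v K c v g t0 t1 K0 ev).
- apply: measurable_funM => //; apply: measurableT_comp => //.
  apply: measurable_funM => //; apply: measurable_funD => //; exact: measurable_sqn.
- move=> r; exists (N / 2 * expR (2 * (1 + d%:R * r ^+ 2))) => y cy.
  rewrite ger0_norm; last by rewrite mulr_ge0 ?expR_ge0 ?(ltW N20).
  by rewrite ler_wpM2l ?(ltW N20)// ler_expR Xle.
move=> r e e0; pose X := 2 * (1 + d%:R * r ^+ 2).
have X0 : 0 < X.
  have : 0 <= d%:R * r ^+ 2 by rewrite mulr_ge0 ?sqr_ge0.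
  by rewrite /X; lra.
pose D := N / 2 * expR X * (4 * X).
have D0 : 0 < D.
  by apply: mulr_gt0; apply: mulr_gt0 => //; exact: expR_gt0.
have E1 : 0 < e / D by rewrite divr_gt0.
have E2 : 0 < (4 * X)^-1 by rewrite invr_gt0 mulr_gt0.
near=> n; move=> x cx.
have dl0 : 0 < radius n :> R by exact: radius_gt0.
have d1 : radius n < e / D by near: n; exact: near_radius.
have d2 : radius n < (4 * X)^-1 by near: n; exact: near_radius.
apply: (le_trans (avg_le_barrier K c N t0 t1 v g n t x cmp h1 h2)).
have m0 := mass_gt0 (d := d) (radius n) dl0 (radius_le1 n).
rewrite /barrier; have -> : N / 2 * @mass R d (radius n) * expR (expo c t0 (radius n) t * (1 + sqn x)) =
  @mass R d (radius n) * (N / 2 * expR (expo c t0 (radius n) t * (1 + sqn x))) by ring.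
rewrite ler_wpM2l ?(ltW m0)//.
set Y := slope c t0 t * (1 + sqn x).
have Y0 : 0 <= Y.
  by apply: mulr_ge0; [exact: (le_trans ler01 a1)|rewrite addr_ge0 ?sqn_ge0].
have YX : Y <= X by exact: Xle.
have -> : expo c t0 (radius n) t * (1 + sqn x) = Y + 2 * radius n * Y.
  by rewrite /expo /Y; ring.
have u1 : 2 * radius n * Y <= 2 * radius n * X by rewrite ler_wpM2l// mulr_ge0// ltW.
have u2 : 2 * radius n * X <= 2^-1.
  have X4 : 0 < 4 * X by lra.
  have : radius n * (4 * X) < 1 by rewrite -[ltRHS](mulVf (lt0r_neq0 X4)) ltr_pM2r.
  lra.
have u0 : 0 <= 2 * radius n * Y by apply: mulr_ge0 => //; apply: mulr_ge0 => //; exact: ltW.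
have q : expR (2 * radius n * Y) <= 1 + 4 * radius n * X.
  rewrite (le_trans (expR_quad _ (le_trans u1 u2)))//.
  move: u0 u1 u2; move: (2 * radius n * Y) => u u0 u1 u2.
  have : u ^+ 2 <= u * 2^-1 by rewrite expr2 ler_wpM2l//; exact: le_trans u2.
  lra.
rewrite expRD mulrA.
have EY : N / 2 * expR Y <= N / 2 * expR X by rewrite ler_wpM2l ?(ltW N20)// ler_expR.
have EY0 : 0 <= N / 2 * expR Y by rewrite mulr_ge0 ?expR_ge0 ?(ltW N20).
rewrite (le_trans (ler_wpM2l EY0 q))// mulrDr mulr1 lerD2l.
have rX : 0 <= 4 * radius n * X by apply: mulr_ge0; [apply: mulr_ge0 => //|]; exact: ltW.
rewrite (le_trans (ler_wpM2r rX EY))//.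
have -> : N / 2 * expR X * (4 * radius n * X) = radius n * D by rewrite /D; ring.
by rewrite -ler_pdivlMr// ltW.
Unshelve. all: by end_near. Qed.

Lemma comparison_half K c N t0 t1 v g : comparison K c N t0 t1 v g ->
  comparison K c (N / 2) t0 t1 v g.
Proof.
move=> cmp; have [K0 c0 N0 ev short init apriori] := cmp.
split => //; first by rewrite divr_gt0.
move=> t h1 h2; apply: filterS2 (ae_le_half _ _ _ _ _ _ _ t cmp h1 h2)
  (ae_le_half _ _ _ _ _ _ _ t (comparisonN _ _ _ _ _ _ _ cmp) h1 h2) => y.
by move=> A B; rewrite ler_norml A andbT lerNl.
Qed.

Lemma comparison_zero K c N t0 t1 v g t : comparison K c N t0 t1 v g ->
  t0 <= t -> t <= t1 -> {ae mu, forall y, v t y = 0}.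
Proof.
move=> cmp h1 h2.
have cj j : comparison K c (N / 2 ^+ j) t0 t1 v g.
  elim: j => [|j IH]; first by rewrite expr0 divr1.
  by rewrite exprSr invfM mulrA; exact: comparison_half.
have /ae_foralln := fun j => cmp_apriori _ _ _ _ _ _ _ (cj j) t h1 h2.
apply: filterS => y hy; apply/eqP; rewrite -normr_le0.
set E := expR (slope c t0 t * (1 + sqn y)) in hy.
have cv : N / 2 ^+ j * E @[j --> \oo] --> 0.
  rewrite (_ : (fun j => _) = (fun j => (N * E) * (2^-1) ^+ j)); last first.
    by apply/funext => j; rewrite exprVn mulrAC.
  rewrite -[X in _ --> X](mulr0 (N * E)).
  apply: (cvgM (cvg_cst (N * E))).
  by apply: cvg_expr; rewrite ger0_norm//; lra.
apply/ler_addgt0Pr => e e0; rewrite add0r.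
have /cvgrPdist_le/(_ e e0)[n _ /(_ n (leqnn n))] := cv.
by rewrite /= sub0r normrN; apply: le_trans; exact: le_trans (hy n) (ler_norm _).
Qed.

(** Steps of length 1 / rate c: at the end of each step v vanishes again, and the
    growth bound gives the a priori estimate with N = K + 1 for the next
    one. *)
Lemma evolution_unique K c v g (T : R) : 0 <= K -> 0 < c -> evolution K c v g 0 T ->
  {ae mu, forall y, v 0 y = 0} ->
  forall t, 0 <= t -> t <= T -> {ae mu, forall y, v t y = 0}.
Proof.
move=> K0 c0 ev init.
have rc := rate_gt0 (d := d) c c0.
pose tau := (rate c)^-1.
have tau0 : 0 < tau by rewrite invr_gt0.
suff H n t : 0 <= t -> t <= T -> t <= n%:R * tau -> {ae mu, forall y, v t y = 0}.
  move=> t h1 h2; apply: (H (Num.truncn (t * rate c)).+1) => //.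
  by rewrite -ler_pdivrMr// invrK ltW// truncnS_gt.
elim: n t => [|n IH] t h1 h2 h3.
  have -> : t = 0 by apply/eqP; rewrite eq_le h1 andbT; move: h3; rewrite mul0r.
  exact: init.
have [h4|h4] := leP t (n%:R * tau); first exact: IH.
have n0 : 0 <= n%:R * tau by rewrite mulr_ge0 ?(ltW tau0).
apply: (@comparison_zero K c (K + 1) (n%:R * tau) t v g) => //; last exact: ltW.
split => //.
- by rewrite ltr_wpDl.
- exact: (evolutionS _ _ _ _ _ _ _ _ n0 h2 ev).
- rewrite mulrC -ler_pdivlMr// div1r -/tau; move: h3; rewrite -natr1 mulrDl mul1r; lra.
- by apply: IH => //; exact: le_trans (ltW h4) h2.
move=> s s1 s2; apply: aeW => y.
rewrite (le_trans (ev_growth _ _ _ _ _ _ ev s y (le_trans n0 s1) (le_trans s2 h2)))//.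
rewrite ler_pM ?expR_ge0//; first by rewrite lerDl.
have := sqn_ge0 y; have := slope_ge1 (d := d) c (n%:R * tau) s c0 s1.
rewrite ler_expR; move: (slope _ _ _) (sqn y) => a q; nra.
Qed.

End uniqueness.

(** * Bumps as test functions *)

Section bump_test_functions.
Context {R : realType} {d : nat}.
Implicit Types (x y : 'rV[R]_d) (f : 'rV[R]_d -> R).

(** Differentiability everywhere, with the directional derivatives given by df;
    in this form products and sums are differentiated by plain formulas. *)
Definition has_diff f (df : 'rV[R]_d -> 'rV[R]_d -> R) : Prop :=
  forall y, differentiable f y /\ forall v, 'D_v f y = df y v.

Lemma has_diffE f df v : has_diff f df -> 'D_v f = fun y => df y v.
Proof. by move=> H; apply/funext => y; have [_] := H y; apply. Qed.

Lemma has_diff_ext f f' df df' : has_diff f df -> f =1 f' -> df =2 df' ->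
  has_diff f' df'.
Proof.
move=> hf /funext <- h; rewrite (_ : df' = df)//.
by apply/funext => y; apply/funext => v; rewrite h.
Qed.

Lemma has_diff_cst (a : R) : has_diff (fun=> a) (fun _ _ => 0).
Proof.
move=> y; split; first exact: differentiable_cst.
by move=> v; exact: (derive_cst a y v).
Qed.

Lemma has_diffD f g df dg : has_diff f df -> has_diff g dg ->
  has_diff (fun y => f y + g y) (fun y v => df y v + dg y v).
Proof.
move=> hf hg y; have [f1 f2] := hf y; have [g1 g2] := hg y.
split; first exact: (differentiableD f1 g1).
move=> v; have := @deriveD _ _ _ f g y v (diff_derivable f1) (diff_derivable g1).
by rewrite f2 g2.
Qed.

Lemma has_diffM f g df dg : has_diff f df -> has_diff g dg ->
  has_diff (fun y => f y * g y) (fun y v => f y * dg y v + g y * df y v).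
Proof.
move=> hf hg y; have [f1 f2] := hf y; have [g1 g2] := hg y.
split; first exact: (differentiableM f1 g1).
move=> v; have := @deriveM _ _ f g y v (diff_derivable f1) (diff_derivable g1).
by rewrite f2 g2.
Qed.

Lemma has_diff_sum (F : 'I_d -> 'rV[R]_d -> R) dF :
  (forall i, has_diff (F i) (dF i)) ->
  has_diff (fun y => \sum_(i < d) F i y) (fun y v => \sum_(i < d) dF i y v).
Proof.
move=> hF; suff H (s : seq 'I_d) :
  has_diff (fun y => \sum_(i <- s) F i y) (fun y v => \sum_(i <- s) dF i y v) by exact: H.
elim: s => [|i s IH].
  by apply: (has_diff_ext _ _ _ _ (has_diff_cst 0)) => y; [|move=> v]; rewrite big_nil.
apply: (has_diff_ext _ _ _ _ (has_diffD _ _ _ _ (hF i) IH)) => y; first by rewrite big_cons.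
by move=> v; rewrite big_cons.
Qed.

Lemma has_diff_coord i : has_diff (fun y => y ord0 i) (fun _ v => v ord0 i).
Proof.
move=> y; split; first exact: differentiable_coord.
move=> v; apply/cvg_lim => //; apply: cvg_near_cst.
near=> h; rewrite /= !mxE addrK.
have h0 : h != 0 by near: h; exact: nbhs_dnbhs_neq.
by rewrite [LHS]mulrA mulVf// mul1r.
Unshelve. all: by end_near. Qed.

Lemma has_diff_comp (p p' : R -> R) f df :
  (forall s : R, is_derive s 1 p (p' s)) -> has_diff f df ->
  has_diff (fun y => p (f y)) (fun y v => p' (f y) * df y v).
Proof.
move=> hp hf y; have [f1 f2] := hf y; have [p1 p2] := hp (f y).
have dp : differentiable p (f y) by apply/derivable1_diffP.
have dpf : differentiable (p \o f) y by exact: differentiable_comp.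
split => // v.
have -> : 'D_v (fun y => p (f y)) y = 'd (p \o f) y v by exact: (deriveE v dpf).
rewrite (diff_comp f1 dp) /= diff1E// -(deriveE _ f1) f2 derive1E p2.
exact: mulrC.
Qed.

(** The remainder of the first-order expansion is at most h^2, also across the
    kink at 0. *)
Lemma is_derive_ppow2 (s : R) : is_derive s 1 (ppow 2) (2 * ppow 1 s).
Proof.
have bd (h : R) : `|ppow 2 (s + h) - ppow 2 s - 2 * ppow 1 s * h| <= h ^+ 2.
  have [s0|s0] := leP 0 s; have [sh|sh] := leP 0 (s + h).
  - rewrite !ppow_pos//.
    have -> : (s + h) ^+ 2 - s ^+ 2 - 2 * s ^+ 1 * h = h ^+ 2 by ring.
    by rewrite ger0_norm// sqr_ge0.
  - rewrite (ppow_neg _ (s + h)) ?(ltW sh)// !ppow_pos// ler_norml.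
    by apply/andP; split; nra.
  - rewrite (ppow_pos _ (s + h))// !(ppow_neg _ s) ?(ltW s0)// ler_norml.
    by apply/andP; split; nra.
  - rewrite !ppow_neg ?(ltW s0) ?(ltW sh)// mulr0 mul0r !subr0 normr0.
    exact: sqr_ge0.
have cv : (fun h => h^-1 *: ((ppow 2 \o shift s) (h *: 1) - ppow 2 s)) @ 0^' --> (2 * ppow 1 s : R).
  apply/cvgrPdist_le => e e0; near=> h.
  have h0 : h != 0 by near: h; exact: nbhs_dnbhs_neq.
  have he : `|h| <= e.
    near: h; apply: nbhs_dnbhs; exists e => //= h /=; rewrite sub0r normrN => /ltW; exact.
  rewrite /= [_ *: 1]mulr1 [h + s]addrC.
  have -> : 2 * ppow 1 s - h^-1 *: (ppow 2 (s + h) - ppow 2 s) =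
     - (h^-1 * (ppow 2 (s + h) - ppow 2 s - 2 * ppow 1 s * h)).
    have e1 : h^-1 * h = 1 by rewrite mulVf.
    transitivity (2 * ppow 1 s - h^-1 * (ppow 2 (s + h) - ppow 2 s)); first by [].
    transitivity (2 * ppow 1 s * (h^-1 * h) - h^-1 * (ppow 2 (s + h) - ppow 2 s)); last by ring.
    by rewrite e1 mulr1.
  rewrite normrN normrM normfV (le_trans (ler_wpM2l _ (bd h))) ?invr_ge0//.
  by rewrite -real_normK ?num_real// expr2 mulrA mulVf ?normr_eq0// mul1r.
split; last exact/cvg_lim.
by apply/cvg_ex; exists (2 * ppow 1 s).
Unshelve. all: by end_near. Qed.

Lemma is_derive_ppow m (s : R) : is_derive s 1 (ppow m.+2) (m.+2%:R * ppow m.+1 s).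
Proof.
elim: m => [|m IH]; first exact: is_derive_ppow2.
rewrite (_ : ppow m.+3 = (fun t => t) * ppow m.+2); last first.
  by apply/funext => t; rewrite -ppowS.
apply: is_derive_eq; rewrite /GRing.scale/=.
rewrite mulr1 -ppowS -[m.+3%:R]natr1; ring.
Qed.

Lemma has_diff_dotr x v : has_diff (fun y => dotrv (y - x) v) (fun _ w => dotrv w v).
Proof.
have h i := has_diffM _ _ _ _ (has_diffD _ _ _ _ (has_diff_coord i) (has_diff_cst (- x ord0 i)))
  (has_diff_cst (v ord0 i)).
apply: (has_diff_ext _ _ _ _ (has_diff_sum _ _ h)) => y.
  by apply: eq_bigr => i _; rewrite !mxE.
by move=> w; apply: eq_bigr => i _; ring.
Qed.

Lemma has_diff_sqn (dl : R) x : has_diff (fun y => dl ^+ 2 - sqn (y - x))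
  (fun y v => - (2 * dotrv (y - x) v)).
Proof.
have h i := has_diffD _ _ _ _ (has_diff_coord i) (has_diff_cst (- x ord0 i)).
have h2 i := has_diffM _ _ _ _ (has_diff_cst (- 1)) (has_diffM _ _ _ _ (h i) (h i)).
apply: (has_diff_ext _ _ _ _ (has_diffD _ _ _ _ (has_diff_cst (dl ^+ 2)) (has_diff_sum _ _ h2))) => y.
  rewrite sqnE -mulr_sumr mulN1r; congr (_ - _).
  by apply: eq_bigr => i _; rewrite !mxE expr2.
move=> v; rewrite add0r /dotrv mulr_sumr -sumrN.
by apply: eq_bigr => i _; rewrite !mxE; ring.
Qed.

Lemma has_diff_bump m dl x : has_diff (bump m.+2 dl x)
  (fun y v => (- 2 * m.+2%:R) * (bump m.+1 dl x y * dotrv (y - x) v)).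
Proof.
apply: (has_diff_ext _ _ _ _ (has_diff_comp _ _ _ _ (is_derive_ppow m) (has_diff_sqn dl x))) => // y v.
by rewrite /bump; ring.
Qed.

Lemma has_diff_bump2 m dl x v : has_diff ('D_v (bump m.+3 dl x))
  (fun y w => 4 * m.+3%:R * m.+2%:R * (bump m.+1 dl x y * dotrv (y - x) w * dotrv (y - x) v)
     - 2 * m.+3%:R * (bump m.+2 dl x y * dotrv w v)).
Proof.
rewrite (has_diffE _ _ _ (has_diff_bump m.+1 dl x)).
apply: (has_diff_ext _ _ _ _ (has_diffM _ _ _ _ (has_diff_cst (- 2 * m.+3%:R))
  (has_diffM _ _ _ _ (has_diff_bump m dl x) (has_diff_dotr x v)))) => // y w.
ring.
Qed.

Lemma continuous_has_diff f df : has_diff f df -> continuous f.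
Proof. by move=> hf y; have [/differentiable_continuous] := hf y. Qed.

Lemma continuous_bump m dl x : continuous (bump m dl x).
Proof.
have cs := continuous_has_diff _ _ (has_diff_sqn dl x).
case: m => [|m]; first by rewrite (_ : bump 0 dl x = fun=> 1); [exact: continuous_cstf|
  by apply/funext => y; rewrite /bump /ppow expr0].
have c1 : continuous (fun y => Num.max (dl ^+ 2 - sqn (y - x)) 0).
  by apply: continuous_maxf => //; exact: continuous_cstf.
elim: m => [|m IH]; first by rewrite (_ : bump 1 dl x = (fun y => Num.max (dl ^+ 2 - sqn (y - x)) 0)).
rewrite (_ : bump m.+2 dl x = fun y => Num.max (dl ^+ 2 - sqn (y - x)) 0 * bump m.+1 dl x y).
  exact: continuous_mulf.
by apply/funext => y; rewrite /bump /ppow [LHS]exprS.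
Qed.

Lemma class_C2_bump m dl x : class_C 2 (bump m.+3 dl x).
Proof.
have cdot v : continuous (fun y => dotrv (y - x) v).
  exact: continuous_has_diff (has_diff_dotr x v).
case=> [|v [|w [|? ?]]] /=; split=> //.
- by move=> _ y; have [] := has_diff_bump m.+1 dl x y.
- by move=> _; exact: continuous_bump.
- by move=> _ y; have [] := has_diff_bump2 m dl x v y.
- by move=> _; exact: continuous_has_diff (has_diff_bump2 m dl x v).
move=> _; rewrite (has_diffE _ _ _ (has_diff_bump2 m dl x w)).
apply: continuous_subf; apply: continuous_mulf; try exact: continuous_cstf.
  by do 2?[apply: continuous_mulf => //]; exact: continuous_bump.
by apply: continuous_mulf; [exact: continuous_bump|exact: continuous_cstf].
Qed.

Lemma dotrv_basis x i : dotrv x (basis_rv R i) = x ord0 i.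
Proof.
rewrite /dotrv (bigD1 i)//= big1 ?addr0; last first.
  by move=> j ji; rewrite /basis_rv mxE (negbTE ji) andbF mulr0.
by rewrite /basis_rv mxE !eqxx mulr1.
Qed.

Definition lapbump m dl x y : R :=
  4 * m%:R * m.-1%:R * (dl ^+ 2 * bump m.-2 dl x y - bump m.-1 dl x y)
  - 2 * m%:R * d%:R * bump m.-1 dl x y.

(** The factor |y - x|^2 produced by differentiating twice is r^2 minus the
    argument of the bump, and so raises its order by one. *)
Lemma laplacian_bump m dl x y :
  laplacian (bump m.+3 dl x) y = lapbump m.+3 dl x y.
Proof.
have E i : iter_derive [:: basis_rv R i; basis_rv R i] (bump m.+3 dl x) y =
  4 * m.+3%:R * m.+2%:R * (bump m.+1 dl x y * (y - x) ord0 i ^+ 2) - 2 * m.+3%:R * bump m.+2 dl x y.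
  have [_ /(_ (basis_rv R i)) D2] := has_diff_bump2 m dl x (basis_rv R i) y.
  rewrite [LHS]D2 !dotrv_basis.
  have b1 : basis_rv R i ord0 i = 1 by rewrite /basis_rv mxE !eqxx.
  by rewrite b1; ring.
rewrite /laplacian; under eq_bigr do rewrite E.
rewrite sumrB sumr_const card_ord -!mulr_sumr -sqnE -[_ *+ d]mulr_natr /lapbump /=.
have -> : bump m.+2 dl x y = (dl ^+ 2 - sqn (y - x)) * bump m.+1 dl x y.
  by rewrite /bump ppowS.
ring.
Qed.

Lemma compact_support_bump m (dl : R) x : 0 <= dl -> dl <= 1 ->
  compact_support (bump m.+1 dl x).
Proof.
move=> d0 d1; pose r := sqn x + 1 + 1.
have kcube := @compact_cube R d r.
have ccube : closed (@cube R d r) by apply: compact_closed kcube; exact: norm_hausdorff.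
apply: subclosed_compact kcube _; first exact: closed_closure.
rewrite closureE; apply: smallest_sub => // y /= /eqP yb.
apply: contrapT => ny; apply: yb; exact: bump_supp (cube_sqn x) ny.
Qed.

End bump_test_functions.

(** * Growth of solutions and of Lipschitz constants *)

Section growth.
Context {R : realType}.
Implicit Types (nu eps s q : R).

(** Beyond the point where s^(2 - nu) = 2, the power s^nu is at most s^2 / 2. *)
Lemma powR_le_half_sqr nu : 0 < nu -> nu < 2 ->
  exists C : R, forall s, 0 <= s -> s `^ nu <= 2^-1 * s ^+ 2 + C.
Proof.
move=> nu0 nu2; have n2 : 0 < 2 - nu by rewrite subr_gt0.
pose S0 : R := 2 `^ (2 - nu)^-1.
have S00 : 0 < S0 by exact: powR_gt0.
exists (S0 `^ nu) => s s0.
have [sS|Ss] := leP s S0.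
  have h : s `^ nu <= S0 `^ nu.
    by apply: ge0_ler_powR => //; [exact: ltW|rewrite nnegrE ltW].
  by rewrite (le_trans h)// lerDr mulr_ge0// sqr_ge0.
have sp : 0 < s by exact: lt_trans Ss.
have e : s `^ nu * s `^ (2 - nu) = s ^+ 2.
  rewrite -powRD; last by rewrite (gt_eqF sp) /= implybT.
  by rewrite addrC subrK powR_mulrn.
have h2 : 2 <= s `^ (2 - nu).
  have e2 : S0 `^ (2 - nu) = 2 by rewrite /S0 -powRrM mulVf ?lt0r_neq0// powRr1.
  by rewrite -[leLHS]e2; apply: ge0_ler_powR; rewrite ?nnegrE ?ltW.
have p0 : 0 <= s `^ nu by exact: powR_ge0.
have : s `^ nu * 2 <= s ^+ 2 by rewrite -e ler_wpM2l.
have := powR_ge0 S0 nu; lra.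
Qed.

Lemma expR_powR_le nu : 0 < nu -> nu < 2 ->
  exists2 C : R, 0 <= C & forall s, 0 <= s -> expR (s `^ nu) <= C * expR (2^-1 * s ^+ 2).
Proof.
move=> nu0 nu2; have [C hC] := powR_le_half_sqr nu nu0 nu2.
exists (expR C); first exact: expR_ge0.
by move=> s s0; rewrite -expRD ler_expR addrC hC.
Qed.

(** For r = A exp(s^nu) one has log r = log A + s^nu, whose power 1 + eps is at
    most of the order of max(1, s)^(nu (1 + eps)), hence of 1 + s^2. *)
Lemma log_growth_quadratic (L : R -> R) eps nu : 0 < eps -> 0 < nu ->
  nu * (1 + eps) <= 2 ->
  L r / ln r `^ (1 + eps) @[r --> +oo] --> 0 ->
  forall K : R, exists A c : R, [/\ K <= A, 0 <= A, 0 < c &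
    forall s, 0 <= s -> L (A * expR (s `^ nu)) <= c * (1 + s ^+ 2)].
Proof.
move=> e0 nu0 nue Lg K.
have /cvgrPdist_le/(_ 1 ltr01)[r0 [_ hr0]] := Lg.
pose A := Num.max (Num.max K (r0 + 1)) (expR 1).
have A1 : expR 1 <= A by rewrite le_max lexx orbT.
have Ap : 0 < A by rewrite (lt_le_trans (expR_gt0 1)).
have lA : 1 <= ln A by rewrite -[leLHS](expRK 1) ler_ln// posrE expR_gt0.
have e1 : 0 <= 1 + eps by lra.
exists A, ((ln A + 1) `^ (1 + eps)); split.
- by rewrite !le_max lexx.
- exact: ltW.
- by rewrite powR_gt0//; lra.
move=> s s0; set r := A * _.
have E1 : 1 <= expR (s `^ nu) by rewrite -expR0 ler_expR powR_ge0.
have rA : A <= r by rewrite /r ler_peMr// ltW.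
have rp : 0 < r by exact: lt_le_trans rA.
have lr : ln r = ln A + s `^ nu by rewrite /r lnM ?posrE ?expR_gt0// expRK.
have lr1 : 1 <= ln r by rewrite lr; have := powR_ge0 s nu; lra.
have lrp : 0 < ln r `^ (1 + eps) by rewrite powR_gt0//; lra.
have h1 : L r <= ln r `^ (1 + eps).
  have r0r : r0 < r.
    rewrite (lt_le_trans _ rA)// /A !lt_max ltrDl ltr01 orbT//.
  have := hr0 r r0r; rewrite /= sub0r normrN normrM normfV (gtr0_norm lrp).
  by rewrite ler_pdivrMr// mul1r; apply: le_trans; exact: ler_norm.
apply: (le_trans h1).
pose M := Num.max 1 s.
have M1 : 1 <= M by rewrite le_max lexx.
have Mp : 0 <= M by lra.
have sM : s <= M by rewrite le_max lexx orbT.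
have h2 : ln r <= (ln A + 1) * M `^ nu.
  have p1 : 1 `^ nu = 1 :> R by rewrite powR1.
  have m1 : 1 <= M `^ nu by rewrite -[leLHS]p1 ge0_ler_powR ?nnegrE// ltW.
  have m2 : s `^ nu <= M `^ nu by rewrite ge0_ler_powR ?nnegrE// ltW.
  rewrite lr mulrDl mul1r lerD//.
  by rewrite ler_peMr//; lra.
have h3 : ln r `^ (1 + eps) <= ((ln A + 1) * M `^ nu) `^ (1 + eps).
  apply: ge0_ler_powR => //; rewrite ?nnegrE; first lra.
  by rewrite mulr_ge0 ?powR_ge0//; lra.
apply: (le_trans h3); rewrite powRM ?powR_ge0//; last lra.
rewrite ler_wpM2l ?powR_ge0// -powRrM.
apply: (@le_trans _ _ (M `^ 2)); first by rewrite ler_powR.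
rewrite powR_mulrn//.
have [hs|hs] := leP s 1.
  by rewrite /M max_l// expr1n lerDl sqr_ge0.
by rewrite /M max_r ?(ltW hs)// lerDr.
Qed.

End growth.

(** * Paths of weak solutions *)

Section weak_formulation.
Context {R : realType} {d : nat}.
Implicit Types (x y : 'rV[R]_d) (u v g : R -> 'rV[R]_d -> R) (w k : 'rV[R]_d -> R).
Let mu := lebesgue_rv R d.
Local Notation leb := (@lebesgue_measure R).

Definition ratv (q : 'rV[rat]_d) : 'rV[R]_d := map_mx ratr q.

Lemma ratv_dense x (e : R) : 0 < e ->
  exists q, forall i, `|x ord0 i - ratv q ord0 i| <= e.
Proof.
move=> e0; have h i : exists q : rat, `|x ord0 i - ratr q| <= e.
  have xe : x ord0 i - e < x ord0 i + e by lra.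
  have [q] := rat_in_itvoo xe.
  rewrite in_itv/= => /andP[q1 q2]; exists q.
  by rewrite ler_norml; apply/andP; split; lra.
have [F FP] := fin_all_exists h.
by exists (\row_i F i) => i; rewrite !mxE; exact: FP.
Qed.

Lemma integral_laplacian_bump m (dl : R) w x : 0 <= dl -> dl <= 1 ->
  measurable_fun setT w -> locally_bounded w ->
  \int[mu]_y (w y * (2^-1 * laplacian (bump m.+3 dl x) y)) =
  2^-1 * lapavg m.+3 dl w x.
Proof.
move=> d0 d1 mw lw; have [M wM] := lw (sqn x + 1 + 1).
have i1 := @integrable_avg R d w _ M m.+1 dl x isT d0 d1 mw (cube_sqn x) wM.
have i2 := @integrable_avg R d w _ M m.+2 dl x isT d0 d1 mw (cube_sqn x) wM.
pose a := 2^-1 * (4 * m.+3%:R * m.+2%:R * dl ^+ 2) : R.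
pose b := 2^-1 * (4 * m.+3%:R * m.+2%:R + 2 * m.+3%:R * d%:R) : R.
transitivity (\int[mu]_y (a * (w y * bump m.+1 dl x y) - b * (w y * bump m.+2 dl x y))).
  by apply: eq_Rintegral => y _; rewrite laplacian_bump /lapbump /a /b /=; ring.
rewrite (RintegralB measurableT (integrableRZ a _ i1) (integrableRZ b _ i2)).
rewrite (RintegralZl a measurableT i1) (RintegralZl b measurableT i2).
by rewrite /lapavg /avg /a /b /=; ring.
Qed.

(** Fubini on [0, T] x R^d, with the integrand extended by zero. *)
Lemma integrable_slice (T : R) (h : R * 'rV[R]_d -> R) :
  (leb \x mu)%E.-integrable (`[0, T] `*` setT) (EFin \o h) ->
  leb.-integrable `[0, T] (EFin \o (fun s => \int[mu]_y h (s, y))).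
Proof.
move=> ih; set D := `[0, T] `*` setT in ih.
have mD : measurable D by apply: measurableX.
have ih' : (leb \x mu)%E.-integrable setT ((EFin \o h) \_ D) by rewrite -integrable_mkcond.
have iF := integrable_fubini_F ih'.
set F := fubini_F mu _ in iF.
have FE s : `[0, T]%classic s -> fine (F s) = \int[mu]_y h (s, y).
  move=> sT; rewrite /F /fubini_F /Rintegral; congr fine.
  by apply: eq_integral => y _; rewrite patchE mem_set.
have ifF : leb.-integrable setT (EFin \o (fun s => fine (F s))).
  apply: (le_integrable measurableT _ _ iF).
    apply/measurable_EFinP; apply: measurableT_comp (fine_measurable measurableT) _.
    exact: (measurable_int leb iF).
  move=> s _ /=; case: (F s) => [r| |] //=; by rewrite normr0 ?leey.
apply: (eq_integrable _ (EFin \o (fun s => fine (F s)))) => //.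
  by move=> s; rewrite inE => sT /=; rewrite FE.
exact: integrableS ifF.
Qed.

Lemma measurable_segment (a b : R) :
  measurable (`[a, b]%classic : set (measurableTypeR R)).
Proof. exact: measurable_itv. Qed.

Lemma integrable_subsegment (t T : R) (F : R -> R) : t <= T ->
  leb.-integrable `[0, T] (EFin \o F) -> leb.-integrable `[0, t] (EFin \o F).
Proof.
move=> tT; apply: integrableS; [exact: measurable_segment..|].
by move=> s /=; rewrite !in_itv/= => /andP[-> st]; exact: le_trans st tT.
Qed.

(** The weak formulation, read on one bump, in terms of averages; I t stands for
    the contribution of the noise. *)
Lemma weak_increment m (dl T : R) u (f : R -> R) (I : R -> R) x :
  0 <= dl -> dl <= 1 ->
  (forall t, 0 <= t <= T -> measurable_fun setT (u t) /\ locally_bounded (u t)) ->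
  (leb \x mu)%E.-integrable (`[0, T] `*` setT)
     (fun z => (u z.1 z.2 * (2^-1 * laplacian (bump m.+3 dl x) z.2))%:E) ->
  (leb \x mu)%E.-integrable (`[0, T] `*` setT)
     (fun z => (f (u z.1 z.2) * bump m.+3 dl x z.2)%:E) ->
  (forall t, 0 <= t <= T ->
     \int[mu]_y (u t y * bump m.+3 dl x y) - \int[mu]_y (u 0 y * bump m.+3 dl x y) =
     \int[leb]_(s in `[0, t])
        \int[mu]_y (u s y * (2^-1 * laplacian (bump m.+3 dl x) y)) +
     \int[leb]_(s in `[0, t]) \int[mu]_y (f (u s y) * bump m.+3 dl x y) + I t) ->
  leb.-integrable `[0, T] (EFin \o (fun s => drift m.+3 dl (u s) (f \o u s) x)) /\
  forall t, 0 <= t <= T -> avg m.+3 dl (u t) x - avg m.+3 dl (u 0) x =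
    \int[leb]_(s in `[0, t]) drift m.+3 dl (u s) (f \o u s) x + I t.
Proof.
move=> d0 d1 mu_ i1 i2 eqn.
have j1 := integrable_slice T _ i1; have j2 := integrable_slice T _ i2.
have dE s : 0 <= s <= T -> \int[mu]_y (u s y * (2^-1 * laplacian (bump m.+3 dl x) y)) +
    \int[mu]_y (f (u s y) * bump m.+3 dl x y) = drift m.+3 dl (u s) (f \o u s) x.
  move=> sT; have [mus lus] := mu_ s sT.
  by rewrite integral_laplacian_bump.
split.
  move: (integrableD (measurable_segment 0 T) j1 j2); apply: eq_integrable => //.
  by move=> s; rewrite inE/= in_itv/= => sT; rewrite -dE.
move=> t tT; rewrite [LHS]eqn//; congr (_ + _).
have /andP[t0 tT'] := tT.
have k1 := integrable_subsegment t T _ tT' j1.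
have k2 := integrable_subsegment t T _ tT' j2.
rewrite -(RintegralD (measurable_segment 0 t) k1 k2).
apply: eq_Rintegral => s; rewrite inE/= in_itv/= => /andP[s0 st].
by rewrite dE// s0 (le_trans st tT').
Qed.

Lemma integral_increment (T M s t : R) (F : R -> R) :
  leb.-integrable `[0, T] (EFin \o F) -> 0 <= s -> s <= t -> t <= T ->
  (forall r, s <= r -> r <= t -> F r <= M) ->
  \int[leb]_(r in `[0, t]) F r - \int[leb]_(r in `[0, s]) F r <= M * (t - s).
Proof.
move=> iF s0 st tT FM.
have iFt := integrable_subsegment t T _ tT iF.
rewrite Rintegral_itvB//.
have iFs : leb.-integrable `]s, t] (EFin \o F).
  apply: integrableS iFt => // r /=; rewrite !in_itv/= => /andP[sr ->].
  by rewrite andbT (le_trans s0)// ltW.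
rewrite (@le_trans _ _ (\int[leb]_(r in `]s, t]) M))//.
  apply: le_Rintegral => //.
    apply: measurable_bounded_integrable => //.
      by rewrite [ltLHS]lebesgue_measure_itv/=; case: ifP => _; rewrite ltry.
    exact: bounded_cst.
  by move=> r /=; rewrite in_itv/= => /andP[sr rt]; apply: FM => //; exact: ltW.
rewrite Rintegral_cst// [X in fine X]lebesgue_measure_itv/= lte_fin.
by have [ts|ts] := ltP s t => //=; rewrite mulr0 (_ : t - s = 0) ?mulr0//; apply/eqP; rewrite subr_eq0 eq_le ts st.
Qed.

Lemma avgB m (dl : R) w k x : (0 < m)%N -> 0 <= dl -> dl <= 1 ->
  measurable_fun setT w -> locally_bounded w ->
  measurable_fun setT k -> locally_bounded k ->
  avg m dl (fun y => w y - k y) x = avg m dl w x - avg m dl k x.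
Proof.
move=> m0 d0 d1 mw lw mk lk.
have [M wM] := lw (sqn x + 1 + 1); have [M' kM] := lk (sqn x + 1 + 1).
have iw := @integrable_avg R d w _ M m dl x m0 d0 d1 mw (cube_sqn x) wM.
have ik := @integrable_avg R d k _ M' m dl x m0 d0 d1 mk (cube_sqn x) kM.
rewrite /avg -(RintegralB measurableT iw ik).
by apply: eq_Rintegral => y _; rewrite mulrBl.
Qed.

Lemma driftB m (dl : R) w w' k k' x : 0 <= dl -> dl <= 1 ->
  measurable_fun setT w -> locally_bounded w ->
  measurable_fun setT w' -> locally_bounded w' ->
  measurable_fun setT k -> locally_bounded k ->
  measurable_fun setT k' -> locally_bounded k' ->
  drift m.+3 dl (fun y => w y - w' y) (fun y => k y - k' y) x =
  drift m.+3 dl w k x - drift m.+3 dl w' k' x.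
Proof.
move=> d0 d1 mw lw mw' lw' mk lk mk' lk'.
by rewrite /drift /lapavg /= !avgB//; ring.
Qed.

(** Both paths see the same noise I, which cancels. *)
Lemma difference_increment m (dl T M s t : R) u1 u2 (f : R -> R) (I : R -> R) x :
  0 <= dl -> dl <= 1 ->
  (forall r, 0 <= r <= T -> [/\ measurable_fun setT (u1 r), locally_bounded (u1 r),
      measurable_fun setT (f \o u1 r) & locally_bounded (f \o u1 r)]) ->
  (forall r, 0 <= r <= T -> [/\ measurable_fun setT (u2 r), locally_bounded (u2 r),
      measurable_fun setT (f \o u2 r) & locally_bounded (f \o u2 r)]) ->
  leb.-integrable `[0, T] (EFin \o (fun s => drift m.+3 dl (u1 s) (f \o u1 s) x)) /\
  (forall t, 0 <= t <= T -> avg m.+3 dl (u1 t) x - avg m.+3 dl (u1 0) x =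
    \int[leb]_(s in `[0, t]) drift m.+3 dl (u1 s) (f \o u1 s) x + I t) ->
  leb.-integrable `[0, T] (EFin \o (fun s => drift m.+3 dl (u2 s) (f \o u2 s) x)) /\
  (forall t, 0 <= t <= T -> avg m.+3 dl (u2 t) x - avg m.+3 dl (u2 0) x =
    \int[leb]_(s in `[0, t]) drift m.+3 dl (u2 s) (f \o u2 s) x + I t) ->
  0 <= s -> s <= t -> t <= T ->
  (forall r, s <= r -> r <= t -> drift m.+3 dl (fun y => u1 r y - u2 r y)
     (fun y => f (u1 r y) - f (u2 r y)) x <= M) ->
  avg m.+3 dl (fun y => u1 t y - u2 t y) x - avg m.+3 dl (fun y => u1 s y - u2 s y) x
  <= M * (t - s).
Proof.
move=> d0 d1 h1 h2 [i1 e1] [i2 e2] s0 st tT FM.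
have tI : 0 <= t <= T by rewrite tT (le_trans s0 st).
have sI : 0 <= s <= T by rewrite s0 (le_trans st tT).
have iF := integrableB (measurable_segment 0 T) i1 i2.
have F1 r : leb.-integrable `[0, r] (EFin \o (fun s => drift m.+3 dl (u1 s) (f \o u1 s) x))
    -> leb.-integrable `[0, r] (EFin \o (fun s => drift m.+3 dl (u2 s) (f \o u2 s) x)) ->
   \int[leb]_(s in `[0, r]) (drift m.+3 dl (u1 s) (f \o u1 s) x - drift m.+3 dl (u2 s) (f \o u2 s) x)
   = \int[leb]_(s in `[0, r]) drift m.+3 dl (u1 s) (f \o u1 s) x -
     \int[leb]_(s in `[0, r]) drift m.+3 dl (u2 s) (f \o u2 s) x.
  by move=> q1 q2; exact: (RintegralB (measurable_segment 0 r) q1 q2).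
have sT : s <= T by exact: le_trans st tT.
have := integral_increment T M s t _ iF s0 st tT.
rewrite (F1 t (integrable_subsegment _ _ _ tT i1) (integrable_subsegment _ _ _ tT i2)).
rewrite (F1 s (integrable_subsegment _ _ _ sT i1) (integrable_subsegment _ _ _ sT i2)).
have -> : avg m.+3 dl (fun y => u1 t y - u2 t y) x - avg m.+3 dl (fun y => u1 s y - u2 s y) x =
   (avg m.+3 dl (u1 t) x - avg m.+3 dl (u1 0) x) - (avg m.+3 dl (u1 s) x - avg m.+3 dl (u1 0) x)
  - ((avg m.+3 dl (u2 t) x - avg m.+3 dl (u2 0) x) - (avg m.+3 dl (u2 s) x - avg m.+3 dl (u2 0) x)).
  have [a1 a2 _ _] := h1 t tI; have [a3 a4 _ _] := h2 t tI.
  have [b1 b2 _ _] := h1 s sI; have [b3 b4 _ _] := h2 s sI.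
  by rewrite !avgB//; ring.
rewrite !e1// !e2//.
set A1 := \int[_]_(_ in _) _; set A2 := \int[_]_(_ in _) _.
set A3 := \int[_]_(_ in _) _; set A4 := \int[_]_(_ in _) _ => H.
have : A1 - A2 - (A3 - A4) <= M * (t - s).
  apply: H => r sr rt.
  have rI : 0 <= r <= T by rewrite (le_trans s0 sr) (le_trans rt tT).
  have [a1 a2 a3 a4] := h1 r rI; have [b1 b2 b3 b4] := h2 r rI.
  by have := FM r sr rt; rewrite driftB.
by apply: le_trans; rewrite le_eqVlt; apply/orP; left; apply/eqP; ring.
Qed.

(** Averages and drifts are Lipschitz in the centre of the bump, uniformly in
    time: replacing x by a rational point at distance h costs a multiple
    of h. *)
Lemma subevolution_of_rational K c v g (T : R) : 0 <= K -> 0 <= c ->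
  (forall t, 0 <= t -> t <= T -> measurable_fun setT (v t)) ->
  (forall t, 0 <= t -> t <= T -> measurable_fun setT (g t)) ->
  (forall t y, 0 <= t -> t <= T -> `|v t y| <= K * expR (2^-1 * sqn y)) ->
  (forall t y, 0 <= t -> t <= T -> `|g t y| <= c * (1 + sqn y) * `|v t y|) ->
  (forall m n q s t M, 0 <= s -> s <= t -> t <= T ->
    (forall r, s <= r -> r <= t -> drift m.+3 (radius n) (v r) (g r) (ratv q) <= M) ->
    avg m.+3 (radius n) (v t) (ratv q) - avg m.+3 (radius n) (v s) (ratv q) <= M * (t - s)) ->
  subevolution v g 0 T.
Proof.
move=> K0 c0 mv mg vK gv H [|[|[|m]]] n x s t M //= _ s0 st tT FM.
have [dl0 dl1] := (ltW (radius_gt0 (R := R) n), radius_le1 (R := R) n).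
pose r := sqn x + 2.
have cx : cube r x by apply: cubeS (cube_sqn x); rewrite /r; lra.
have vB q y : 0 <= q -> q <= T -> cube (r + 1) y -> `|v q y| <= vbound (d := d) K (r + 1).
  move=> h1 h2 cy; rewrite (le_trans (vK q y h1 h2))//.
  by rewrite ler_wpM2l// ler_expR ler_wpM2l// sqn_cube.
have gB q y : 0 <= q -> q <= T -> cube (r + 1) y -> `|g q y| <= gbound (d := d) K c (r + 1).
  move=> h1 h2 cy; rewrite (le_trans (gv q y h1 h2))//.
  rewrite ler_pM// ?vB// ?mulr_ge0 ?addr_ge0 ?sqn_ge0//.
  by rewrite ler_wpM2l// lerD2l sqn_cube.
pose C (k : nat) (B : R) : R := B * (k%:R * (d%:R * (4 * r + 2))) * vol (d := d) (r + 1).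
have lipv (j : nat) q h x' : (0 < j)%N -> 0 <= q -> q <= T -> cube r x' ->
    (forall i, `|x ord0 i - x' ord0 i| <= h) ->
    `|avg j (radius n) (v q) x - avg j (radius n) (v q) x'| <= C j (vbound (d := d) K (r + 1)) * h.
  move=> j0 h1 h2 cx' xx'.
  have -> : C j (vbound (d := d) K (r + 1)) * h = vbound (d := d) K (r + 1) *
    (j%:R * (d%:R * (h * (4 * r + 2)))) * vol (d := d) (r + 1) by rewrite /C; ring.
  by apply: avg_lip => //; [exact: mv|move=> y; exact: vB].
have lipg (j : nat) q h x' : (0 < j)%N -> 0 <= q -> q <= T -> cube r x' ->
    (forall i, `|x ord0 i - x' ord0 i| <= h) ->
    `|avg j (radius n) (g q) x - avg j (radius n) (g q) x'| <= C j (gbound (d := d) K c (r + 1)) * h.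
  move=> j0 h1 h2 cx' xx'.
  have -> : C j (gbound (d := d) K c (r + 1)) * h = gbound (d := d) K c (r + 1) *
    (j%:R * (d%:R * (h * (4 * r + 2)))) * vol (d := d) (r + 1) by rewrite /C; ring.
  by apply: avg_lip => //; [exact: mg|move=> y; exact: gB].
set V := vbound (d := d) K (r + 1) in lipv; set G := gbound (d := d) K c (r + 1) in lipg.
pose a : R := 4 * m.+3%:R * m.+2%:R; pose b : R := 2 * m.+3%:R * d%:R.
pose dl : R := radius n.
pose CF := 2^-1 * (a * (dl ^+ 2 * C m.+1 V + C m.+2 V) + b * C m.+2 V) + C m.+3 G.
apply: (@le_of_le_small _ _ _ (2 * C m.+3 V + CF * (t - s)) 1) => // h h0 h1.
have [q xq] := ratv_dense x h h0.
have cq : cube r (ratv q).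
  move=> i; have xi := cube_sqn x i; have := xq i.
  have := lerB_dist (ratv q ord0 i) (x ord0 i); rewrite distrC /r; lra.
have tT0 : 0 <= t by exact: le_trans st.
have sT : s <= T by exact: le_trans tT.
have FMq r' : s <= r' -> r' <= t -> drift m.+3 (radius n) (v r') (g r') (ratv q) <= M + CF * h.
  move=> sr rt; have r0 : 0 <= r' by exact: le_trans sr.
  have rT : r' <= T by exact: le_trans tT.
  have := FM r' sr rt.
  have := lipv m.+1 r' h _ isT r0 rT cq xq.
  have := lipv m.+2 r' h _ isT r0 rT cq xq.
  have := lipg m.+3 r' h _ isT r0 rT cq xq.
  rewrite /drift /lapavg /= -/a -/b -/dl /CF.
  move: (avg m.+1 dl _ _) (avg m.+1 dl _ _) => A1 B1.
  move: (avg m.+2 dl _ _) (avg m.+2 dl _ _) => A2 B2.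
  move: (avg m.+3 dl _ _) (avg m.+3 dl _ _) => A3 B3.
  move: (C m.+1 V) (C m.+2 V) (C m.+3 G) => C1 C2 C3.
  rewrite !ler_norml => /andP[l3 l3'] /andP[l2 l2'] /andP[l1 l1'] FM'.
  have a0 : 0 <= 2^-1 * a by rewrite /a !mulr_ge0.
  have b0 : 0 <= 2^-1 * b by rewrite /b !mulr_ge0.
  have ad : 0 <= 2^-1 * a * dl ^+ 2 by rewrite mulr_ge0 ?sqr_ge0.
  have k1 := ler_wpM2l ad l1; have k2 := ler_wpM2l a0 l2'; have k3 := ler_wpM2l b0 l2'.
  move: k1 k2 k3 FM'; move: (dl ^+ 2) (a) (b) => D a' b' k1 k2 k3 FM'.
  lra.
have := H m n q s t _ s0 st tT FMq.
have := lipv m.+3 t h _ isT tT0 tT cq xq.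
have := lipv m.+3 s h _ isT s0 sT cq xq.
move: (avg m.+3 _ (v t) _) (avg m.+3 _ (v t) _) => A1 B1.
move: (avg m.+3 _ (v s) _) (avg m.+3 _ (v s) _) => A2 B2.
rewrite !ler_norml => /andP[l1 l1'] /andP[l2 l2'] H'.
move: H'; move: (C m.+3 V) l1 l1' l2 l2' (CF) => C1 l1 l1' l2 l2' CF' H'.
lra.
Qed.

End weak_formulation.

(** A countable union of negligible sets is negligible. *)
Lemma ae_forall_countable d0 (T : measurableType d0) (R : realType)
    (P : {measure set T -> \bar R}) (K : countType) (Q : K -> T -> Prop) :
  (forall k, {ae P, forall w, Q k w}) -> {ae P, forall w, forall k, Q k w}.
Proof.
move=> H; pose Q' j w := if unpickle j is Some k then Q k w else True.
have : {ae P, forall w, forall j, Q' j w}.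
  apply/ae_foralln => j; rewrite /Q'; case: (unpickle j) => [k|]; first exact: H.
  exact: aeW.
by apply: filterS => w Hw k; have := Hw (pickle k); rewrite /Q' pickleK.
Qed.

Section paths.
Context {R : realType} {d : nat}.
Implicit Types (x y : 'rV[R]_d) (u : R -> 'rV[R]_d -> R).
Let mu := lebesgue_rv R d.
Local Notation leb := (@lebesgue_measure R).

Lemma local_lipschitz_continuous (f L : R -> R) : local_lipschitz f L -> continuous f.
Proof.
move=> [L0 _ fL] a; apply/cvgrPdist_le => e e0.
pose r := `|a| + 1; have r0 : 0 <= r by rewrite addr_ge0.
have Lr : 0 < L r + 1 by rewrite ltr_wpDl// L0.
pose h := Num.min 1 (e / (L r + 1)).
have h0 : 0 < h by rewrite lt_min ltr01 divr_gt0.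
near=> b.
have ab : `|a - b| <= h.
  near: b; apply/nbhs_ballP; exists h => // b; rewrite /ball /=; exact: ltW.
have ab1 : `|a - b| <= 1 by rewrite (le_trans ab)// ge_min lexx.
have abe : `|a - b| <= e / (L r + 1) by rewrite (le_trans ab)// ge_min lexx orbT.
rewrite (le_trans (fL r a b _ _))//.
- by rewrite /r lerDl.
- by rewrite /r; have := ler_normB a (a - b); rewrite opprB addrCA subrr addr0; lra.
rewrite (@le_trans _ _ ((L r + 1) * `|a - b|))//; first by rewrite ler_wpM2r// lerDl.
by rewrite mulrC -ler_pdivlMr.
Unshelve. all: by end_near. Qed.

Lemma enorm_sqr x : enorm x ^+ 2 = sqn x.
Proof. by rewrite sqr_sqrtr// sqn_ge0. Qed.

(** What a single sample of a weak solution is known to satisfy almost surely: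
    the weak formulation for countably many bumps. *)
Definition solution_path (f : R -> R) (nu T : R)
    (I : nat -> nat -> 'rV[rat]_d -> R -> R) u : Prop :=
  [/\ measurable_fun (`[0, T] `*` [set: 'rV[R]_d]) (fun z : R * 'rV[R]_d => u z.1 z.2),
      exists K : R, forall t y, 0 <= t <= T -> `|u t y| <= K * expR (enorm y `^ nu) &
      forall m n q, let phi := bump m.+3 (radius n) (ratv q) in
      [/\ (leb \x mu)%E.-integrable (`[0, T] `*` setT)
            (fun z => (u z.1 z.2 * (2^-1 * laplacian phi z.2))%:E),
          (leb \x mu)%E.-integrable (`[0, T] `*` setT)
            (fun z => (f (u z.1 z.2) * phi z.2)%:E) &
          forall t, 0 <= t <= T ->
            \int[mu]_y (u t y * phi y) - \int[mu]_y (u 0 y * phi y) =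
            \int[leb]_(s in `[0, t]) \int[mu]_y (u s y * (2^-1 * laplacian phi y)) +
            \int[leb]_(s in `[0, t]) \int[mu]_y (f (u s y) * phi y) + I m n q t]].

(** The hypotheses of [evolution_unique] for u1 - u2; the inequality for u2 - u1
    comes from exchanging the two paths. *)
Lemma pathwise_unique (f L : R -> R) (eps nu T : R) u1 u2
    (I : nat -> nat -> 'rV[rat]_d -> R -> R) :
  local_lipschitz f L -> 0 < eps -> 0 < nu -> nu < 2 -> nu * (1 + eps) <= 2 ->
  L r / ln r `^ (1 + eps) @[r --> +oo] --> 0 ->
  (forall y, u1 0 y = u2 0 y) ->
  (forall u, u = u1 \/ u = u2 -> solution_path f nu T I u) ->
  forall t, 0 <= t <= T -> {ae mu, forall y, u1 t y = u2 t y}.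
Proof.
move=> fL e0 nu0 nu2 nue Lg init H.
have [L0 Lmono fLip] := fL.
have mf : measurable_fun setT f.
  by apply: continuous_measurable_fun; exact: local_lipschitz_continuous fL.
have [C C0 hC] := expR_powR_le nu nu0 nu2.
have en0 y : 0 <= enorm y :> R by exact: sqrtr_ge0.
have reg u : u = u1 \/ u = u2 -> forall t, 0 <= t <= T ->
    [/\ measurable_fun setT (u t), locally_bounded (u t),
        measurable_fun setT (f \o u t) & locally_bounded (f \o u t)].
  move=> /H [mu_ [K uK] _] t tT.
  have mut : measurable_fun setT (u t).
    apply: (@measurable_comp _ _ _ _ _ _ (`[0, T] `*` [set: 'rV[R]_d])
      (fun z : R * 'rV[R]_d => u z.1 z.2) _ (fun y => (t, y))) => //.
    - by apply: measurableX.
    - by move=> _ [y _ <-]; split => //=; rewrite in_itv.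
    - exact: measurable_pair1.
  have lut : locally_bounded (u t).
    move=> r; exists (`|K| * (C * expR (2^-1 * (d%:R * r ^+ 2)))) => y cy.
    rewrite (le_trans (uK t y tT))// (@le_trans _ _ (`|K| * expR (enorm y `^ nu)))//.
      by rewrite ler_wpM2r ?expR_ge0// ler_norm.
    rewrite ler_wpM2l// (le_trans (hC _ (en0 y)))// ler_wpM2l// ler_expR ler_wpM2l//.
    by rewrite enorm_sqr sqn_cube.
  split => //; first exact: measurableT_comp.
  move=> r; have [M uM] := lut r; exists (`|f 0| + L `|M| * `|M|) => y cy.
  have yM : `|u t y| <= `|M| by rewrite (le_trans (uM y cy))// ler_norm.
  have -> : (f \o u t) y = f 0 + (f (u t y) - f 0) by rewrite addrC subrK.
  rewrite (le_trans (ler_normD _ _))// lerD2l.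
  rewrite (le_trans (fLip `|M| _ _ yM _))//; first by rewrite normr0.
  by rewrite subr0 ler_wpM2l// L0.
have [_ [K1 uK1] eq1] := H u1 (or_introl erefl).
have [_ [K2 uK2] eq2] := H u2 (or_intror erefl).
have [A [c [KA A0 c0 LA]]] := log_growth_quadratic L eps nu e0 nu0 nue Lg (Num.max K1 K2).
have uA u : u = u1 \/ u = u2 -> forall t y, 0 <= t <= T -> `|u t y| <= A * expR (enorm y `^ nu).
  move=> [->|->] t y tT.
    by rewrite (le_trans (uK1 t y tT))// ler_wpM2r ?expR_ge0// (le_trans _ KA)// le_max lexx.
  by rewrite (le_trans (uK2 t y tT))// ler_wpM2r ?expR_ge0// (le_trans _ KA)// le_max lexx orbT.
have incr u : u = u1 \/ u = u2 -> forall m n q,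
    leb.-integrable `[0, T] (EFin \o (fun s => drift m.+3 (radius n) (u s) (f \o u s) (ratv q))) /\
    forall t, 0 <= t <= T -> avg m.+3 (radius n) (u t) (ratv q) - avg m.+3 (radius n) (u 0) (ratv q) =
      \int[leb]_(s in `[0, t]) drift m.+3 (radius n) (u s) (f \o u s) (ratv q) + I m n q t.
  move=> hu m n q; have [_ _ /(_ m n q) [i1 i2 eqn]] := H u hu.
  apply: weak_increment => //; [exact/ltW/radius_gt0|exact: radius_le1|].
  by move=> t tT; have [] := reg u hu t tT.
have vK u v t y : u = u1 \/ u = u2 -> v = u1 \/ v = u2 -> 0 <= t -> t <= T ->
    `|u t y - v t y| <= (A * C + A * C) * expR (2^-1 * sqn y).
  move=> hu hv t0 tT; have tI : 0 <= t <= T by rewrite t0 tT.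
  have b : A * expR (enorm y `^ nu) <= A * C * expR (2^-1 * sqn y).
    by rewrite -mulrA ler_wpM2l// -enorm_sqr hC.
  rewrite (le_trans (ler_normB _ _))// mulrDl lerD//.
    exact: le_trans (uA u hu t y tI) b.
  exact: le_trans (uA v hv t y tI) b.
have gK u v t y : u = u1 \/ u = u2 -> v = u1 \/ v = u2 -> 0 <= t -> t <= T ->
    `|f (u t y) - f (v t y)| <= c * (1 + sqn y) * `|u t y - v t y|.
  move=> hu hv t0 tT; have tI : 0 <= t <= T by rewrite t0 tT.
  rewrite (le_trans (fLip _ _ _ (uA u hu t y tI) (uA v hv t y tI)))//.
  by rewrite ler_wpM2r// -enorm_sqr LA.
have K0 : 0 <= A * C + A * C by rewrite addr_ge0// mulr_ge0.
have sub u v : u = u1 \/ u = u2 -> v = u1 \/ v = u2 ->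
    subevolution (fun t y => u t y - v t y) (fun t y => f (u t y) - f (v t y)) 0 T.
  move=> hu hv; apply: (subevolution_of_rational _ _ _ _ _ K0 (ltW c0)).
  - move=> t t0 tT; have tI : 0 <= t <= T by rewrite t0 tT.
    have [a _ _ _] := reg u hu t tI; have [b _ _ _] := reg v hv t tI.
    exact: measurable_funB.
  - move=> t t0 tT; have tI : 0 <= t <= T by rewrite t0 tT.
    have [_ _ a _] := reg u hu t tI; have [_ _ b _] := reg v hv t tI.
    exact: measurable_funB.
  - by move=> t y; exact: vK.
  - by move=> t y; exact: gK.
  move=> m n q s t M s0 st tT FM.
  exact: (difference_increment m (radius n) T M s t u v f (I m n q) (ratv q)
    (ltW (radius_gt0 n)) (radius_le1 n) (reg u hu) (reg v hv)
    (incr u hu m n q) (incr v hv m n q) s0 st tT FM).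
have h1 : u1 = u1 \/ u1 = u2 by left.
have h2 : u2 = u1 \/ u2 = u2 by right.
have EV : evolution (A * C + A * C) c (fun t y => u1 t y - u2 t y)
    (fun t y => f (u1 t y) - f (u2 t y)) 0 T.
  split.
  - move=> t t0 tT; have tI : 0 <= t <= T by rewrite t0 tT.
    have [a _ _ _] := reg u1 h1 t tI; have [b _ _ _] := reg u2 h2 t tI.
    exact: measurable_funB.
  - move=> t t0 tT; have tI : 0 <= t <= T by rewrite t0 tT.
    have [_ _ a _] := reg u1 h1 t tI; have [_ _ b _] := reg u2 h2 t tI.
    exact: measurable_funB.
  - by move=> t y; exact: vK.
  - by move=> t y; exact: gK.
  - exact: sub.
  - rewrite (_ : (fun t y => - (u1 t y - u2 t y)) = fun t y => u2 t y - u1 t y); last first.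
      by apply/funext => t; apply/funext => y; rewrite opprB.
    rewrite (_ : (fun t y => - (f (u1 t y) - f (u2 t y))) = fun t y => f (u2 t y) - f (u1 t y)); last first.
      by apply/funext => t; apply/funext => y; rewrite opprB.
    exact: sub.
move=> t /andP[t0 tT].
have i0 : {ae mu, forall y, u1 0 y - u2 0 y = 0}.
  by apply: aeW => y; rewrite init subrr.
apply: filterS (evolution_unique _ _ _ _ _ K0 c0 EV i0 t t0 tT) => y /eqP.
by rewrite subr_eq0 => /eqP.
Qed.

End paths.

Theorem theorem2p7 (R : realType) (d' : measure_display)
    (Omega : measurableType d') (P : probability Omega R)
    (d : nat) (d_gt0 : (0 < d)%N) (sigma : R)
    (f L : R -> R) (Ff : assumption_F f L)
    (Lam : ('rV[R]_d -> R) -> R) (mu : {measure set 'rV[R]_d -> \bar R})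
    (covLam : spatial_covariance Lam mu)
    (W : (R * 'rV[R]_d -> R) -> {RV P >-> R})
    (noiseW : gaussian_noise Lam W)
    (u0 : 'rV[R]_d -> R) (Iu0 : assumption_I u0)
    (eps : R) (eps01 : 0 < eps < 1)
    (L_growth : L r / ln r `^ (1 + eps) @[r --> +oo] --> 0)
    (nu : R) (nu_bound : 0 < nu < 2 / (1 + eps))
    (T : R) (T_gt0 : 0 < T)
    (u1 u2 : R -> 'rV[R]_d -> Omega -> R)
    (sol1 : weak_solution mu W f sigma T u1)
    (sol2 : weak_solution mu W f sigma T u2)
    (init1 : has_initial_data P u0 u1)
    (init2 : has_initial_data P u0 u2)
    (growth1 : growth_condition P T nu u1)
    (growth2 : growth_condition P T nu u2) :
  {ae P, forall w, forall t, 0 <= t <= T ->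
     {ae lebesgue_rv R d, forall x, u1 t x w = u2 t x w}}.
Proof.
have /andP[e0 e1] := eps01; have /andP[nu0 nue] := nu_bound.
have e10 : 0 < 1 + eps by lra.
have nue' : nu * (1 + eps) < 2 by rewrite -ltr_pdivlMr.
have nu2 : nu < 2 by rewrite (le_lt_trans _ nue')// ler_peMr ?(ltW nu0)//; lra.
have bound (u : R -> 'rV[R]_d -> Omega -> R) : growth_condition P T nu u -> {ae P, forall w, exists K : R,
    forall t y, 0 <= t <= T -> `|u t y w| <= K * expR (enorm y `^ nu)}.
  apply: filterS => w; set S := [set _ | _ in _] => supS.
  exists (fine (ereal_sup S)) => t y tT.
  have inS : S (`|u t y w| * expR (- (enorm y `^ nu)))%:E.
    by exists (t, y) => //; split => //=; rewrite in_itv.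
  have h := ereal_sup_ubound inS.
  have fS : ereal_sup S \is a fin_num.
    by rewrite fin_numElt supS andbT (lt_le_trans _ h)// ltNyr.
  move: h; rewrite -[ereal_sup S]fineK// lee_fin expRN ler_pdivrMr ?expR_gt0//.
pose I w m n q t := walsh_integral mu W
  (fun x => sigma * bump m.+3 (radius n) (ratv q) x) t w.
have path (u : R -> 'rV[R]_d -> Omega -> R) : weak_solution mu W f sigma T u ->
    growth_condition P T nu u ->
    {ae P, forall w, solution_path f nu T (I w) (fun t y => u t y w)}.
  move=> [[_ mu_] sol] gr.
  have solk (k : nat * nat * 'rV[rat]_d) := sol (bump k.1.1.+3 (radius k.1.2) (ratv k.2))
    (class_C2_bump _ _ _)
    (compact_support_bump _ _ _ (ltW (radius_gt0 _)) (radius_le1 _)).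
  have sola := ae_forall_countable _ _ _ P _ _ solk.
  apply: filterS3 mu_ (bound u gr) sola => w m1 b1 q1; split => // m n q.
  by have [_ B C D] := q1 (m, n, q).
have init : {ae P, forall w, forall y, u1 0 y w = u2 0 y w}.
  by apply: filterS2 init1 init2 => w h1 h2 y; rewrite h1 h2.
apply: filterS3 init (path u1 sol1 growth1) (path u2 sol2 growth2) => w i0 p1 p2.
apply: (pathwise_unique f L eps nu T (fun t y => u1 t y w) (fun t y => u2 t y w)
  (I w) Ff.1 e0 nu0 nu2 (ltW nue') L_growth i0).
by move=> u [->|->].
Qed.
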